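(* Let $\mathbb{G}$ be a stratified group, let $\Omega\subset\mathbb{G}$ be open, and let $u=U+P:\Omega\to\mathbb{R}$, where $U:\Omega\to\mathbb{R}$ is h-convex and $P$ is a polynomial on $\mathbb{G}$ of homogeneous degree at most $2$. Let $\lambda=\max_{\|w\|=1}|P^{(2)}(w)|$, where $P^{(2)}$ is the $2$-homogeneous part of $P$. Then for every $x\in\Omega$ and every $h$ such that $[0,h]\subseteq H_1\cap x^{-1}\Omega$, there exist $t\in[0,1]$ and $p\in\partial_H^\lambda u(x\delta_th)$ such that $$u(xh)-u(x)=\langle p,h\rangle.$$
   Context: Stratified group: $\mathbb{G}=H_1\oplus\cdots\oplus H_\iota$ is a finite dimensional graded vector space with a polynomial group operation given by the Baker-Campbell-Hausdorff formula (so $\mathbb{G}$ is identified with its stratified Lie algebra via exponential coordinates; the unit element is $0$, and the first layer $H_1$ generates the Lie algebra). Dilations: $\delta_r(x)=\sum_jr^jx_{(j)}$ if $x=\sum_jx_{(j)}$, $x_{(j)}\in H_j$. A scalar product $\langle\cdot,\cdot\rangle$ is fixed on $\mathbb{G}$ making the $H_j$ mutually orthogonal. A homogeneous distance $d$ is fixed: a continuous metric with $d(ux,uy)=d(x,y)$ and $d(\delta_rx,\delta_ry)=r\,d(x,y)$ for $r>0$; $\|w\|=d(0,w)$. Polynomials: fix graded linear coordinates $(x_1,\dots,x_n)$ (associated with a basis of $\mathbb{G}$ that is a union of bases of the $H_s$) and give $x_i$ the degree $d_i=s$ if the $i$-th basis vector lies in $H_s$. A polynomial $P=\sum_\alpha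 c_\alpha x^\alpha$ has homogeneous degree $\max\{\sum_id_i\alpha_i\}$ over the multi-indices that occur, and its $j$-homogeneous part $P^{(j)}$ is the sum of the terms with $\sum_id_i\alpha_i=j$. For $h\in H_1$ put $[0,h]=\{th:0\le t\le1\}$ and $x\cdot[0,h]=\{x\delta_th:0\le t\le1\}$. A function $U:\Omega\to\mathbb{R}$ is h-convex if for all $x,y\in\Omega$ with $x^{-1}y\in H_1$ and $x\cdot[0,x^{-1}y]\subset\Omega$ one has $U(x\delta_s(x^{-1}y))\le sU(y)+(1-s)U(x)$ for all $s\in[0,1]$. All h-convex functions are assumed measurable; they are then locally Lipschitz with respect to $d$ (Rickly). For $\lambda\ge0$, the $\lambda$-subdifferential $\partial_H^\lambda u(x)$ of $u:\Omega\to\mathbb{R}$ at $x\in\Omega$ is the set of $p\in H_1$ such that $u(xh)\ge u(x)+\langle p,h\rangle-\lambda\|h\|^2$ whenever $[0,h]\subseteq H_1\cap x^{-1}\Omega$. *)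

(* Defs.v *)
From HB Require Import structures.
From mathcomp Require Import all_boot all_order all_algebra.
From mathcomp Require Import all_classical all_reals all_analysis.
From mathcomp Require mpoly.

Set Implicit Arguments.
Unset Strict Implicit.
Unset Printing Implicit Defensive.

Import Order.TTheory GRing.Theory Num.Theory.
Import numFieldNormedType.Exports.

Local Open Scope classical_set_scope.
Local Open Scope ring_scope.

(* The underlying vector space is 'rV[R]_n in graded linear coordinates: the
   i-th vector of the standard basis lies in the layer H_(deg i). *)

Section GradedSpace.
Variables (R : realType) (n : nat) (deg : 'I_n -> nat).
Implicit Types (x : 'rV[R]_n) (r : R).

Definition layer (s : nat) : set 'rV[R]_n :=
  [set x | forall i, deg i <> s -> x 0 i = 0].

Definition dil r x : 'rV[R]_n := \row_i (r ^+ deg i * x 0 i).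

End GradedSpace.

Section BCH.
Variables (R : realType) (n : nat).
Variable lie : 'rV[R]_n -> 'rV[R]_n -> 'rV[R]_n.

(* [w_1, [w_2, ... [w_(m-1), w_m]]] *)
Fixpoint nested_bracket (w : seq 'rV[R]_n) : 'rV[R]_n :=
  match w with
  | [::] => 0
  | [:: a] => a
  | a :: w' => lie a (nested_bracket w')
  end.

(* Baker-Campbell-Hausdorff formula in Dynkin's form,
     \sum_(k >= 1) (-1)^(k-1) / k \sum_(r_j + s_j > 0)
        [x^(r_1) y^(s_1) ... x^(r_k) y^(s_k)]
        / ((\sum_j (r_j + s_j)) \prod_j r_j! s_j!).
   The truncation k, r_j, s_j <= step loses nothing for a Lie algebra that is
   nilpotent of step at most step: every omitted term is an iterated bracket
   of more than step elements. The index k below is shifted by one. *)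
Definition bch (step : nat) (x y : 'rV[R]_n) : 'rV[R]_n :=
  \sum_(k < step)
   \sum_(f : {ffun 'I_k.+1 -> 'I_step.+1 * 'I_step.+1}
           | [forall j, (0 < (f j).1 + (f j).2)%N])
     ((-1) ^+ k / (k.+1%:R * (\sum_j ((f j).1 + (f j).2))%N%:R
                   * (\prod_j (((f j).1)`! * ((f j).2)`!))%N%:R))
     *: nested_bracket
          (flatten [seq nseq (f j).1 x ++ nseq (f j).2 y | j <- enum 'I_k.+1]).

End BCH.

(* Associativity, unit and inverse are redundant given gmulE; they are listed
   because the group law is part of the data of a stratified group. *)
Record stratifiedGroup (R : realType) (n : nat) := StratifiedGroup {
  step : nat;
  deg : 'I_n -> nat;
  deg_bounds : forall i, (1 <= deg i <= step)%N;
  lie : 'rV[R]_n -> 'rV[R]_n -> 'rV[R]_n;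
  lieDl : forall (a : R) x y z, lie (a *: x + y) z = a *: lie x z + lie y z;
  lieDr : forall (a : R) x y z, lie z (a *: x + y) = a *: lie z x + lie z y;
  lie_alt : forall x, lie x x = 0;
  lie_jacobi :
    forall x y z, lie x (lie y z) + lie y (lie z x) + lie z (lie x y) = 0;
  lie_graded : forall s t x y,
    layer deg s x -> layer deg t y -> layer deg (s + t) (lie x y);
  lie_generated : forall W : {vspace 'rV[R]_n},
    (forall x, layer deg 1 x -> x \in W) ->
    (forall x y, x \in W -> y \in W -> lie x y \in W) ->
    W = fullv;
  gmul : 'rV[R]_n -> 'rV[R]_n -> 'rV[R]_n;
  gmulE : forall x y, gmul x y = bch lie step x y;
  gmulA : associative gmul;
  gmul0x : left_id 0 gmul;
  gmulNx : left_inverse 0 -%R gmul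
}.

Section LebesgueMeasurability.
Variables (R : realType) (n : nat).
Implicit Types (a b : 'rV[R]_n) (A N : set 'rV[R]_n).

Definition box a b : set 'rV[R]_n := [set x | forall i, a 0 i <= x 0 i <= b 0 i].

Definition box_volume a b : R := \prod_i (b 0 i - a 0 i).

Definition lebesgue_null N : Prop :=
  forall e : R, 0 < e -> exists a b : nat -> 'rV[R]_n,
    [/\ forall k i, a k 0 i <= b k 0 i,
        N `<=` \bigcup_k box (a k) (b k) &
        (\sum_(0 <= k <oo) (box_volume (a k) (b k))%:E <= e%:E)%E].

(* completion of the Borel sigma-algebra of R^n *)
Definition lebesgue_measurable A : Prop :=
  exists B, <<s open >> B /\ lebesgue_null ((A `\` B) `|` (B `\` A)).

Definition lebesgue_measurable_fun (D : set 'rV[R]_n) (U : 'rV[R]_n -> R) :=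
  forall r : R, lebesgue_measurable (D `&` [set x | U x < r]).

End LebesgueMeasurability.

Section Polynomials.
Variables (R : realType) (n : nat) (deg : 'I_n -> nat).
Implicit Types (P : mpoly.mpoly n R) (m : mpoly.multinom n).

Definition poly_fun P (x : 'rV[R]_n) : R := mpoly.meval (fun i => x 0 i) P.

Definition hdeg_monomial m : nat := \sum_i deg i * mpoly.fun_of_multinom m i.

Definition hdeg_le P (k : nat) : Prop :=
  forall m, mpoly.mcoeff m P != 0 -> (hdeg_monomial m <= k)%N.

(* the j-homogeneous part of P, as a function *)
Definition homog_part (j : nat) P (x : 'rV[R]_n) : R :=
  \sum_(m <- mpoly.msupp P | hdeg_monomial m == j)
    mpoly.mcoeff m P * \prod_i x 0 i ^+ mpoly.fun_of_multinom m i.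

End Polynomials.

Section StratifiedGroupNotions.
Variables (R : realType) (n : nat) (G : stratifiedGroup R n).
Implicit Types (x y h p w : 'rV[R]_n) (Omega : set 'rV[R]_n).
Implicit Types (u U : 'rV[R]_n -> R).

Definition H1 : set 'rV[R]_n := layer (deg G) 1.

Definition scalar_product (ip : 'rV[R]_n -> 'rV[R]_n -> R) : Prop :=
  [/\ forall (a : R) x y z, ip (a *: x + y) z = a * ip x z + ip y z,
      forall x y, ip x y = ip y x,
      forall x, x != 0 -> 0 < ip x x &
      forall s t x y, s <> t -> layer (deg G) s x -> layer (deg G) t y ->
        ip x y = 0].

Definition metric (d : 'rV[R]_n -> 'rV[R]_n -> R) : Prop :=
  [/\ forall x y, 0 <= d x y,
      forall x y, d x y = 0 <-> x = y,
      forall x y, d x y = d y x &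
      forall x y z, d x z <= d x y + d y z].

Definition homogeneous_distance (d : 'rV[R]_n -> 'rV[R]_n -> R) : Prop :=
  [/\ metric d,
      continuous (fun z : 'rV[R]_n * 'rV[R]_n => d z.1 z.2),
      forall w x y, d (gmul G w x) (gmul G w y) = d x y &
      forall (r : R) x y, 0 < r ->
        d (dil (deg G) r x) (dil (deg G) r y) = r * d x y].

Definition hnorm (d : 'rV[R]_n -> 'rV[R]_n -> R) w : R := d 0 w.

(* [0,h], meant for h in H1 *)
Definition segment0 h : set 'rV[R]_n := [set t *: h | t in `[0 : R, 1]].

Definition ltrans x Omega : set 'rV[R]_n := gmul G x @` Omega.

Definition hconvex Omega U : Prop :=
  forall x y, Omega x -> Omega y ->
    let h := gmul G (- x) y in
    H1 h -> ltrans x (segment0 h) `<=` Omega ->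
    forall s : R, 0 <= s <= 1 ->
      U (gmul G x (dil (deg G) s h)) <= s * U y + (1 - s) * U x.

Definition subdifferential (ip d : 'rV[R]_n -> 'rV[R]_n -> R) (lambda : R)
    Omega u x : set 'rV[R]_n :=
  [set p | H1 p /\ forall h, segment0 h `<=` H1 `&` ltrans (- x) Omega ->
    u (gmul G x h) >= u x + ip p h - lambda * hnorm d h ^+ 2].

(* The unit sphere of a homogeneous distance is compact, so that the supremum
   is a maximum (unless n = 0, where the sphere is empty and sup is 0). *)
Definition lambda_max (d : 'rV[R]_n -> 'rV[R]_n -> R)
    (P : mpoly.mpoly n R) : R :=
  sup [set `|homog_part (deg G) 2 P w| | w in [set w | hnorm d w = 1]].

End StratifiedGroupNotions.

(* Main.v *)
Require Import Defs.
From HB Require Import structures.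
From mathcomp Require Import all_boot all_order all_algebra perm.
From mathcomp Require Import all_classical all_reals all_analysis measurable_realfun.
From mathcomp Require mpoly.
Import (canonicals) mpoly.
From mathcomp Require Import ring lra.

Set Implicit Arguments.
Unset Strict Implicit.
Unset Printing Implicit Defensive.

Import Order.TTheory GRing.Theory Num.Theory.
Import numFieldNormedType.Exports.

Local Open Scope classical_set_scope.
Local Open Scope ring_scope.

(** The proof is that of Rolle's theorem. Restrict [u] to the segment from [x] to [xh] and subtract
    the linear interpolation of its end values. The resulting function of one variable takes the
    same value at both ends, so that it has an interior extremum, at the point [y] say
    ([interior_extremum]). Along a horizontal line through [y] the polynomial is an affine function
    plus [t ^ 2] times the value of its 2-homogeneous part at the direction ([poly_expansion]), and
    the quadratic term is invisible to first order. Comparing one-sided derivatives at [y] thus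
    shows that the number [s] which the mean value formula requires of a subgradient of [U] in
    direction [h] lies between [- slope (- h)] and [slope h], the one-sided derivatives of [U].

    It remains to find a linear form on the first layer that is bounded by the slope of [U] at [y]
    and takes the value [s] at [h]. It exists by the Hahn-Banach theorem ([hahn_banach_row]),
    provided that the slope is a sublinear function of the direction, and it is represented by a
    horizontal vector [p] because the layers are orthogonal ([riesz_H1]). By convexity the
    increments of [U] dominate the slope, so [p] is a subgradient of [U]
    ([subgradient_exists]). Adding the linear term of [P] makes it a subgradient of [u] up to the
    2-homogeneous part of [P], which is at least [- lambda ||h||^2] by homogeneity
    ([homog_part_ge]).

    The subadditivity of the slope ([slope_subadditive]) relates directions that do not commute.
    The point [y t(k + k')] is the limit of staircases with steps in the directions [k] and [k']
    ([trotter]); along them [U] grows at most with the sum of the two slopes, the slope being upper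
    semicontinuous in the base point. This uses the continuity of [U].

    Continuity has to be derived from measurability ([hconvex_continuous]). The conjugates of the
    first layer under products of horizontal elements span the Lie algebra
    ([gconj_horizontal_span]): their span is stable under brackets with the first layer. Hence there
    is a word of horizontal letters such that rescaling the letters moves the end point in all
    directions, and this remains possible after any change of signs of the letters
    ([flip_frame_basis_exists]). Now the value of [U] at a point [z] is bounded by the largest of
    its values at the end points of the words with modified signs that start at [z] ([le_flips]). If
    [U z] were large, each word near the given one would for some signs end in the set where [U] is
    large. That set has small measure, since [U] is measurable and finite, and the end point maps
    pull back small sets to small sets ([lipschitz_preimage]); this is a contradiction, and [U] is
    locally bounded above. A convex function of one variable that is bounded above on an interval
    has small increments well inside the interval, and nearby points are joined by boundedly many
    short horizontal steps ([horizontal_products_near0]). So [U] is continuous. *)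

(** * The Baker-Campbell-Hausdorff product to second order *)

Section LieBracket.
Variables (R : realType) (n : nat) (G : stratifiedGroup R n).
Implicit Types (x y z : 'rV[R]_n) (a t : R) (w : seq bool).

Lemma lieD_l x y z : lie G (x + y) z = lie G x z + lie G y z.
Proof. by rewrite -{1}(scale1r x) lieDl scale1r. Qed.

Lemma lieD_r x y z : lie G z (x + y) = lie G z x + lie G z y.
Proof. by rewrite -{1}(scale1r x) lieDr scale1r. Qed.

Lemma lie0l z : lie G 0 z = 0.
Proof. by apply: (addrI (lie G 0 z)); rewrite -lieD_l !addr0. Qed.

Lemma lie0r z : lie G z 0 = 0.
Proof. by apply: (addrI (lie G z 0)); rewrite -lieD_r !addr0. Qed.

Lemma lieZl a x z : lie G (a *: x) z = a *: lie G x z.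
Proof. by rewrite -[a *: x]addr0 lieDl lie0l !addr0. Qed.

Lemma lieZr a x z : lie G z (a *: x) = a *: lie G z x.
Proof. by rewrite -[a *: x]addr0 lieDr lie0r !addr0. Qed.

Lemma lieNl x z : lie G (- x) z = - lie G x z.
Proof. by rewrite -scaleN1r lieZl scaleN1r. Qed.

Lemma lieNr x z : lie G z (- x) = - lie G z x.
Proof. by rewrite -scaleN1r lieZr scaleN1r. Qed.

Lemma lie_antisym x y : lie G x y = - lie G y x.
Proof.
apply/eqP; rewrite -subr_eq0 opprK; apply/eqP.
have := lie_alt G (x + y).
by rewrite lieD_l !lieD_r !lie_alt add0r addr0.
Qed.

(** A word of booleans, and not of vectors, so that one list of words serves all [x] and [y]. *)
Definition bracket_word w x y : 'rV[R]_n :=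
  nested_bracket (lie G) [seq (if b then x else y) | b <- w].

Lemma bracket_word_cons b w x y : (0 < size w)%N ->
  bracket_word (b :: w) x y = lie G (if b then x else y) (bracket_word w x y).
Proof. by case: w. Qed.

End LieBracket.

Section DynkinLowOrder.
Variables (R : realType) (n : nat) (G : stratifiedGroup R n).
Implicit Types (x y : 'rV[R]_n).

Let idx s := ('I_s.+1 * 'I_s.+1)%type.

Let dynkin_word s k (f : {ffun 'I_k.+1 -> idx s}) : seq bool :=
  flatten [seq nseq (f j).1 true ++ nseq (f j).2 false | j <- enum 'I_k.+1].

Let dynkin_coef s k (f : {ffun 'I_k.+1 -> idx s}) : R :=
  (-1) ^+ k / (k.+1%:R * (\sum_j ((f j).1 + (f j).2))%N%:R
                   * (\prod_j (((f j).1)`! * ((f j).2)`!))%N%:R).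

Let valid s k (f : {ffun 'I_k.+1 -> idx s}) :=
  [forall j, (0 < (f j).1 + (f j).2)%N].

Let term s k (f : {ffun 'I_k.+1 -> idx s}) x y :=
  dynkin_coef f *: bracket_word G (dynkin_word f) x y.

Let bch_terms s x y : bch (lie G) s x y =
  \sum_(k < s) \sum_(f : {ffun 'I_k.+1 -> idx s} | valid f) term f x y.
Proof.
apply: eq_bigr => k _; apply: eq_bigr => f _; congr (_ *: _).
rewrite /bracket_word /dynkin_word map_flatten -map_comp; congr nested_bracket.
congr flatten; apply: eq_map => j /=.
by rewrite map_cat !map_nseq.
Qed.

Let size_dynkin_word s k (f : {ffun 'I_k.+1 -> idx s}) :
  size (dynkin_word f) = (\sum_j ((f j).1 + (f j).2))%N.
Proof.
rewrite /dynkin_word size_flatten sumnE /shape -map_comp big_map big_enum /=.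
by apply: eq_bigr => j _; rewrite size_cat !size_nseq.
Qed.

Let valid_size s k (f : {ffun 'I_k.+1 -> idx s}) : valid f ->
  (k.+1 <= size (dynkin_word f))%N.
Proof.
move=> /forallP fv; rewrite size_dynkin_word.
apply: (@leq_trans (\sum_(j < k.+1) 1)%N); first by rewrite sum1_card card_ord.
by apply: leq_sum => j _; exact: fv.
Qed.

(* The words are x, y, xy, xx, yy, and the brackets of the last two vanish. *)
Let dynkin_order1 s x y :
  \sum_(f : {ffun 'I_1 -> idx s.+1} | valid f && (size (dynkin_word f) <= 2)%N)
     term f x y = x + y + 2^-1 *: lie G x y.
Proof.
pose c (p : idx s.+1) : {ffun 'I_1 -> idx s.+1} := [ffun=> p].
rewrite (reindex c) /=; last first.
  exists (fun f => f ord0) => [p _|f _]; first by rewrite ffunE.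
  by apply/ffunP => j; rewrite ffunE (ord1 j).
pose p10 : idx s.+1 := (inord 1, inord 0); pose p01 : idx s.+1 := (inord 0, inord 1).
pose p11 : idx s.+1 := (inord 1, inord 1).
have wc p : dynkin_word (c p) = nseq p.1 true ++ nseq p.2 false.
  by rewrite /dynkin_word enum_ordSl enum_ord0 /= ffunE cats0.
have vc p : valid (c p) = (0 < p.1 + p.2)%N.
  by apply/forallP/idP => [/(_ ord0)|h j]; rewrite ffunE.
have v1 : (inord 1 : 'I_s.+2) = 1%N :> nat by rewrite inordK.
have v0 : (inord 0 : 'I_s.+2) = 0%N :> nat by rewrite inordK.
have tc p : term (c p) x y = ((p.1 + p.2) * (p.1`! * p.2`!))%N%:R^-1
      *: bracket_word G (nseq p.1 true ++ nseq p.2 false) x y.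
  by rewrite /term /dynkin_coef wc !big_ord1 expr0 !mul1r !ffunE !natrM.
pose fst_nat (p : idx s.+1) := nat_of_ord p.1.
pose snd_nat (p : idx s.+1) := nat_of_ord p.2.
have n1 : p01 != p10 by apply/eqP => /(congr1 fst_nat); rewrite /fst_nat /= v0 v1.
have n2 : p11 != p10 by apply/eqP => /(congr1 snd_nat); rewrite /snd_nat /= v0 v1.
have n3 : p11 != p01 by apply/eqP => /(congr1 fst_nat); rewrite /fst_nat /= v0 v1.
rewrite (bigD1 p10); last by rewrite vc wc size_cat !size_nseq /= v1 v0.
rewrite (bigD1 p01); last by rewrite n1 vc wc size_cat !size_nseq /= v1 v0.
rewrite (bigD1 p11); last by rewrite n2 n3 vc wc size_cat !size_nseq /= v1.
rewrite big1 ?addr0; last first.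
  move=> [r t] /andP[/andP[/andP[]]]; rewrite vc wc size_cat !size_nseq /=.
  move=> /andP[rt0 rt2] n10 n01 n11; rewrite tc /=.
  have : (nat_of_ord r, nat_of_ord t) = (2, 0)%N \/ (nat_of_ord r, nat_of_ord t) = (0, 2)%N.
    have E (p : idx s.+1) (i j : nat) : (i < s.+2)%N -> (j < s.+2)%N ->
        p != (inord i, inord j) -> ~~ ((p.1 == i :> nat) && (p.2 == j :> nat)).
      move=> hi hj; apply: contraNN => /andP[/eqP pi /eqP pj].
      by case: p pi pj => p1 p2 /= pi pj; rewrite -pi -pj !inord_val.
    have := E (r, t) 1%N 0%N isT isT n10; have := E (r, t) 0%N 1%N isT isT n01.
    have := E (r, t) 1%N 1%N isT isT n11.
    move: {tc wc vc E n10 n01 n11} rt0 rt2 => /=; case: (nat_of_ord r) => [|[|[|r']]];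
      case: (nat_of_ord t) => [|[|[|t']]] //=; rewrite ?addnS ?addn0 ?ltnS //; by auto.
  by case=> -[-> ->]; rewrite /bracket_word /= lie_alt scaler0.
rewrite !tc /= !v1 !v0 /bracket_word /=.
by rewrite invr1 !scale1r addr0 addrA.
Qed.

(* Each of the two blocks is a single letter. Exchanging x and y permutes the terms and, the
   bracket being antisymmetric, changes their signs. *)
Let dynkin_order2 s x y :
  \sum_(f : {ffun 'I_2 -> idx s} | valid f && (size (dynkin_word f) <= 2)%N)
     term f x y = 0.
Proof.
set S := LHS.
suff SN : S = - S.
  have : 2%:R *: S = 0 by rewrite scaler_nat mulr2n {1}SN addNr.
  by move=> /eqP; rewrite scaler_eq0 pnatr_eq0 /= => /eqP.
pose sw (f : {ffun 'I_2 -> idx s}) := [ffun j => ((f j).2, (f j).1)] : {ffun 'I_2 -> idx s}.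
have swK : involutive sw by move=> f; apply/ffunP => j; rewrite !ffunE; case: (f j).
have Ssz f : size (dynkin_word (sw f)) = size (dynkin_word f).
  by rewrite !size_dynkin_word; apply: eq_bigr => j _; rewrite ffunE addnC.
have Svd f : valid (sw f) = valid f.
  by apply: eq_forallb => j; rewrite ffunE addnC.
rewrite /S -sumrN [LHS](reindex_inj (inv_inj swK)) /=.
apply: eq_big => [f|f]; first by rewrite Ssz Svd.
rewrite Ssz Svd => /andP[fv sz]; rewrite /term -scalerN.
have -> : dynkin_coef (sw f) = dynkin_coef f.
  rewrite /dynkin_coef; congr (_ / (_ * _%:R * _%:R)).
    by apply: eq_bigr => j _; rewrite ffunE addnC.
  by apply: eq_bigr => j _; rewrite ffunE mulnC.
congr (_ *: _).
have h0 := forallP fv ord0; have h1 := forallP fv (lift ord0 ord0).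
move: sz; rewrite size_dynkin_word !big_ord_recl big_ord0 addn0 => sz.
rewrite /dynkin_word !enum_ordSl enum_ord0 /= !ffunE /= cats0.
move: h0 h1 sz.
case: (nat_of_ord (f ord0).1) => [|[|?]]; case: (nat_of_ord (f ord0).2) => [|[|?]];
  case: (nat_of_ord (f (lift ord0 ord0)).1) => [|[|?]];
  case: (nat_of_ord (f (lift ord0 ord0)).2) => [|[|?]] //=;
  rewrite ?addnS ?addSn ?addn0 ?add0n //.
all: move=> _ _ _; rewrite /bracket_word /= ?lie_alt ?oppr0 //; exact: lie_antisym.
Qed.

(** The words of length at most two come from the first two values of the outer index of
    Dynkin's formula. All others are put into one list that does not depend on [x] and [y];
    the estimates below use only that its words have at least three letters. *)
Lemma gmul_expansion : {T : seq (R * seq bool) |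
  all (fun t => 3 <= size t.2)%N T &
  forall x y, gmul G x y = x + y + 2^-1 *: lie G x y
                 + \sum_(t <- T) t.1 *: bracket_word G t.2 x y}.
Proof.
case E : (step G) => [|s].
  exists [::] => // x y.
  apply/rowP => i; have := deg_bounds G i; rewrite E => /andP[h1 h2].
  by have := leq_trans h1 h2.
pose L k := [seq (dynkin_coef f, dynkin_word f) |
   f <- enum {ffun 'I_k.+1 -> idx s.+1} & valid f && (2 < size (dynkin_word f))%N].
exists (flatten [seq L k | k <- iota 0 s.+1]).
  apply/allP => t /flatten_mapP[k _ /mapP[f]]; rewrite mem_filter => /andP[/andP[_ h] _] ->.
  by [].
move=> x y; rewrite gmulE E bch_terms.
rewrite [in RHS]big_flatten big_map -[iota 0 s.+1]/(index_iota 0 s.+1) big_mkord.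
have spl k : \sum_(f : {ffun 'I_k.+1 -> idx s.+1} | valid f) term f x y =
   \sum_(f : {ffun 'I_k.+1 -> idx s.+1} | valid f && (size (dynkin_word f) <= 2)%N) term f x y +
   \sum_(t <- L k) t.1 *: bracket_word G t.2 x y.
  rewrite (bigID (fun f => (size (dynkin_word f) <= 2)%N)) /=; congr (_ + _).
  rewrite big_map big_filter big_enum_cond /=.
  by apply: eq_bigl => f; rewrite -ltnNge.
rewrite (eq_bigr _ (fun (k : 'I_s.+1) _ => spl k)) big_split /=; congr (_ + _).
rewrite big_ord_recl dynkin_order1 -[RHS]addr0; congr (_ + _).
apply: big1 => k _; rewrite lift0.
case: k => -[_|k k_lt] /=; first exact: dynkin_order2.
apply: big1 => f /andP[/valid_size h1 h2].
by have := leq_trans h1 h2.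
Qed.

End DynkinLowOrder.

(** * Norm estimates for brackets and dilations *)

Section RowNorm.
Variables (R : realType) (n : nat).
Implicit Types (x y : 'rV[R]_n).

Lemma coord_norm_le x i : `|x 0 i| <= `|x|.
Proof.
rewrite [leRHS]/Num.norm /= mx_normrE; apply/bigmax_geP; right => /=.
by exists (0, i).
Qed.

Lemma row_norm_le x e : 0 <= e -> (forall i, `|x 0 i| <= e) -> `|x| <= e.
Proof.
move=> e0 xe; rewrite [leLHS]/Num.norm /= mx_normrE; apply/bigmax_leP; split => //.
by move=> [i j] _ /=; rewrite (ord1 i).
Qed.

End RowNorm.

Section LieEstimates.
Variables (R : realType) (n : nat) (G : stratifiedGroup R n).
Implicit Types (x y z : 'rV[R]_n) (a b t : R) (w : seq bool).

Lemma lie_suml (I : Type) (r : seq I) (F : I -> 'rV[R]_n) z :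
  lie G (\sum_(i <- r) F i) z = \sum_(i <- r) lie G (F i) z.
Proof. by apply: (big_morph (lie G ^~ z)) => [x y|]; rewrite ?lieD_l ?lie0l. Qed.

Lemma lie_sumr (I : Type) (r : seq I) (F : I -> 'rV[R]_n) z :
  lie G z (\sum_(i <- r) F i) = \sum_(i <- r) lie G z (F i).
Proof. by apply: (big_morph (lie G z)) => [x y|]; rewrite ?lieD_r ?lie0r. Qed.

Lemma lie_coords x y : lie G x y =
  \sum_i \sum_j (x 0 i * y 0 j) *: lie G (delta_mx 0 i) (delta_mx 0 j).
Proof.
rewrite {1}(row_sum_delta x) lie_suml; apply: eq_bigr => i _.
rewrite lieZl {1}(row_sum_delta y) lie_sumr scaler_sumr; apply: eq_bigr => j _.
by rewrite lieZr scalerA.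
Qed.

Lemma lie_bound : {K : R | 0 <= K & forall x y, `|lie G x y| <= K * (`|x| * `|y|)}.
Proof.
exists (\sum_i \sum_j `|lie G (delta_mx 0 i) (delta_mx 0 j)|).
  by do 2!(apply: sumr_ge0 => ? _).
move=> x y; rewrite lie_coords mulr_suml; apply: le_trans (ler_norm_sum _ _ _) _.
apply: ler_sum => i _; rewrite mulr_suml; apply: le_trans (ler_norm_sum _ _ _) _.
apply: ler_sum => j _; rewrite normrZ mulrC; apply: ler_wpM2l => //.
by rewrite normrM ler_pM // coord_norm_le.
Qed.

(** The filtration by layers: a bracket of [m] elements lies in its [m]-th term, so that long
    words do not contribute to the low layers. *)
Definition in_layers_from (s : nat) x := forall i, (deg G i < s)%N -> x 0 i = 0.

Lemma delta_layer i : layer (deg G) (deg G i) (delta_mx 0 i : 'rV[R]_n).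
Proof.
move=> j; rewrite mxE /=; case: eqP => [->|_ _]; first by [].
by [].
Qed.

Lemma lie_in_layers_from (a b : nat) x y : in_layers_from a x -> in_layers_from b y ->
  in_layers_from (a + b) (lie G x y).
Proof.
move=> xa yb l ld; rewrite lie_coords summxE big1 // => i _.
rewrite summxE big1 // => j _; rewrite mxE.
have [/xa->|ai] := ltnP (deg G i) a; first by rewrite !mul0r.
have [/yb->|bj] := ltnP (deg G j) b; first by rewrite mulr0 mul0r.
rewrite (lie_graded (@delta_layer i) (@delta_layer j)) ?mulr0 // => e.
by move: ld; rewrite e ltnNge leq_add.
Qed.

Lemma in_layers_from1 x : in_layers_from 1 x.
Proof. by move=> i; rewrite ltnS leqNgt; have /andP[->] := deg_bounds G i. Qed.

Lemma bracket_word_in_layers_from w x y : (0 < size w)%N ->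
  in_layers_from (size w) (bracket_word G w x y).
Proof.
elim: w => // b [_ _|c w IH _]; first exact: in_layers_from1.
rewrite bracket_word_cons //; apply: (@lie_in_layers_from 1); last exact: IH.
exact: in_layers_from1.
Qed.

Lemma bracket_wordZ w a x y : (0 < size w)%N ->
  bracket_word G w (a *: x) (a *: y) = a ^+ size w *: bracket_word G w x y.
Proof.
elim: w => // b [_ _|c w IH _]; first by rewrite expr1; case: b.
rewrite !(@bracket_word_cons _ _ _ b (c :: w)) // IH //.
by rewrite lieZr [size (b :: _)]/= exprSr -scalerA; case: b; rewrite lieZl.
Qed.

Lemma bracket_word_collinear w a b z : (1 < size w)%N ->
  bracket_word G w (a *: z) (b *: z) = 0.
Proof.
elim: w => // c [//|d [_ _|e w IH _]].
  by rewrite /bracket_word /=; case: c; case: d; rewrite lieZl lieZr lie_alt !scaler0.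
by rewrite bracket_word_cons // IH // lie0r.
Qed.

Lemma dilD r x y : dil (deg G) r (x + y) = dil (deg G) r x + dil (deg G) r y.
Proof. by apply/rowP => i; rewrite !mxE mulrDr. Qed.

Lemma dilZ r a x : dil (deg G) r (a *: x) = a *: dil (deg G) r x.
Proof. by apply/rowP => i; rewrite !mxE mulrCA. Qed.

Lemma dil0 r : dil (deg G) r (0 : 'rV[R]_n) = 0.
Proof. by apply/rowP => i; rewrite !mxE mulr0. Qed.

Lemma dil_sum (I : Type) (s : seq I) (F : I -> 'rV[R]_n) r :
  dil (deg G) r (\sum_(i <- s) F i) = \sum_(i <- s) dil (deg G) r (F i).
Proof. by apply: (big_morph (dil (deg G) r)) => [x y|]; rewrite ?dilD ?dil0. Qed.

Lemma dil_layer (s : nat) r x : layer (deg G) s x -> dil (deg G) r x = r ^+ s *: x.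
Proof.
move=> xs; apply/rowP => i; rewrite !mxE.
by have [->//|/eqP/xs->] := eqVneq (deg G i) s; rewrite !mulr0.
Qed.

Lemma dilK r x : r != 0 -> dil (deg G) r^-1 (dil (deg G) r x) = x.
Proof.
move=> r0; apply/rowP => i; rewrite !mxE mulrA -exprMn mulVf //.
by rewrite expr1n mul1r.
Qed.

Lemma lie_dil r x y :
  lie G (dil (deg G) r x) (dil (deg G) r y) = dil (deg G) r (lie G x y).
Proof.
rewrite [in LHS]lie_coords (lie_coords x y) dil_sum; apply: eq_bigr => i _.
rewrite dil_sum; apply: eq_bigr => j _.
rewrite dilZ (dil_layer _ (lie_graded (@delta_layer i) (@delta_layer j))) !mxE scalerA.
by congr (_ *: _); rewrite exprD; ring.
Qed.

Lemma bracket_word_dil w r x y : (0 < size w)%N ->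
  bracket_word G w (dil (deg G) r x) (dil (deg G) r y)
  = dil (deg G) r (bracket_word G w x y).
Proof.
elim: w => // b [_ _|c w IH _]; first by rewrite /bracket_word /=; case: b.
by rewrite !(@bracket_word_cons _ _ _ b (c :: w)) // IH //; case: b; rewrite lie_dil.
Qed.

Lemma bracket_word_bound K w (r : R) x y : 0 <= K ->
    (forall x y, `|lie G x y| <= K * (`|x| * `|y|)) ->
    `|x| <= r -> `|y| <= r -> (0 < size w)%N ->
  `|bracket_word G w x y| <= K ^+ (size w).-1 * r ^+ size w.
Proof.
move=> K0 Klie xr yr; have r0 : 0 <= r := le_trans (normr_ge0 _) xr.
elim: w => // b [_ _|c w IH _]; first by rewrite expr0 mul1r expr1; case: b.
rewrite bracket_word_cons //; apply: le_trans (Klie _ _) _.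
have h : `|if b then x else y| <= r by case: b.
apply: le_trans (_ : K * (r * (K ^+ size w * r ^+ (size w).+1)) <= _).
  by apply: ler_wpM2l => //; apply: ler_pM => //; exact: IH.
rewrite [(size (b :: c :: w)).-1]/= [size (b :: c :: w)]/= [K ^+ _.+1]exprS [r ^+ _.+2]exprS.
by rewrite le_eqVlt; apply/orP; left; apply/eqP; ring.
Qed.

(** The letters are changed one at a time. *)
Lemma bracket_word_lipschitz K w (r e : R) x y x' y' : 0 <= K ->
    (forall x y, `|lie G x y| <= K * (`|x| * `|y|)) ->
    `|x| <= r -> `|y| <= r -> `|x'| <= r -> `|y'| <= r ->
    `|x - x'| <= e -> `|y - y'| <= e -> (0 < size w)%N ->
  `|bracket_word G w x y - bracket_word G w x' y'|
    <= (size w)%:R * K ^+ (size w).-1 * r ^+ (size w).-1 * e.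
Proof.
move=> K0 Klie xr yr xr' yr' xe ye; have r0 : 0 <= r := le_trans (normr_ge0 _) xr.
have e0 : 0 <= e := le_trans (normr_ge0 _) xe.
elim: w => // b [_ _|c w IH _]; first by rewrite !expr0 !mul1r; case: b.
rewrite !(@bracket_word_cons _ _ _ b (c :: w)) //.
set v := bracket_word G _ _ _; set v' := bracket_word G _ _ _.
set p := if b then x else y; set p' := if b then x' else y'.
have pr' : `|p'| <= r by rewrite /p'; case: (b).
have pe : `|p - p'| <= e by rewrite /p /p'; case: (b).
have -> : lie G p v - lie G p' v' = lie G (p - p') v + lie G p' (v - v').
  by rewrite lieD_l lieD_r lieNl lieNr addrA subrK.
apply: le_trans (ler_normD _ _) _.
have vb : `|v| <= K ^+ size w * r ^+ (size w).+1.
  by rewrite /v; apply: (bracket_word_bound (w := c :: w)).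
have := IH isT; rewrite -/v -/v' => vv'.
apply: le_trans (lerD (Klie _ _) (Klie _ _)) _.
apply: le_trans (_ : K * (e * (K ^+ size w * r ^+ (size w).+1)) +
   K * (r * ((size w).+1%:R * K ^+ size w * r ^+ size w * e)) <= _).
  by apply: lerD; apply: ler_wpM2l => //; apply: ler_pM.
rewrite [(size (b :: c :: w)).-1]/= [size (b :: c :: w)]/= -[(size w).+2]addn1 natrD.
rewrite [K ^+ _.+1]exprS [r ^+ _.+1]exprS.
by rewrite le_eqVlt; apply/orP; left; apply/eqP; ring.
Qed.

End LieEstimates.

(** * The group law and polynomial curves *)

Section GroupLaw.
Variables (R : realType) (n : nat) (G : stratifiedGroup R n).
Implicit Types (x y z v : 'rV[R]_n) (a b r t : R).

Local Notation "x '**' y" := (gmul G x y) (at level 40, left associativity).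

Lemma gmulNK x y : - x ** (x ** y) = y.
Proof. by rewrite gmulA gmulNx gmul0x. Qed.

Lemma gmulx0 x : x ** 0 = x.
Proof.
have h : - (- x) ** (- x ** x) = x by rewrite gmulNK.
by rewrite -{1}h gmulNx -gmulA gmul0x -[RHS]h gmulNx.
Qed.

Lemma gmulxN x : x ** - x = 0.
Proof. by have := gmulNx G (- x); rewrite opprK. Qed.

Lemma gmulKN x y : x ** (- x ** y) = y.
Proof. by rewrite gmulA gmulxN gmul0x. Qed.

Lemma gmulK x y : y ** x ** - x = y.
Proof. by rewrite -gmulA gmulxN gmulx0. Qed.

Lemma gmulNVK x y : y ** - x ** x = y.
Proof. by rewrite -gmulA gmulNx gmulx0. Qed.

Lemma gmul_oppM x y : - (x ** y) = - y ** - x.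
Proof.
by rewrite -[LHS]gmulx0 -(gmulxN x) -{1}(gmulKN y (- x)) 2!gmulA -[- _ ** x ** y]gmulA gmulNx gmul0x.
Qed.

Lemma gmul_collinear a b z : (a *: z) ** (b *: z) = (a + b) *: z.
Proof.
have [T /allP sT ->] := gmul_expansion G.
rewrite lieZl lieZr lie_alt !scaler0 addr0 big_seq big1 ?addr0 ?scalerDl // => t /sT st.
by rewrite bracket_word_collinear ?scaler0 // (leq_trans _ st).
Qed.

Lemma dil_gmul r x y : dil (deg G) r (x ** y) = dil (deg G) r x ** dil (deg G) r y.
Proof.
have [T /allP sT E] := gmul_expansion G.
rewrite !E !dilD dilZ lie_dil; congr (_ + _).
rewrite dil_sum !big_seq; apply: eq_bigr => t /sT st.
by rewrite dilZ bracket_word_dil // (leq_trans _ st).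
Qed.

(** The remaining words have at least three letters, hence vanish in the first two layers. *)
Lemma gmul_coord1 x y i : deg G i = 1%N -> (x ** y) 0 i = x 0 i + y 0 i.
Proof.
move=> di; have [T /allP sT ->] := gmul_expansion G.
rewrite !mxE (lie_in_layers_from (@in_layers_from1 _ _ G x) (@in_layers_from1 _ _ G y)) ?di //.
rewrite summxE big_seq big1 ?mulr0 ?addr0 // => t /sT st.
by rewrite mxE bracket_word_in_layers_from ?mulr0 ?di // (leq_trans _ st).
Qed.

Lemma gmul_coord2 x y i : deg G i = 2%N ->
  (x ** y) 0 i = x 0 i + y 0 i + 2^-1 * lie G x y 0 i.
Proof.
move=> di; have [T /allP sT ->] := gmul_expansion G.
rewrite !mxE summxE big_seq [X in _ + X]big1 ?addr0 // => t /sT st.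
by rewrite mxE bracket_word_in_layers_from ?mulr0 ?di // (leq_trans _ st).
Qed.

(** The group law is a perturbation of the addition whose Lipschitz constant
    tends to zero at the origin; [p] is that constant as a function of the
    radius. *)
Lemma gmul_addition_lipschitz : {p : {poly R} | p.[0] = 0 &
  forall r e x y x' y', `|x| <= r -> `|y| <= r -> `|x'| <= r -> `|y'| <= r ->
    `|x - x'| <= e -> `|y - y'| <= e ->
  `|(x ** y - x - y) - (x' ** y' - x' - y')| <= p.[r] * e}.
Proof.
have [T /allP sT E] := gmul_expansion G; have [K K0 Klie] := lie_bound G.
pose q (s : nat) : {poly R} := (s%:R * K ^+ s.-1) *: 'X^(s.-1).
exists (2^-1 *: q 2 + \sum_(t <- T) `|t.1| *: q (size t.2)).
  have q0 s : (1 < s)%N -> (q s).[0] = 0.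
    by case: s => [|[|m]] // _; rewrite /q hornerZ hornerXn /= expr0n mulr0.
  rewrite hornerD hornerZ q0 // mulr0 add0r horner_sum big_seq big1 // => t /sT st.
  by rewrite hornerZ q0 ?mulr0 // ltnW.
move=> r e x y x' y' xr yr xr' yr' xe ye.
have B x1 y1 : x1 ** y1 - x1 - y1 = 2^-1 *: bracket_word G [:: true; false] x1 y1
     + \sum_(t <- T) t.1 *: bracket_word G t.2 x1 y1.
  rewrite E {2}/bracket_word /=; set S := \sum_(t <- T) _.
  by apply/rowP => i; rewrite !mxE; ring.
have L w : (1 < size w)%N ->
    `|bracket_word G w x y - bracket_word G w x' y'| <= (q (size w)).[r] * e.
  move=> sw; rewrite /q hornerZ hornerXn.
  by apply: bracket_word_lipschitz => //; exact: ltnW.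
rewrite !B opprD addrACA -scalerBr -sumrB; apply: le_trans (ler_normD _ _) _.
rewrite hornerD mulrDl; apply: lerD.
  rewrite normrZ hornerZ -mulrA ger0_norm ?invr_ge0 //.
  by apply: ler_wpM2l; rewrite ?invr_ge0 //; exact: L.
apply: le_trans (ler_norm_sum _ _ _) _; rewrite horner_sum mulr_suml !big_seq.
apply: ler_sum => t /sT st; rewrite -scalerBr normrZ hornerZ -mulrA.
by apply: ler_wpM2l => //; apply: L; exact: ltnW.
Qed.

Lemma gmul_near_addition (eta : R) : 0 < eta -> exists2 r, 0 < r &
  forall e x y x' y', `|x| <= r -> `|y| <= r -> `|x'| <= r -> `|y'| <= r ->
    `|x - x'| <= e -> `|y - y'| <= e ->
  `|(x ** y - x - y) - (x' ** y' - x' - y')| <= eta * e.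
Proof.
move=> eta0; have [p p0 pP] := gmul_addition_lipschitz.
have : p.[t] @[t --> (0 : R)] --> p.[0] by exact: continuous_horner.
rewrite p0 => /cvgrPdist_lt /(_ _ eta0) [r /= r0 rP].
exists (r / 2) => [|e x y x' y' xr yr xr' yr' xe ye]; first by rewrite divr_gt0.
apply: le_trans (pP _ _ _ _ _ _ xr yr xr' yr' xe ye) _.
apply: ler_wpM2r; first by exact: le_trans (normr_ge0 _) xe.
have := rP (r / 2); rewrite /= !sub0r !normrN gtr0_norm ?divr_gt0 // => h.
apply: le_trans (ler_norm _) (ltW (h _)).
by rewrite ltr_pdivrMr // ltr_pMr // ltr1n.
Qed.

Lemma gmul_lipschitz r : exists2 C, 0 <= C &
  forall e x y x' y', `|x| <= r -> `|y| <= r -> `|x'| <= r -> `|y'| <= r ->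
    `|x - x'| <= e -> `|y - y'| <= e -> `|x ** y - x' ** y'| <= C * e.
Proof.
have [p p0 pP] := gmul_addition_lipschitz.
exists (`|p.[r]| + 2) => // e x y x' y' xr yr xr' yr' xe ye.
have e0 : 0 <= e := le_trans (normr_ge0 _) xe.
have := pP _ _ _ _ _ _ xr yr xr' yr' xe ye; set u := (X in `|X| <= _) => h.
have -> : x ** y - x' ** y' = u + (x - x') + (y - y').
  by rewrite /u !opprD !opprK; apply/rowP => i; rewrite !mxE; ring.
apply: le_trans (ler_normD _ _) _.
have -> : (`|p.[r]| + 2) * e = `|p.[r]| * e + e + e by ring.
apply: lerD => //; apply: le_trans (ler_normD _ _) _; apply: lerD => //.
by apply: le_trans h _; apply: ler_wpM2r => //; exact: ler_norm.
Qed.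

Lemma gmul_cvg (T : Type) (F : set_system T) (FF : Filter F) (f g : T -> 'rV[R]_n) x y :
  f @ F --> x -> g @ F --> y -> (f t ** g t) @[t --> F] --> x ** y.
Proof.
move=> fx gy; pose r := Num.max `|x| `|y| + 1.
have [C C0 CP] := gmul_lipschitz r.
have xr : `|x| <= r by rewrite /r ler_wpDr // le_max lexx.
have yr : `|y| <= r by rewrite /r ler_wpDr // le_max lexx orbT.
apply/cvgrPdist_le => e e0; have d0 : 0 < Num.min 1 (e / (C + 1)).
  by rewrite lt_min ltr01 divr_gt0 // ltr_wpDl.
have [/cvgrPdist_le/(_ _ d0) hf /cvgrPdist_le/(_ _ d0) hg] := (fx, gy).
near=> t.
have ft : `|x - f t| <= Num.min 1 (e / (C + 1)) by near: t.
have gt : `|y - g t| <= Num.min 1 (e / (C + 1)) by near: t.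
have bnd u w : `|u| <= Num.max `|x| `|y| -> `|u - w| <= Num.min 1 (e / (C + 1)) -> `|w| <= r.
  move=> h; rewrite le_min => /andP[h1 _].
  rewrite -[w](subKr u); apply: le_trans (ler_normB _ _) _; exact: lerD.
have fr : `|f t| <= r by apply: bnd ft; rewrite le_max lexx.
have gr : `|g t| <= r by apply: bnd gt; rewrite le_max lexx orbT.
apply: le_trans (CP _ _ _ _ _ xr yr fr gr ft gt) _.
apply: le_trans (_ : C * (e / (C + 1)) <= _).
  by apply: ler_wpM2l => //; rewrite ge_min lexx orbT.
rewrite mulrCA -[leRHS]mulr1; apply: ler_wpM2l; first exact: ltW.
by rewrite ler_pdivrMr ?mul1r ?lerDl // ltr_wpDl.
Unshelve. all: by end_near. Qed.

Lemma gmul_second_order (r : R) : exists C, forall t u v,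
  `|u| <= r -> `|v| <= r -> `|t| <= 1 ->
  `|(t *: u) ** (t *: v) - t *: (u + v) - (2^-1 * t ^+ 2) *: lie G u v| <= C * `|t| ^+ 3.
Proof.
have [T /allP sT E] := gmul_expansion G; have [K K0 Klie] := lie_bound G.
exists (\sum_(s <- T) `|s.1| * (K ^+ (size s.2).-1 * r ^+ size s.2)) => t u v ur vr t1.
have r0 : 0 <= r := le_trans (normr_ge0 _) ur.
rewrite E; set S := \sum_(s <- T) _.
have -> : t *: u + t *: v + 2^-1 *: lie G (t *: u) (t *: v) + S - t *: (u + v) -
    (2^-1 * t ^+ 2) *: lie G u v = S.
  by rewrite lieZl lieZr; apply/rowP => i; rewrite !mxE; ring.
apply: le_trans (ler_norm_sum _ _ _) _.
rewrite mulr_suml !big_seq; apply: ler_sum => s /sT ss.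
have s0 : (0 < size s.2)%N by exact: leq_trans ss.
rewrite bracket_wordZ // !normrZ -mulrA; apply: ler_wpM2l => //.
rewrite mulrC normrX; apply: ler_pM => //; first exact: bracket_word_bound.
by apply: ler_wiXn2l.
Qed.

End GroupLaw.

Section PolynomialCurves.
Variables (R : realType) (n : nat) (G : stratifiedGroup R n).

(** Polynomial dependence on a parameter makes nonvanishing a generic condition: if it holds
    for one value of the parameter, it fails for finitely many only. *)
Definition polynomial_in (f : R -> R) := exists p : {poly R}, forall t, f t = p.[t].

Definition polynomial_curve (c : R -> 'rV[R]_n) := forall i, polynomial_in (fun t => c t 0 i).

Lemma polynomial_inD f g : polynomial_in f -> polynomial_in g ->
  polynomial_in (fun t => f t + g t).
Proof. by move=> [p fp] [q gq]; exists (p + q) => t; rewrite hornerD fp gq. Qed.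

Lemma polynomial_inM f g : polynomial_in f -> polynomial_in g ->
  polynomial_in (fun t => f t * g t).
Proof. by move=> [p fp] [q gq]; exists (p * q) => t; rewrite hornerM fp gq. Qed.

Lemma polynomial_in_cst a : polynomial_in (fun=> a).
Proof. by exists a%:P => t; rewrite hornerC. Qed.

Lemma polynomial_in_sum (I : Type) (s : seq I) (f : I -> R -> R) :
  (forall i, polynomial_in (f i)) -> polynomial_in (fun t => \sum_(i <- s) f i t).
Proof.
move=> pf; elim: s => [|i s IH].
  by have [p pP] := polynomial_in_cst 0; exists p => t; rewrite big_nil -pP.
have [p pP] := polynomial_inD (pf i) IH.
by exists p => t; rewrite big_cons -pP.
Qed.

Lemma polynomial_in_prod (I : Type) (s : seq I) (f : I -> R -> R) :
  (forall i, polynomial_in (f i)) -> polynomial_in (fun t => \prod_(i <- s) f i t).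
Proof.
move=> pf; elim: s => [|i s IH].
  by have [p pP] := polynomial_in_cst 1; exists p => t; rewrite big_nil -pP.
have [p pP] := polynomial_inM (pf i) IH.
by exists p => t; rewrite big_cons -pP.
Qed.

Lemma polynomial_curve_cst x : polynomial_curve (fun=> x).
Proof. by move=> i; exact: polynomial_in_cst. Qed.

Lemma polynomial_curveD c d : polynomial_curve c -> polynomial_curve d ->
  polynomial_curve (fun t => c t + d t).
Proof.
move=> pc pd i; have [p pP] := polynomial_inD (pc i) (pd i).
by exists p => t; rewrite -pP mxE.
Qed.

Lemma polynomial_curveZ f c : polynomial_in f -> polynomial_curve c ->
  polynomial_curve (fun t => f t *: c t).
Proof.
move=> pf pc i; have [p pP] := polynomial_inM pf (pc i).
by exists p => t; rewrite -pP mxE.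
Qed.

Lemma polynomial_curve_line x : polynomial_curve (fun t => t *: x).
Proof.
by apply: polynomial_curveZ (polynomial_curve_cst _); exists 'X => t; rewrite hornerX.
Qed.

Lemma polynomial_curveN c : polynomial_curve c -> polynomial_curve (fun t => - c t).
Proof.
move=> pc i; have [p pP] := pc i; exists (- p) => t.
by rewrite hornerN -pP mxE.
Qed.

Lemma polynomial_curve_sum (I : Type) (s : seq I) (c : I -> R -> 'rV[R]_n) :
  (forall i, polynomial_curve (c i)) -> polynomial_curve (fun t => \sum_(i <- s) c i t).
Proof.
move=> pc j; have [p pP] := polynomial_in_sum s (fun i => pc i j).
by exists p => t; rewrite -pP summxE.
Qed.

Lemma polynomial_curve_lie c d : polynomial_curve c -> polynomial_curve d ->
  polynomial_curve (fun t => lie G (c t) (d t)).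
Proof.
move=> pc pd l; have [p pP] : polynomial_in (fun t => \sum_i \sum_j
    c t 0 i * d t 0 j * lie G (delta_mx 0 i) (delta_mx 0 j) 0 l).
  do 2!apply: polynomial_in_sum => ?.
  apply: polynomial_inM (polynomial_in_cst _); exact: polynomial_inM.
exists p => t; rewrite -pP lie_coords summxE; apply: eq_bigr => i _.
by rewrite summxE; apply: eq_bigr => j _; rewrite mxE.
Qed.

Lemma polynomial_curve_gmul c d : polynomial_curve c -> polynomial_curve d ->
  polynomial_curve (fun t => gmul G (c t) (d t)).
Proof.
move=> pc pd; have [T _ E] := gmul_expansion G.
have pw w : polynomial_curve (fun t => bracket_word G w (c t) (d t)).
  elim: w => [|b [|e w] IH]; first exact: polynomial_curve_cst.
    by case: b.
  by case: b; apply: polynomial_curve_lie.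
have pb : polynomial_curve (fun t => c t + d t + 2^-1 *: lie G (c t) (d t)
              + \sum_(s <- T) s.1 *: bracket_word G s.2 (c t) (d t)).
  apply: polynomial_curveD; first (apply: polynomial_curveD).
  - exact: polynomial_curveD.
  - by apply: polynomial_curveZ; [exact: polynomial_in_cst|exact: polynomial_curve_lie].
  - apply: polynomial_curve_sum => s.
    by apply: polynomial_curveZ; [exact: polynomial_in_cst|].
by move=> i; have [p pP] := pb i; exists p => t; rewrite -pP E.
Qed.

End PolynomialCurves.

(** * Conjugates of the first layer span the Lie algebra *)

Section Subspaces.
Variables (R : realType) (n : nat).

Lemma poly_nonroot (p : {poly R}) : p != 0 -> exists k : nat, p.[k%:R] != 0.
Proof.
move=> p0; apply: contrapT => h; suff: false by [].
have := @max_poly_roots _ p [seq k%:R | k <- iota 0 (size p)] p0.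
rewrite size_map size_iota ltnn; apply.
  apply/allP => _ /mapP[k _ ->]; rewrite /root; apply: contraPT isT => pk.
  by case: h; exists k.
rewrite map_inj_uniq ?iota_uniq // => i j /eqP.
by rewrite eqr_nat => /eqP.
Qed.

(** A subspace of largest dimension contained in the predicate exhausts it, since it could
    otherwise be enlarged by a vector. *)
Lemma vspace_of_pred (P : 'rV[R]_n -> Prop) : P 0 ->
  (forall a x y, P x -> P y -> P (a *: x + y)) ->
  exists W : {vspace 'rV[R]_n}, forall x, x \in W <-> P x.
Proof.
move=> P0 PD; pose Q m := `[< exists2 W : {vspace 'rV[R]_n}, \dim W = m &
  forall x, x \in W -> P x >].
have Q0 : exists m, Q m.
  exists 0%N; apply/asboolP; exists 0%VS; first by rewrite dimv0.
  by move=> x; rewrite memv0 => /eqP ->.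
have Qb m : Q m -> (m <= \dim {:'rV[R]_n})%N.
  by move=> /asboolP[W <- _]; apply: dimvS; exact: subvf.
case: (ex_maxnP Q0 Qb) => m /asboolP[W Wm WP] mmax.
exists W => x; split=> [/WP//|Px].
have : Q (\dim (W + <[x]>)).
  apply/asboolP; exists (W + <[x]>)%VS => // y /memv_addP[u uW [v /vlineP[a ->] ->]].
  by rewrite addrC; apply: PD => //; exact: WP.
move=> /mmax; rewrite -Wm => dimle.
have /eqP -> : W == (W + <[x]>)%VS by rewrite eqEdim addvSl.
by rewrite memvE addvSr.
Qed.

Lemma linear_cvg (m : nat) (f : 'rV[R]_n -> 'rV[R]_m)
    (f_lin : forall a x y, f (a *: x + y) = a *: f x + f y)
    (T : Type) (F : set_system T) (FF : Filter F) (z : T -> 'rV[R]_n) z0 :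
  z @ F --> z0 -> f (z t) @[t --> F] --> f z0.
Proof.
have f0 : f 0 = 0 by apply: (addIr (f 0)); rewrite -{1}(scale1r (f 0)) -f_lin scale1r !add0r.
have E x : f x = \sum_i x 0 i *: f (delta_mx 0 i).
  rewrite {1}(row_sum_delta x); apply: (big_rec2 (fun u v => f u = v)) => // i u v _ <-.
  exact: f_lin.
move=> zz0; rewrite E (funext (fun t => E (z t))).
elim: (index_enum _) => [|i s IH].
  by rewrite big_nil (funext (fun t => big_nil _ _ _ _)); exact: cvg_cst.
rewrite big_cons (funext (fun t => big_cons _ _ _ _ _ _)) /=.
apply: cvgD => //; apply: cvgZr_tmp.
apply: (@cvg_comp _ _ _ z (fun v : 'rV[R]_n => v 0 i) _ _ _ zz0).
exact: coord_continuous.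
Qed.

Lemma vspace_closed (W : {vspace 'rV[R]_n}) (T : Type) (F : set_system T)
    (FF : ProperFilter F) (z : T -> 'rV[R]_n) z0 :
  z @ F --> z0 -> (forall t, z t \in W) -> z0 \in W.
Proof.
move=> zz0 zW.
have h : projv W (z t) @[t --> F] --> projv W z0.
  by apply: linear_cvg zz0 => a x y; rewrite linearP.
have : projv W z0 = z0.
  apply: (cvg_unique _ _ zz0) => //.
  by rewrite (_ : (fun t => projv W (z t)) = z) in h; [|apply/funext => t; rewrite projv_id].
by move=> <-; exact: memv_proj.
Qed.

End Subspaces.

Section Conjugation.
Variables (R : realType) (n : nat) (G : stratifiedGroup R n).
Implicit Types (g h x y z X : 'rV[R]_n) (s : seq 'rV[R]_n).

Local Notation "x '**' y" := (gmul G x y) (at level 40, left associativity).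

Definition gconj g y := g ** y ** - g.

Lemma gconj_gmul g x y : gconj g (x ** y) = gconj g x ** gconj g y.
Proof. by rewrite /gconj !gmulA gmulNVK. Qed.

Lemma gconjM g h y : gconj (g ** h) y = gconj g (gconj h y).
Proof. by rewrite /gconj gmul_oppM !gmulA. Qed.

Lemma gconj0g y : gconj 0 y = y.
Proof. by rewrite /gconj oppr0 gmulx0 gmul0x. Qed.

Lemma gconjg0 g : gconj g 0 = 0.
Proof. by rewrite /gconj gmulx0 gmulxN. Qed.

Lemma gconj_mulr g y : gconj g y ** g = g ** y.
Proof. by rewrite /gconj gmulNVK. Qed.

Lemma gconj_cvg (T : Type) (F : set_system T) (FF : Filter F) (f k : T -> 'rV[R]_n) g y :
  f @ F --> g -> k @ F --> y -> gconj (f t) (k t) @[t --> F] --> gconj g y.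
Proof.
by move=> fg ky; apply: gmul_cvg; [exact: gmul_cvg|exact: cvgN].
Qed.

(** The two sides agree along the integers, where [k]-th powers are multiples by [k], and
    both are polynomial in [t]. *)
Lemma gconjZ g (t : R) y : gconj g (t *: y) = t *: gconj g y.
Proof.
have hk (k : nat) (a : R) : gconj g ((k%:R * a) *: y) = k%:R *: gconj g (a *: y).
  elim: k => [|k IH]; first by rewrite mul0r !scale0r gconjg0.
  rewrite -natr1 mulrDl mul1r -(gmul_collinear G) gconj_gmul IH.
  by rewrite -[X in _ ** X]scale1r gmul_collinear.
apply/rowP => i; rewrite mxE.
have [p pP] : polynomial_in (fun t => gconj g (t *: y) 0 i).
  have := polynomial_curve_gmul G (polynomial_curve_gmul G (polynomial_curve_cst g)
    (polynomial_curve_line y)) (polynomial_curve_cst (- g)).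
  by move/(_ i).
have q0 : p - p.[1] *: 'X = 0.
  apply/eqP; apply: contraT => /poly_nonroot[k]; rewrite hornerD hornerN hornerZ hornerX -!pP.
  by rewrite -{1}[k%:R]mulr1 hk mxE mulrC subrr eqxx.
rewrite pP -[p](subrK (p.[1] *: 'X)) q0 add0r hornerZ hornerX -pP scale1r.
by rewrite mulrC.
Qed.

(** Near the origin the group law is close to the addition. As [k] times an element is its
    [k]-th power, this expresses the sum through the group law. *)
Lemma trotter x y :
  (k.+1%:R *: ((k.+1%:R^-1 *: x) ** (k.+1%:R^-1 *: y))) @[k --> \oo] --> x + y.
Proof.
pose m := Num.max `|x| `|y|.
have m0 : 0 <= m by rewrite /m le_max normr_ge0.
apply/cvgrPdist_le => e e0.
have [r r0 rP] : exists2 r, 0 < r & _ := gmul_near_addition G (divr_gt0 e0 (ltr_wpDl m0 ltr01)).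
near=> k; pose N : R := k.+1%:R.
have N0 : 0 < N by rewrite /N.
have Nr : m / N <= r.
  rewrite ler_pdivrMr // mulrC -ler_pdivrMr //.
  apply: le_trans (ltW (archi_boundP _)) _; first by rewrite divr_ge0 // ltW.
  rewrite /N ler_nat ltnW // ltnS; near: k; exact: nbhs_infty_ge.
have E u : `|N^-1 *: u| = `|u| / N by rewrite normrZ gtr0_norm ?invr_gt0 // mulrC.
have xm : `|N^-1 *: x| <= m / N.
  by rewrite E ler_pM2r ?invr_gt0 // /m le_max lexx.
have ym : `|N^-1 *: y| <= m / N.
  by rewrite E ler_pM2r ?invr_gt0 // /m le_max lexx orbT.
have z0 : `|0 : 'rV[R]_n| <= r by rewrite normr0 ltW.
have := rP (m / N) _ _ 0 0 (le_trans xm Nr) (le_trans ym Nr) z0 z0.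
rewrite !subr0 gmulx0 subr0 => /(_ xm ym); set u := _ ** _ => h.
have -> : x + y - N *: u = - (N *: (u - N^-1 *: x - N^-1 *: y)).
  by rewrite !scalerBr !scalerA mulfV ?gt_eqF // !scale1r !opprB addrA (addrC y).
rewrite normrN normrZ gtr0_norm // -ler_pdivlMl // mulrC.
apply: le_trans h _; rewrite mulrA ler_pM2r ?invr_gt0 //.
by rewrite mulrAC ler_pdivrMr ?ltr_wpDl // ler_pM2l // lerDl.
Unshelve. all: by end_near. Qed.

(** Conjugation is an automorphism of the group and commutes with dilations of lines, hence
    respects the sum as a limit of products. *)
Lemma gconjD g x y : gconj g (x + y) = gconj g x + gconj g y.
Proof.
pose f (k : nat) := gconj g (k.+1%:R *: ((k.+1%:R^-1 *: x) ** (k.+1%:R^-1 *: y))).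
have l1 : f k @[k --> \oo] --> gconj g (x + y).
  by apply: gconj_cvg; [exact: cvg_cst|exact: trotter].
have l2 : f k @[k --> \oo] --> gconj g x + gconj g y.
  rewrite (_ : f = fun k => k.+1%:R *: ((k.+1%:R^-1 *: gconj g x) ** (k.+1%:R^-1 *: gconj g y))).
    exact: trotter.
  by apply/funext => k; rewrite /f gconjZ gconj_gmul !gconjZ.
exact: (cvg_unique (@norm_hausdorff _ _) l1 l2).
Qed.

Lemma gconj_linear g (a : R) x y : gconj g (a *: x + y) = a *: gconj g x + gconj g y.
Proof. by rewrite gconjD gconjZ. Qed.

(** The derivative of conjugation is the bracket: compare the second order terms of
    the two sides of (gconj (tX) (ty)) ** tX = tX ** ty. *)
Lemma gconj_derivative X y :
  (k.+1%:R *: (gconj (k.+1%:R^-1 *: X) y - y)) @[k --> \oo] --> lie G X y.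
Proof.
pose t (k : nat) : R := k.+1%:R^-1; pose Y k := gconj (t k *: X) y.
have t0 : t k @[k --> \oo] --> (0 : R) by exact: cvg_harmonic.
have Yy : Y k @[k --> \oo] --> y.
  rewrite -[X in _ --> X]gconj0g -(scale0r X).
  by apply: gconj_cvg; [apply: cvgZr_tmp|exact: cvg_cst].
pose r := Num.max `|X| `|y| + 1.
have Xr : `|X| <= r by rewrite /r ler_wpDr // le_max lexx.
have yr : `|y| <= r by rewrite /r ler_wpDr // le_max lexx orbT.
have [C CP] := gmul_second_order G r.
have lim1 : 2^-1 *: (lie G X y - lie G (Y k) X) @[k --> \oo] --> lie G X y.
  have {2}-> : lie G X y = 2^-1 *: (lie G X y - lie G y X).
    by rewrite (lie_antisym G y X); apply/rowP => i; rewrite !mxE; field.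
  apply: cvgZl_tmp; apply: cvgB; first exact: cvg_cst.
  by apply: (@linear_cvg _ _ _ (fun u => lie G u X)) Yy => a u v; rewrite lieDl.
have lim2 : (2 * C * t k) @[k --> \oo] --> (0 : R).
  by rewrite -[X in _ --> X](mulr0 (2 * C)); apply: cvgMl_tmp.
have bnd : \forall k \near \oo, `|k.+1%:R *: (Y k - y) - 2^-1 *: (lie G X y - lie G (Y k) X)|
    <= 2 * C * t k.
  near=> k.
  have tk0 : 0 < t k by rewrite /t invr_gt0.
  have tk1 : `|t k| <= 1 by rewrite gtr0_norm // /t invf_le1 // ler1n.
  have Yr : `|Y k| <= r.
    have : `|y - Y k| <= 1 by near: k; move/cvgrPdist_le : Yy; apply.
    move=> h; rewrite -[Y k](subKr y); apply: le_trans (ler_normB _ _) _.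
    by apply: lerD => //; rewrite le_max lexx orbT.
  have h1 := CP (t k) _ _ Yr Xr tk1; have h2 := CP (t k) _ _ Xr yr tk1.
  have e : (t k *: Y k) ** (t k *: X) = (t k *: X) ** (t k *: y).
    by rewrite /Y -gconjZ gconj_mulr.
  rewrite e in h1.
  have kE : k.+1%:R = (t k)^-1 by rewrite /t invrK.
  have -> : k.+1%:R *: (Y k - y) - 2^-1 *: (lie G X y - lie G (Y k) X) =
    (t k ^- 2) *: (((t k *: X) ** (t k *: y) - t k *: (X + y) - (2^-1 * t k ^+ 2) *: lie G X y)
     - ((t k *: X) ** (t k *: y) - t k *: (Y k + X) - (2^-1 * t k ^+ 2) *: lie G (Y k) X)).
    by rewrite kE; apply/rowP => i; rewrite !mxE; field; rewrite gt_eqF.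
  rewrite normrZ ger0_norm; last by rewrite invr_ge0 exprn_ge0 // ltW.
  rewrite ler_pdivrMl ?exprn_gt0 //; apply: le_trans (ler_normB _ _) _.
  rewrite gtr0_norm // in h1 h2; apply: le_trans (lerD h2 h1) _.
  by rewrite le_eqVlt; apply/orP; left; apply/eqP; ring.
have lim3 : (k.+1%:R *: (Y k - y) - 2^-1 *: (lie G X y - lie G (Y k) X)) @[k --> \oo] --> (0 : 'rV[R]_n).
  apply/cvgr0Pnorm_le => e e0; near=> k.
  apply: le_trans (_ : 2 * C * t k <= _); first by near: k.
  apply: le_trans (ler_norm _) _; near: k.
  by move/cvgr0Pnorm_le : lim2; apply.
have e : (fun k => k.+1%:R *: (Y k - y)) =
    (fun k => (k.+1%:R *: (Y k - y) - 2^-1 *: (lie G X y - lie G (Y k) X)) +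
       2^-1 *: (lie G X y - lie G (Y k) X)) by apply/funext => k; rewrite subrK.
by rewrite -[X in _ --> X]add0r e; exact: cvgD lim3 lim1.
Unshelve. all: by end_near. Qed.

Definition gprod s := foldr (gmul G) 0 s.

Lemma gprod_cat s s' : gprod (s ++ s') = gprod s ** gprod s'.
Proof. by elim: s => [|x s IH] /=; rewrite ?gmul0x // IH gmulA. Qed.

Definition horizontal s := forall X, X \in s -> H1 G X.

Lemma horizontal_cat s s' : horizontal s -> horizontal s' -> horizontal (s ++ s').
Proof. by move=> hs hs' X; rewrite mem_cat => /orP[/hs|/hs']. Qed.

Lemma horizontal_cons X s : H1 G X -> horizontal s -> horizontal (X :: s).
Proof. by move=> hX hs Y; rewrite inE => /orP[/eqP->|/hs]. Qed.

(** The span of the conjugates of [H1] is stable under conjugation by products of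
    horizontal elements, hence, differentiating, under brackets with [H1]; by the Jacobi
    identity it is a subalgebra. *)
Lemma gconj_horizontal_span (W : {vspace 'rV[R]_n}) :
  (forall s X, horizontal s -> H1 G X -> gconj (gprod s) X \in W) -> W = fullv.
Proof.
pose gens (W : {vspace 'rV[R]_n}) :=
  forall s X, horizontal s -> H1 G X -> gconj (gprod s) X \in W.
(* The smallest subspace containing all the conjugates. *)
have [W0 W0P] : exists W0 : {vspace 'rV[R]_n}, forall x, x \in W0 <-> forall W, gens W -> x \in W.
  apply: vspace_of_pred => [V _|a x y Vx Vy V VP]; first exact: mem0v.
  by apply: memvD; [apply: memvZ; exact: Vx|exact: Vy].
have H1W X : H1 G X -> X \in W0.
  by move=> HX; apply/W0P => V /(_ [::] X); rewrite /= gconj0g; apply.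
have gconjW (h : seq 'rV[R]_n) x : horizontal h -> x \in W0 -> gconj (gprod h) x \in W0.
  move=> hh /W0P xW; apply/W0P => V VP.
  have [V' V'P] : exists V' : {vspace 'rV[R]_n}, forall x, x \in V' <-> gconj (gprod h) x \in V.
    apply: vspace_of_pred => [|a u v uV vV]; first by rewrite gconjg0 mem0v.
    by rewrite gconj_linear memvD ?memvZ.
  apply/V'P/xW => s X hs HX; apply/V'P; rewrite -gconjM -gprod_cat.
  by apply: VP => //; exact: horizontal_cat.
have lieW X x : H1 G X -> x \in W0 -> lie G X x \in W0.
  move=> HX xW; apply: (vspace_closed _ (@gconj_derivative X x)) => k.
  apply: memvZ; apply: memvB => //.
  have := gconjW [:: k.+1%:R^-1 *: X] x; rewrite /= gmulx0; apply => //.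
  by move=> Y; rewrite inE => /eqP-> i /HX hi; rewrite mxE hi mulr0.
(* The elements of W0 whose brackets with W0 stay in W0 form a subalgebra containing the first
   layer, which generates. *)
have [A AP] : exists A : {vspace 'rV[R]_n}, forall x, x \in A <->
    (x \in W0 /\ forall y, y \in W0 -> lie G x y \in W0).
  apply: vspace_of_pred => [|a u v [uW hu] [vW hv]].
    by split=> [|y _]; rewrite ?lie0l mem0v.
  split=> [|y yW]; first by rewrite memvD ?memvZ.
  by rewrite lieDl memvD ?memvZ ?hu ?hv.
have A_full : A = fullv.
  apply: (@lie_generated _ _ G) => [X HX|x y /AP[xW hx] /AP[yW hy]].
    by apply/AP; split=> [|y yW]; [exact: H1W|exact: lieW].
  apply/AP; split=> [|z zW]; first exact: hx.
  have -> : lie G (lie G x y) z = lie G x (lie G y z) - lie G y (lie G x z).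
    rewrite (lie_antisym G x z) lieNr opprK.
    rewrite (lie_antisym G (lie G x y) z); apply/eqP; rewrite eq_sym -subr_eq0 opprK.
    by apply/eqP; exact: lie_jacobi.
  by apply: memvB; [exact: hx (hy _ zW)|exact: hy (hx _ zW)].
move=> WP; apply/eqP; rewrite eqEsubv subvf /=; apply/subvP => x _.
have : x \in A by rewrite A_full memvf.
by move=> /AP[/W0P/(_ _ WP)].
Qed.

End Conjugation.

(** * Words of horizontal elements and their frames *)

Lemma mem_zip_unzip (S T : eqType) (s : seq S) (t : seq T) q :
  q \in zip s t -> (q.1 \in s) && (q.2 \in t).
Proof.
elim: s t => [|x s IH] [|y t] //=; rewrite !inE => /orP[/eqP->|/IH/andP[-> ->]].
  by rewrite !eqxx.
by rewrite !orbT.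
Qed.

Section HorizontalWords.
Variables (R : realType) (n : nat) (G : stratifiedGroup R n).
Implicit Types (g h x y z X : 'rV[R]_n) (s t : seq 'rV[R]_n) (bs : seq bool).

Local Notation "x '**' y" := (gmul G x y) (at level 40, left associativity).

Lemma H1D (a : R) x y : H1 G x -> H1 G y -> H1 G (a *: x + y).
Proof. by move=> hx hy i di; rewrite !mxE hx // hy // mulr0 addr0. Qed.

Lemma H10 : H1 G 0. Proof. by move=> i _; rewrite mxE. Qed.

Lemma H1Z (a : R) x : H1 G x -> H1 G (a *: x).
Proof. by move=> hx; rewrite -[a *: x]addr0; apply: H1D => //; exact: H10. Qed.

Lemma H1N x : H1 G x -> H1 G (- x).
Proof. by rewrite -scaleN1r; exact: H1Z. Qed.

Lemma dil_H1 (r : R) x : H1 G x -> dil (deg G) r x = r *: x.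
Proof. by move=> /dil_layer ->; rewrite expr1. Qed.

Lemma horizontal_map (f : 'rV[R]_n -> 'rV[R]_n) s :
  (forall X, H1 G X -> H1 G (f X)) -> horizontal G s -> horizontal G (map f s).
Proof. by move=> fH hs _ /mapP[X /hs hX ->]; exact: fH. Qed.

Lemma nth_horizontal s i : horizontal G s -> H1 G (nth 0 s i).
Proof.
move=> hs; have [h|h] := ltnP i (size s); first by apply: hs; exact: mem_nth.
by rewrite nth_default //; exact: H10.
Qed.

Lemma gprodN s : - gprod G s = gprod G (rev (map -%R s)).
Proof.
elim: s => [|x s IH]; first by rewrite oppr0.
by rewrite /= gmul_oppM IH rev_cons -cats1 gprod_cat /= gmulx0.
Qed.

Lemma gconj_gprod g s : gconj G g (gprod G s) = gprod G (map (gconj G g) s).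
Proof. by elim: s => [|x s IH] /=; rewrite ?gconjg0 // gconj_gmul IH. Qed.

Lemma dil_gprod (r : R) s : dil (deg G) r (gprod G s) = gprod G (map (dil (deg G) r) s).
Proof. by elim: s => [|x s IH] /=; rewrite ?dil0 // dil_gmul IH. Qed.

(** Rescaling the [i]-th factor of the product of [s] by [1 + t] multiplies the product
    on the left by [t] times this vector. *)
Definition frame s i := gconj G (gprod G (take i s)) (nth 0 s i).

Definition wprod (c : seq R) s := gprod G [seq p.1 *: p.2 | p <- zip c s].

(** Write each factor [(1 + a) X] as the product of [a X] and [X], and move all the [a X] to the
    left, which conjugates them by the preceding factors. *)
Lemma wprod_frame (c : seq R) s : size c = size s ->
  wprod [seq 1 + a | a <- c] s = wprod c (mkseq (frame s) (size s)) ** gprod G s.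
Proof.
elim: s c => [|x s IH] [|a c] //=; first by rewrite gmulx0.
move=> [sz]; rewrite /wprod /= -/(wprod _ _) IH //.
have -> : frame (x :: s) 0 = x by rewrite /frame /= gconj0g.
have -> : [seq frame (x :: s) i | i <- iota 1 (size s)] = map (gconj G x) (mkseq (frame s) (size s)).
  rewrite (iotaDl 1) -!map_comp; apply: eq_map => i /=.
  by rewrite /frame /= gconjM.
have -> : (1 + a) *: x = (a *: x) ** x.
  by have := gmul_collinear G a 1 x; rewrite scale1r addrC => ->.
rewrite -!gmulA; congr (_ ** _).
rewrite !gmulA; congr (_ ** _); rewrite -gconj_mulr; congr (_ ** _).
rewrite /wprod gconj_gprod; congr gprod.
elim: c (mkseq _ _) {sz IH} => [|b c IH] [|y v] //=.
by rewrite gconjZ IH.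
Qed.

Lemma frame_cat s t i : (i < size s)%N -> frame (s ++ t) i = frame s i.
Proof. by move=> h; rewrite /frame take_cat nth_cat h. Qed.

Lemma frame_rcons s X : frame (rcons s X) (size s) = gconj G (gprod G s) X.
Proof. by rewrite /frame -cats1 take_size_cat // nth_cat ltnn subnn. Qed.

Lemma frame_dil (r : R) s i : horizontal G s ->
  frame [seq r *: X | X <- s] i = dil (deg G) r (frame s i).
Proof.
move=> hs; rewrite /frame /gconj !dil_gmul.
have dN g : dil (deg G) r (- g) = - dil (deg G) r g.
  by apply/rowP => j; rewrite !mxE mulrN.
rewrite dN dil_gprod -map_take.
have -> : [seq dil (deg G) r X | X <- take i s] = [seq r *: X | X <- take i s].
  by apply/eq_in_map => X /mem_take/hs hX; rewrite dil_H1.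
congr (_ ** _ ** _); rewrite dil_H1; last exact: nth_horizontal.
have [h|h] := ltnP i (size s); first by rewrite (nth_map 0).
by rewrite !nth_default ?size_map ?scaler0.
Qed.

Definition frame_mx s (p : 'I_n -> nat) : 'M[R]_n := \matrix_j frame s (p j).

Lemma frame_mx_dil_det (r : R) s p : horizontal G s -> r != 0 ->
  (\det (frame_mx [seq r *: X | X <- s] p) != 0) = (\det (frame_mx s p) != 0).
Proof.
move=> hs r0.
have -> : frame_mx [seq r *: X | X <- s] p = frame_mx s p *m diag_mx (\row_i r ^+ deg G i).
  by apply/matrixP => i j; rewrite mul_mx_diag !mxE frame_dil // mxE mulrC.
rewrite det_mulmx det_diag mulf_eq0 negb_or.
suff -> : \prod_i (\row_i r ^+ deg G i) 0 i != 0 :> R by rewrite andbT.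
by apply/prodf_neq0 => i _; rewrite mxE expf_neq0.
Qed.

(** Greedy choice: as long as the frame vectors do not span, some conjugate of a horizontal
    vector leaves their span. *)
Lemma free_frame_exists m : (m <= n)%N -> exists s (ps : seq nat),
  [/\ horizontal G s, size ps = m, forall i, i \in ps -> (i < size s)%N &
      free [seq frame s i | i <- ps]].
Proof.
elim: m => [_|m IH mn].
  by exists [::], [::]; split; rewrite // ?nil_free.
have [s [ps [hs sz lt fr]]] := IH (ltnW mn).
pose W := <<[seq frame s i | i <- ps]>>%VS.
have [V VP] : exists V : {vspace 'rV[R]_n}, forall x, x \in V <-> gconj G (gprod G s) x \in W.
  apply: vspace_of_pred => [|a u v uV vV]; first by rewrite gconjg0 mem0v.
  by rewrite gconj_linear memvD ?memvZ.
have [t [X [ht HX nX]]] : exists t X,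
    [/\ horizontal G t, H1 G X & gconj G (gprod G (s ++ t)) X \notin W].
  apply: contrapT => h; have VT : V = fullv.
    apply: (@gconj_horizontal_span _ _ G) => t X ht HX; apply/VP.
    rewrite -gconjM -gprod_cat; apply: contraT => nX.
    by case: h; exists t, X.
  have : (\dim W < \dim {:'rV[R]_n})%N.
    move: fr; rewrite /free => /eqP ->; rewrite size_map sz dimvf /dim /= mul1n.
    exact: mn.
  suff -> : W = fullv by rewrite ltnn.
  apply/eqP; rewrite eqEsubv subvf /=; apply/subvP => x _.
  have : gconj G (- gprod G s) x \in V by rewrite VT memvf.
  by move=> /VP; rewrite -gconjM gmulxN gconj0g.
exists (rcons (s ++ t) X), (size (s ++ t) :: ps); split.
- rewrite -cats1; apply: horizontal_cat; first exact: horizontal_cat.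
  by apply: horizontal_cons.
- by rewrite /= sz.
- move=> i; rewrite size_rcons inE => /orP[/eqP ->//|/lt il].
  by rewrite ltnS ltnW // size_cat ltn_addr.
rewrite /= frame_rcons free_cons; apply/andP.
have -> : [seq frame (rcons (s ++ t) X) i | i <- ps] = [seq frame s i | i <- ps].
  apply/eq_in_map => i /lt il; rewrite -cats1 frame_cat ?frame_cat //.
  by rewrite size_cat ltn_addr.
by split.
Qed.

Lemma frame_basis_exists : exists s (p : 'I_n -> nat),
  [/\ horizontal G s, forall j, (p j < size s)%N & \det (frame_mx s p) != 0].
Proof.
have [s [ps [hs sz lt fr]]] := free_frame_exists (leqnn n).
exists s, (fun j => nth 0%N ps j); split => // [j|].
  by apply: lt; rewrite mem_nth // sz.
rewrite -unitfE -unitmxE -row_free_unit; apply: inj_row_free => v v0.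
have szf : size [seq frame s i | i <- ps] == n by rewrite size_map sz.
have /freeP h : free (Tuple szf) by [].
apply/rowP => j; rewrite mxE; apply: (h (fun j => v 0 j)).
rewrite -[RHS]v0 mulmx_sum_row; apply: eq_bigr => i _; congr (_ *: _).
rewrite rowK (nth_map 0%N) // sz; exact: ltn_ord.
Qed.

Definition flip bs s := [seq (if p.1 then - p.2 else p.2) | p <- zip bs s].

Lemma size_flip bs s : size bs = size s -> size (flip bs s) = size s.
Proof. by move=> e; rewrite size_map size_zip e minnn. Qed.

Lemma flipK bs s : size bs = size s -> flip bs (flip bs s) = s.
Proof.
by elim: bs s => [|b bs IH] [|x s] //= [/IH e]; rewrite /flip /= -!/(flip _ _) e; case: b; rewrite ?opprK.
Qed.

Lemma horizontal_flip bs s : horizontal G s -> horizontal G (flip bs s).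
Proof.
move=> hs X /mapP[[b Y]] /mem_zip_unzip /=/andP[_ /hs hY] ->; case: b => //; exact: H1N.
Qed.

Lemma flip_scale (r : R) bs s : flip bs [seq r *: X | X <- s] = [seq r *: X | X <- flip bs s].
Proof.
by elim: bs s => [|b bs IH] [|x s] //=; rewrite /flip /= -!/(flip _ _) IH; case: b; rewrite ?scalerN.
Qed.

Lemma polynomial_frame_det (c : seq (R -> 'rV[R]_n)) p :
  (forall k, k \in c -> polynomial_curve k) ->
  polynomial_in (fun u => \det (frame_mx [seq k u | k <- c] p)).
Proof.
move=> pc.
have pg (l : seq (R -> 'rV[R]_n)) : {subset l <= c} -> polynomial_curve (fun u => gprod G [seq k u | k <- l]).
  elim: l => [|k l IH] lc; first exact: polynomial_curve_cst.
  apply: polynomial_curve_gmul; first by apply: pc; apply: lc; rewrite mem_head.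
  by apply: IH => k' kl; apply: lc; rewrite inE kl orbT.
have pf i : polynomial_curve (fun u => frame [seq k u | k <- c] i).
  have pt : polynomial_curve (fun u => gprod G (take i [seq k u | k <- c])).
    move=> j; have [q qP] := pg (take i c) (fun k kt => mem_take kt) j.
    by exists q => u; rewrite -qP map_take.
  apply: polynomial_curve_gmul; last exact: polynomial_curveN.
  apply: polynomial_curve_gmul => //.
  have [h|h] := ltnP i (size c).
    move=> j; have [q qP] := pc _ (mem_nth (fun=> 0) h) j.
    by exists q => u; rewrite -qP (nth_map (fun=> 0)).
  move=> j; have [q qP] := polynomial_curve_cst (0 : 'rV[R]_n) j.
  by exists q => u; rewrite -qP nth_default // size_map.
have [q qP] : polynomial_in (fun u => \sum_(w : 'S_n) (-1) ^+ w *
    \prod_i frame [seq k u | k <- c] (p i) 0 (w i)).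
  apply: polynomial_in_sum => w; apply: polynomial_inM (polynomial_in_cst _) _.
  by apply: polynomial_in_prod => i; exact: pf.
exists q => u; rewrite -qP /determinant; apply: eq_bigr => w _; congr (_ * _).
by apply: eq_bigr => i _; rewrite mxE.
Qed.

(** One word has to serve for all changes of signs, because the convexity inequalities lead from
    the origin of a path to the end points of all the paths with modified signs. For each choice
    of the signs the condition holds for a suitable word, and it is polynomial along lines of
    words of the same length; so finitely many conditions can be satisfied together. *)
Lemma flip_frame_basis_exists : exists s (p : 'I_n -> nat),
  [/\ horizontal G s, forall j, (p j < size s)%N &
      forall bs, size bs = size s -> \det (frame_mx (flip bs s) p) != 0].
Proof.
have [s0 [p [hs0 p0 det0]]] := frame_basis_exists.
suff gen (l : seq (seq bool)) : all (fun bs => size bs == size s0) l ->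
    exists s, [/\ horizontal G s, size s = size s0 &
      all (fun bs => \det (frame_mx (flip bs s) p) != 0) l].
  have [|s [hs ss /allP sl]] := gen [seq tval b | b <- enum {: (size s0).-tuple bool}].
    by apply/allP => _ /mapP[b _ ->]; rewrite size_tuple.
  exists s, p; split => // [j|bs sz]; first by rewrite ss.
  apply: sl; have /eqP sz' : size bs = size s0 by rewrite sz.
  by apply/mapP; exists (Tuple sz') => //; rewrite mem_enum.
(* Join a word that is good for the conditions in l to one that is good for bs0. *)
elim: l => [_|bs0 l IH /= /andP[/eqP sz0 sl]]; first by exists s0.
have [s [hs ss al]] := IH sl; pose s1 := flip bs0 s0.
have hs1 : horizontal G s1 by exact: horizontal_flip.
have ss1 : size s1 = size s0 by apply: size_flip; rewrite sz0.
pose c := [seq (fun u : R => u *: (nth 0 s1 i - nth 0 s i) + nth 0 s i) | i <- iota 0 (size s0)].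
pose line (u : R) := [seq k u | k <- c].
have line0 : line 0 = s.
  rewrite /line /c -map_comp; apply: (@eq_from_nth _ 0); rewrite ?size_map ?size_iota // => i il.
  by rewrite (nth_map 0%N) ?size_iota // nth_iota //= scale0r add0r.
have line1 : line 1 = s1.
  rewrite /line /c -map_comp; apply: (@eq_from_nth _ 0); rewrite !size_map size_iota.
    by rewrite -[RHS](size_map (fun q => if q.1 then - q.2 else q.2)) -/(flip bs0 s0) ss1.
  move=> i il.
  by rewrite (nth_map 0%N) ?size_iota // nth_iota //= scale1r subrK.
have pol bs : polynomial_in (fun u => \det (frame_mx (flip bs (line u)) p)).
  pose cb := [seq (fun u : R => if q.1 then - q.2 u else q.2 u) | q <- zip bs c].
  have [|q qP] := @polynomial_frame_det cb p.
    move=> k /mapP[[b k'] /mem_zip_unzip /= /andP[_ /mapP[i _ ->]] ->] /=.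
    have pk : polynomial_curve (fun u : R => u *: (nth 0 s1 i - nth 0 s i) + nth 0 s i).
      by apply: polynomial_curveD (polynomial_curve_line _) (polynomial_curve_cst _).
    by case: b => //; exact: polynomial_curveN.
  exists q => u; rewrite -qP; congr (\det (frame_mx _ p)).
  rewrite /line /cb; elim: (bs) (c) => [|b bs' IHb] [|k c'] //=.
  by rewrite /flip /= -/(flip _ _) IHb.
have [q [q0 qP]] : exists q : {poly R}, q != 0 /\
    forall u, q.[u] != 0 -> all (fun bs => \det (frame_mx (flip bs (line u)) p) != 0) (bs0 :: l).
  have nz : all (fun bs => `[< exists u, \det (frame_mx (flip bs (line u)) p) != 0 >]) (bs0 :: l).
    apply/andP; split.
      by apply/asboolP; exists 1; rewrite line1 /s1 flipK.
    apply/allP => bs /(allP al) h; apply/asboolP; exists 0.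
    by rewrite line0.
  elim: (bs0 :: l) nz => [_|bs l' IHl /= /andP[/asboolP[u0 hu0] /IHl[q [q0 qP]]]].
    by exists 1; rewrite oner_eq0.
  have [q' q'P] := pol bs; exists (q' * q); split.
    rewrite mulf_neq0 //; apply: contraNneq hu0 => q'0.
    by rewrite q'P q'0 horner0.
  by move=> u; rewrite hornerM mulf_eq0 negb_or -q'P => /andP[-> /qP].
have [k kP] := poly_nonroot q0.
exists (line k%:R); split; last exact: qP.
  move=> _ /mapP[_ /mapP[i _ ->] ->]; apply: H1D; last exact: nth_horizontal.
  rewrite -scaleN1r addrC; apply: H1D; exact: nth_horizontal.
by rewrite !size_map size_iota.
Qed.

End HorizontalWords.

(** * Horizontal products near the origin *)

(* Completeness and norm have to be joined for the contraction principle. *)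
HB.instance Definition _ (R : realType) (m n : nat) := Complete.on 'M[R]_(m, n).

Section LocalAnalysis.
Variables (R : realType) (n : nat) (G : stratifiedGroup R n).
Implicit Types (y : 'rV[R]_n).

Local Notation "x '**' y" := (gmul G x y) (at level 40, left associativity).

(** Strict differentiability at the origin, with zero derivative. *)
Definition flat0 m (f : 'rV[R]_m -> 'rV[R]_n) := forall eta : R, 0 < eta ->
  exists2 r, 0 < r & forall v v', `|v| <= r -> `|v'| <= r ->
    `|f v - f v'| <= eta * `|v - v'|.

Definition lipschitz0 m (f : 'rV[R]_m -> 'rV[R]_n) :=
  f 0 = 0 /\ exists2 L, 0 <= L & forall v v', `|f v - f v'| <= L * `|v - v'|.

Lemma lipschitz0_sum m (fs : seq ('rV[R]_m -> 'rV[R]_n)) :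
  (forall f, f \in fs -> lipschitz0 f) -> lipschitz0 (fun v => \sum_(f <- fs) f v).
Proof.
elim: fs => [_|f fs IH Lf].
  by split; [rewrite big_nil|exists 0 => // v v'; rewrite !big_nil subrr normr0 mul0r].
have [f0 [L L0 fL]] := Lf f (mem_head _ _).
have [|s0 [K K0 sK]] := IH; first by move=> k kfs; apply: Lf; rewrite inE kfs orbT.
split; first by rewrite big_cons f0 s0 addr0.
exists (L + K) => [|v v']; first exact: addr_ge0.
by rewrite !big_cons opprD addrACA mulrDl; apply: le_trans (ler_normD _ _) (lerD _ _).
Qed.

(** The group law differs from the addition by a term whose Lipschitz constant vanishes at the
    origin; so a product has the sum of the factors as its strict derivative. *)
Lemma gprod_flat0 m (fs : seq ('rV[R]_m -> 'rV[R]_n)) :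
  (forall f, f \in fs -> lipschitz0 f) ->
  gprod G [seq f 0 | f <- fs] = 0 /\
  flat0 (fun v => gprod G [seq f v | f <- fs] - \sum_(f <- fs) f v).
Proof.
elim: fs => [_|f fs IH Lf].
  split=> // eta eta0; exists 1 => // v v' _ _.
  by rewrite !big_nil /= !subrr normr0 mulr_ge0 // ltW.
have [f0 [L L0 fL]] := Lf f (mem_head _ _).
have Lfs k : k \in fs -> lipschitz0 k by move=> kfs; apply: Lf; rewrite inE kfs orbT.
have [P0 Pflat] := IH Lfs; have [S0 [K K0 SK]] := lipschitz0_sum Lfs.
split=> [|eta eta0]; first by rewrite /= P0 f0 gmulx0.
pose P v := gprod G [seq k v | k <- fs]; pose S v := \sum_(k <- fs) k v.
pose M := L + K + 1; have M0 : 0 < M by rewrite /M ltr_wpDl // addr_ge0.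
have [r1 r10 Pr1] := Pflat _ ltr01.
have [r2 r20 Pr2] := Pflat _ (divr_gt0 eta0 (@ltr0Sn R 1)).
have eta1 : 0 < eta / 2 / M by rewrite !divr_gt0.
have [r3 r30 Pr3] := gmul_near_addition G eta1.
have PM v v' : `|v| <= r1 -> `|v'| <= r1 -> `|P v - P v'| <= M * `|v - v'|.
  move=> vr vr'; have -> : P v - P v' = (S v - S v') + ((P v - S v) - (P v' - S v')).
    by apply/rowP => i; rewrite !mxE; ring.
  apply: le_trans (ler_normD _ _) _; apply: le_trans (lerD (SK _ _) (Pr1 _ _ vr vr')) _.
  by rewrite -mulrDl ler_wpM2r // /M -addrA lerDr.
have fM v v' : `|f v - f v'| <= M * `|v - v'|.
  by apply: le_trans (fL _ _) _; rewrite ler_wpM2r // /M -addrA lerDl addr_ge0.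
exists (Num.min r1 (Num.min r2 (r3 / M))) => [|v v'].
  by rewrite !lt_min r10 r20 divr_gt0.
rewrite !le_min => /and3P[v1 v2 v3] /and3P[v1' v2' v3'].
have r1ge : `|0 : 'rV[R]_m| <= r1 by rewrite normr0 ltW.
have fr w : `|w| <= r3 / M -> `|f w| <= r3.
  rewrite ler_pdivlMr // => h; apply: le_trans (_ : M * `|w| <= _); last by rewrite mulrC.
  by have := fM w 0; rewrite f0 !subr0.
have Pr w : `|w| <= r1 -> `|w| <= r3 / M -> `|P w| <= r3.
  rewrite ler_pdivlMr // => w1 h; apply: le_trans (_ : M * `|w| <= _); last by rewrite mulrC.
  by have := PM w 0 w1 r1ge; rewrite [P 0]P0 !subr0.
have h := Pr3 _ _ _ _ _ (fr _ v3) (Pr _ v1 v3) (fr _ v3') (Pr _ v1' v3') (fM v v') (PM v v' v1 v1').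
rewrite !big_cons /= -/(P v) -/(P v') -/(S v) -/(S v').
have -> : f v ** P v - (f v + S v) - (f v' ** P v' - (f v' + S v')) =
   (f v ** P v - f v - P v - (f v' ** P v' - f v' - P v')) + ((P v - S v) - (P v' - S v')).
  by apply/rowP => i; rewrite !mxE; ring.
apply: le_trans (ler_normD _ _) _; apply: le_trans (lerD h (Pr2 _ _ v2 v2')) _.
rewrite mulrA divfK ?gt_eqF // -mulrDl -splitr //.
Qed.

Lemma mulmx_bound m (A : 'M[R]_(m, n)) :
  {K : R | 0 < K & forall v : 'rV[R]_m, `|v *m A| <= K * `|v|}.
Proof.
exists (1 + \sum_i \sum_j `|A i j|) => [|v].
  by rewrite ltr_wpDr //; do 2!(apply: sumr_ge0 => ? _).
have S0 : 0 <= \sum_i \sum_j `|A i j| by do 2!(apply: sumr_ge0 => ? _).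
apply: row_norm_le => [|j]; first by rewrite mulr_ge0 // addr_ge0.
rewrite mxE mulrDl mul1r; apply: ler_wpDl => //; apply: le_trans (ler_norm_sum _ _ _) _.
rewrite mulr_suml; apply: ler_sum => i _; rewrite normrM mulrC.
apply: ler_pM => //; last exact: coord_norm_le.
by rewrite (bigD1 j) //= lerDl; apply: sumr_ge0.
Qed.

Section InverseFunction.
Variables (L : 'rV[R]_n -> 'rV[R]_n) (B : 'M[R]_n).
Hypotheses (B_unit : B \in unitmx) (L0 : L 0 = 0).
Hypothesis (L_flat : flat0 (fun v => L v - v *m B)).

Lemma inverse_lipschitz : exists C, exists2 r, 0 < r & 0 <= C /\
  forall v v', `|v| <= r -> `|v'| <= r -> `|v - v'| <= C * `|L v - L v'|.
Proof.
have [K K0 BK] := mulmx_bound (invmx B).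
have e0 : 0 < (2 * K)^-1 by rewrite invr_gt0 mulr_gt0.
have [r r0 rP] := L_flat e0.
exists (2 * K), r => //; split => [|v v' vr vr']; first by rewrite mulr_ge0 // ltW.
have := BK ((v - v') *m B); rewrite mulmxK // => h1.
have h2 := rP _ _ vr vr'.
have h3 : `|(v - v') *m B| <= `|L v - L v'| + (2 * K)^-1 * `|v - v'|.
  have -> : (v - v') *m B = (L v - L v') - ((L v - v *m B) - (L v' - v' *m B)).
    by rewrite mulmxBl; apply/rowP => i; rewrite !mxE; ring.
  by apply: le_trans (ler_normB _ _) _; rewrite lerD2l.
have h4 : K * ((2 * K)^-1 * `|v - v'|) = `|v - v'| / 2 by field; rewrite gt_eqF.
have := le_trans h1 (ler_wpM2l (ltW K0) h3).
by rewrite mulrDr h4; lra.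
Qed.

(** The solution of [L v = y] is the fixed point of the contraction
    [v |-> (y - (L v - v B)) B^-1]. *)
Lemma locally_onto : exists2 e : R, 0 < e & forall y, `|y| <= e ->
  exists2 v, `|v| <= 1 & L v = y.
Proof.
have [K K0 BK] := mulmx_bound (invmx B).
have e0 : 0 < (2 * K)^-1 by rewrite invr_gt0 mulr_gt0.
have [r' r0' rP'] := L_flat e0; pose r := Num.min r' 1.
have r0 : 0 < r by rewrite /r lt_min r0' ltr01.
have rP v v' : `|v| <= r -> `|v'| <= r ->
    `|(L v - v *m B) - (L v' - v' *m B)| <= (2 * K)^-1 * `|v - v'|.
  by rewrite /r !le_min => /andP[h _] /andP[h' _]; exact: rP'.
exists (r / (2 * K)) => [|y yr]; first by rewrite divr_gt0 // mulr_gt0.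
pose T v := (y - (L v - v *m B)) *m invmx B.
pose U := closed_ball_ (fun x : 'rV[R]_n => `|x|) 0 r.
have UE v : U v <-> `|v| <= r by rewrite /U /closed_ball_ /= sub0r normrN.
have TT v v' : U v -> U v' -> `|T v - T v'| <= 2^-1 * `|v - v'|.
  move=> /UE vr /UE vr'; rewrite /T -mulmxBl; apply: le_trans (BK _) _.
  have -> : y - (L v - v *m B) - (y - (L v' - v' *m B)) = - ((L v - v *m B) - (L v' - v' *m B)).
    by apply/rowP => i; rewrite !mxE; ring.
  rewrite normrN; apply: le_trans (ler_wpM2l (ltW K0) (rP _ _ vr vr')) _.
  by rewrite le_eqVlt; apply/orP; left; apply/eqP; field; rewrite gt_eqF.
have U0 : U 0 by apply/UE; rewrite normr0 ltW.
have TU v : U v -> U (T v).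
  move=> Uv; apply/UE; have := TT _ _ Uv U0; rewrite subr0 => h.
  have h0 : `|T 0| <= r / 2.
    rewrite /T L0 mul0mx subr0 subr0; apply: le_trans (BK _) _.
    apply: le_trans (ler_wpM2l (ltW K0) yr) _.
    by rewrite le_eqVlt; apply/orP; left; apply/eqP; field; rewrite gt_eqF.
  rewrite -[T v](subrK (T 0)); apply: le_trans (ler_normD _ _) _.
  by move/UE : Uv => Uv; lra.
pose Tf : {fun U >-> U} := HB.pack T (@isFun.Build _ _ U U T TU).
have ctr : is_contraction Tf.
  exists (2^-1)%:nng; split => /=; first by rewrite invf_lt1 // ltr1n.
  by move=> [v v'] [/= Uv Uv']; exact: TT.
have [||v Uv vT] := banach_fixed_point ctr.
- exact: closed_closed_ball_.
- by exists 0.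
exists v; first by move/UE : Uv; rewrite /r le_min => /andP[].
have : v *m B = y - (L v - v *m B) by rewrite {1}vT /= /T mulmxKV.
set w := v *m B => h; apply/rowP => i; have := congr1 (fun u : 'rV[R]_n => u 0 i) h.
by rewrite !mxE; lra.
Qed.

End InverseFunction.

(** The parameter [v_j] is put at position [p j] of a word of length [N]; the sum covers the
    case of several [j] with the same position. *)
Definition spread (p : 'I_n -> nat) N (v : 'rV[R]_n) : seq R :=
  [seq \sum_(j | p j == i) v 0 j | i <- iota 0 N].

Lemma size_spread p N v : size (spread p N v) = N.
Proof. by rewrite size_map size_iota. Qed.

Lemma spread_bound p N v a : a \in spread p N v -> `|a| <= n%:R * `|v|.
Proof.
move=> /mapP[i _ ->]; apply: le_trans (ler_norm_sum _ _ _) _.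
apply: le_trans (_ : \sum_(j < n) `|v| <= _).
  rewrite big_mkcond /=; apply: ler_sum => j _.
  by case: ifP => // _; rewrite coord_norm_le.
by rewrite sumr_const card_ord mulr_natl.
Qed.

Definition frame_chart s p v :=
  wprod G (spread p (size s) v) (mkseq (frame G s) (size s)).

Lemma frame_chart_flat0 s p : (forall j, (p j < size s)%N) ->
  frame_chart s p 0 = 0 /\ flat0 (fun v => frame_chart s p v - v *m frame_mx G s p).
Proof.
move=> ps; pose fs := [seq (fun v : 'rV[R]_n => (\sum_(j | p j == i) v 0 j) *: frame G s i) | i <- iota 0 (size s)].
have E v : frame_chart s p v = gprod G [seq f v | f <- fs].
  rewrite /frame_chart /wprod /spread /mkseq /fs zip_map -!map_comp.
  by congr gprod; apply: eq_map => i.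
have S v : \sum_(f <- fs) f v = v *m frame_mx G s p.
  rewrite /fs big_map mulmx_sum_row.
  have -> : iota 0 (size s) = index_iota 0 (size s) by rewrite /index_iota subn0.
  rewrite big_mkord.
  under eq_bigr do rewrite scaler_suml.
  under eq_bigr do rewrite big_mkcond.
  rewrite exchange_big /=; apply: eq_bigr => j _; rewrite rowK.
  rewrite (bigD1 (Ordinal (ps j))) //= eqxx big1 ?addr0 // => i ne.
  by case: eqP => // e; case/eqP: ne; apply/val_inj.
have Lfs f : f \in fs -> lipschitz0 f.
  move=> /mapP[i _ ->]; split.
    by rewrite big1 ?scale0r // => j _; rewrite mxE.
  exists (n%:R * `|frame G s i|) => [|v v']; first by rewrite mulr_ge0.
  rewrite -scalerBl normrZ mulrAC ler_wpM2r // -sumrB.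
  under eq_bigr => j _ do [have -> : v 0 j - v' 0 j = (v - v') 0 j by rewrite !mxE].
  have [h|h] := ltnP i (size s); last first.
    rewrite big1 ?normr0 ?mulr_ge0 // => j /eqP pj.
    by have := ps j; rewrite pj ltnNge h.
  apply: (@spread_bound p (size s)); apply/mapP; exists i => //.
  by rewrite mem_iota.
have [P0 Pf] := gprod_flat0 Lfs; split; first by rewrite E.
by under eq_fun do rewrite E -S.
Qed.

Lemma wprod_frame_chart s p v :
  wprod G [seq 1 + a | a <- spread p (size s) v] s = frame_chart s p v ** gprod G s.
Proof. by rewrite wprod_frame // size_spread. Qed.

(** Rescaling the letters of a word with an invertible frame and dividing by the original product
    covers a neighbourhood of the origin. A dilation then makes the letters small, while their
    number remains the same. *)
Lemma horizontal_products_near0 : exists N, forall e : R, 0 < e -> exists2 r, 0 < r &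
  forall y, `|y| <= r -> exists hs, [/\ size hs = N, horizontal G hs,
    forall X, X \in hs -> `|X| <= e & gprod G hs = y].
Proof.
have [s [p [hs ps det0]]] := frame_basis_exists G.
have [c0 cf] := frame_chart_flat0 ps.
have Bu : frame_mx G s p \in unitmx by rewrite unitmxE unitfE.
have [d d0 dP] := locally_onto Bu c0 cf.
pose C := (n%:R + 1) * \sum_(X <- s) `|X| + 1.
have C0 : 0 < C by rewrite /C ltr_wpDl // mulr_ge0 ?addr_ge0 // sumr_ge0.
have sC X : X \in s -> (n%:R + 1) * `|X| <= C.
  move=> Xs; rewrite /C ler_wpDr // ler_wpM2l ?addr_ge0 //.
  by rewrite (big_rem X) //= lerDl sumr_ge0.
have reach y : `|y| <= d -> exists hs', [/\ size hs' = (size s + size s)%N, horizontal G hs',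
    forall X, X \in hs' -> `|X| <= C & gprod G hs' = y].
  move=> /dP[v v1 <-].
  exists ([seq q.1 *: q.2 | q <- zip [seq 1 + a | a <- spread p (size s) v] s] ++ rev (map -%R s)); split.
  - by rewrite size_cat size_rev !size_map size_zip size_map size_spread minnn.
  - apply: horizontal_cat => [_ /mapP[q /mem_zip_unzip/andP[_ /hs hX] ->]|X]; first exact: H1Z.
    by rewrite mem_rev; apply: horizontal_map hs _ => Y; exact: H1N.
  - move=> X; rewrite mem_cat mem_rev => /orP[/mapP[[b Y] /mem_zip_unzip/= /andP[/mapP[a ab ->] Ys] ->]|].
      rewrite normrZ; apply: le_trans (sC _ Ys); apply: ler_wpM2r => //.
      rewrite addrC; apply: le_trans (ler_normD _ _) _; rewrite normr1 lerD2r.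
      by apply: le_trans (spread_bound ab) _; rewrite ler_piMr.
    move=> /mapP[Y Ys ->]; rewrite normrN; apply: le_trans (sC _ Ys).
    by rewrite ler_peMl // lerDr.
  - by rewrite gprod_cat -gprodN -/(wprod _ _ _) wprod_frame_chart gmulK.
exists (size s + size s)%N => e e0; pose r := Num.min (e / C) 1.
have r0 : 0 < r by rewrite /r lt_min ltr01 andbT divr_gt0.
have r1 : r <= 1 by rewrite /r ge_min lexx orbT.
exists (d * r ^+ step G) => [|y yr]; first by rewrite mulr_gt0 // exprn_gt0.
have [|hs' [sz hh hC E]] := reach (dil (deg G) r^-1 y).
  apply: row_norm_le => [|i]; first exact: ltW.
  rewrite mxE normrM normrX normfV (gtr0_norm r0) exprVn ler_pdivrMl ?exprn_gt0 //.
  apply: le_trans (coord_norm_le _ _) (le_trans yr _).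
  rewrite mulrC ler_wpM2r //; first exact: ltW.
  by apply: ler_wiXn2l => //; [exact: ltW|have /andP[_] := deg_bounds G i].
exists [seq r *: X | X <- hs']; split.
- by rewrite size_map.
- by apply: horizontal_map hh => X; exact: H1Z.
- move=> _ /mapP[X /hC XC ->]; rewrite normrZ gtr0_norm //.
  apply: le_trans (ler_pM (ltW r0) (normr_ge0 _) _ XC) _; first exact: lexx.
  by rewrite -ler_pdivlMr // /r ge_min lexx.
have -> : [seq r *: X | X <- hs'] = [seq dil (deg G) r X | X <- hs'].
  by apply/eq_in_map => X /hh hX; rewrite dil_H1.
rewrite -dil_gprod E -{1}[r]invrK dilK // invr_neq0 //; exact: lt0r_neq0.
Qed.

End LocalAnalysis.

(** * Lebesgue outer measure *)

Section BoxOuterMeasure.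
Variables (R : realType) (n : nat).
Local Notation V := ('rV[R]_n).
Implicit Types (A B E X : set V) (a b : V).

Local Open Scope ereal_scope.

Definition boxes_around A : set (V * V) :=
  [set p : V * V | (forall i, (p.1 0%R i <= p.2 0%R i)%R) /\ A `<=` box p.1 p.2].

(** The empty set is treated apart for the sake of dimension zero, where every box has volume
    one. *)
Definition hull_volume A : \bar R := if `[< A = set0 >] then 0 else
  ereal_inf [set (box_volume p.1 p.2)%:E | p in boxes_around A].

Lemma box_volume_ge0 a b : (forall i, (a 0%R i <= b 0%R i)%R) -> (0 <= box_volume a b)%R.
Proof. by move=> ab; apply: prodr_ge0 => i _; rewrite subr_ge0. Qed.

Lemma hull_volume_ge0 A : 0 <= hull_volume A.
Proof.
rewrite /hull_volume; case: ifP => // _; apply: le_ereal_inf_tmp => _ [p [pp _] <-].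
by rewrite lee_fin box_volume_ge0.
Qed.

Lemma hull_volume0 : hull_volume set0 = 0.
Proof. by rewrite /hull_volume asboolT. Qed.

Lemma hull_volume_le A a b : (forall i, (a 0%R i <= b 0%R i)%R) -> A `<=` box a b ->
  hull_volume A <= (box_volume a b)%:E.
Proof.
move=> ab Aab; rewrite /hull_volume; case: ifP => _; first by rewrite lee_fin box_volume_ge0.
by apply: ereal_inf_lbound; exists (a, b).
Qed.

(** Lebesgue outer measure. All sets are declared measurable, so that the Caratheodory
    extension applies to the set function [hull_volume]. *)
Definition box_outer : set V -> \bar R :=
  mu_ext (T := g_sigma_algebraType (@setT (set V))) hull_volume.

HB.instance Definition _ := isOuterMeasure.Build R V box_outer
  (mu_ext0 (T := g_sigma_algebraType (@setT (set V))) hull_volume0 hull_volume_ge0)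
  (mu_ext_ge0 (T := g_sigma_algebraType (@setT (set V))) hull_volume_ge0)
  (le_mu_ext (T := g_sigma_algebraType (@setT (set V))) hull_volume)
  (mu_ext_sigma_subadditive (T := g_sigma_algebraType (@setT (set V))) hull_volume_ge0).

Lemma all_measurable A : measurable (A : set (g_sigma_algebraType (@setT (set V)))).
Proof. exact: sub_sigma_algebra. Qed.

Lemma box_outer_le_cover A (F : nat -> set V) : A `<=` \bigcup_k F k ->
  box_outer A <= \sum_(k <oo) hull_volume (F k).
Proof.
by move=> AF; apply: ereal_inf_lbound; exists F => //; split=> // k; exact: all_measurable.
Qed.

Lemma box_outer_glb A (l : \bar R) :
  (forall F : nat -> set V, A `<=` \bigcup_k F k -> l <= \sum_(k <oo) hull_volume (F k)) ->
  l <= box_outer A.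
Proof. by move=> h; apply: le_ereal_inf_tmp => _ [F [_ AF] <-]; exact: h. Qed.

Lemma box_outer_hull A : box_outer A <= hull_volume A.
Proof.
apply: le_trans (box_outer_le_cover (F := fun k => if k is 0%N then A else set0) _) _.
  by move=> x Ax; exists 0%N.
rewrite (nneseries_split _ 1); last by move=> *; exact: hull_volume_ge0.
rewrite add0n big_nat1 eseries0 ?adde0 // => -[//|k] _ _; exact: hull_volume0.
Qed.

Lemma box_outer_box a b : (forall i, (a 0%R i <= b 0%R i)%R) ->
  box_outer (box a b) <= (box_volume a b)%:E.
Proof. by move=> ab; apply: le_trans (box_outer_hull _) (hull_volume_le ab _). Qed.

(** A coordinate hyperplane cuts a box into two boxes whose volumes add up. *)
Lemma hull_volume_cut A (i : 'I_n) (c : R) (H : set V) :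
  (forall x, H x -> (x 0%R i <= c)%R) -> (forall x, ~ H x -> (c <= x 0%R i)%R) ->
  hull_volume (A `&` H) + hull_volume (A `\` H) <= hull_volume A.
Proof.
move=> Hc Hc'; rewrite {3}/hull_volume; case: ifP => [/asboolP ->|_].
  by rewrite set0I set0D hull_volume0 adde0.
apply: le_ereal_inf_tmp => _ [[a b] /= [ab Aab] <-].
have [bc|cb] := leP (b 0%R i) c.
  have [ac|ac] := eqVneq (A `\` H) set0.
    by rewrite ac hull_volume0 adde0; apply: hull_volume_le => // x [/Aab].
  have [x [Ax Hx]] : exists x, A x /\ ~ H x by have /set0P[x [? ?]] := ac; exists x.
  have /(_ i)/andP[_ xb] := Aab _ Ax.
  have bi : b 0%R i = c by apply/eqP; rewrite eq_le bc (le_trans (Hc' _ Hx)).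
  rewrite -[leRHS]adde0; apply: leeD.
    by apply: hull_volume_le => // y [/Aab].
  pose a' : V := (\row_j if j == i then c else a 0%R j)%R.
  have -> : 0 = (box_volume a' b)%:E :> \bar R.
    by rewrite /box_volume (bigD1 i) //= mxE eqxx bi subrr mul0r.
  apply: hull_volume_le => [j|y [/Aab yab /Hc' cy] j].
    by rewrite mxE; case: eqP => [->|_]; rewrite ?bi.
  by rewrite mxE; have /andP[h1 h2] := yab j; case: eqP => [->|_]; rewrite ?bi ?h1 ?h2 // cy -bi;
    have /andP[_] := yab i.
have [ca|ac] := leP c (a 0%R i).
  have [ac|ac] := eqVneq (A `&` H) set0.
    by rewrite ac hull_volume0 add0e; apply: hull_volume_le => // x [/Aab].
  have [x [Ax Hx]] : exists x, A x /\ H x by have /set0P[x [? ?]] := ac; exists x.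
  have /(_ i)/andP[xa _] := Aab _ Ax.
  have ai : a 0%R i = c by apply/eqP; rewrite eq_le ca (le_trans xa (Hc _ Hx)).
  rewrite -[leRHS]add0e; apply: leeD; last first.
    by apply: hull_volume_le => // y [/Aab].
  pose b' : V := (\row_j if j == i then c else b 0%R j)%R.
  have -> : 0 = (box_volume a b')%:E :> \bar R.
    by rewrite /box_volume (bigD1 i) //= mxE eqxx ai subrr mul0r.
  apply: hull_volume_le => [j|y [/Aab yab /Hc cy] j].
    by rewrite mxE; case: eqP => [->|_]; rewrite ?ai.
  by rewrite mxE; have /andP[h1 h2] := yab j; case: eqP => [->|_]; rewrite ?ai ?h1 ?h2 // cy andbT -ai;
    have /andP[] := yab i.
pose b' : V := (\row_j if j == i then c else b 0%R j)%R.
pose a' : V := (\row_j if j == i then c else a 0%R j)%R.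
have -> : box_volume a b = (box_volume a b' + box_volume a' b)%R.
  pose r := (\prod_(j | j != i) (b 0 j - a 0 j))%R.
  have -> : box_volume a b' = ((c - a 0 i) * r)%R.
    rewrite /box_volume (bigD1 i) //= mxE eqxx; congr (_ * _)%R.
    by apply: eq_bigr => j /negbTE ji; rewrite mxE ji.
  have -> : box_volume a' b = ((b 0 i - c) * r)%R.
    rewrite /box_volume (bigD1 i) //= mxE eqxx; congr (_ * _)%R.
    by apply: eq_bigr => j /negbTE ji; rewrite mxE ji.
  by rewrite /box_volume (bigD1 i) //= -/r; ring.
rewrite EFinD; apply: leeD; apply: hull_volume_le.
- by move=> j; rewrite mxE; case: eqP => [->|_] //; exact: ltW.
- move=> y [/Aab yab /Hc cy] j; rewrite mxE; have /andP[h1 h2] := yab j.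
  by case: eqP => [ji|_]; rewrite h1 //= ji.
- by move=> j; rewrite mxE; case: eqP => [->|_] //; exact: ltW.
- move=> y [/Aab yab /Hc' cy] j; rewrite mxE; have /andP[h1 h2] := yab j.
  by case: eqP => [ji|_]; rewrite h2 ?h1 //= ji cy.
Qed.

Lemma half_space_caratheodory (i : 'I_n) (c : R) (H : set V) :
  (forall x, H x -> (x 0%R i <= c)%R) -> (forall x, ~ H x -> (c <= x 0%R i)%R) ->
  box_outer.-caratheodory H.
Proof.
move=> Hc Hc'; apply: le_caratheodory_measurable => X; apply: box_outer_glb => F XF.
apply: le_trans (_ : \sum_(k <oo) (hull_volume (F k `&` H) + hull_volume (F k `\` H)) <= _).
  rewrite nneseriesD; try by move=> *; exact: hull_volume_ge0.
  apply: leeD; apply: box_outer_le_cover => x [/XF[k _ Fk] Hx]; by exists k.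
apply: lee_nneseries => [k _ _|k _]; last exact: hull_volume_cut Hc Hc'.
by rewrite adde_ge0 ?hull_volume_ge0.
Qed.

Lemma box_caratheodory a b : box_outer.-caratheodory (box a b).
Proof.
have -> : box a b = \big[setI/setT]_(i < n)
    (~` [set x : V | x 0%R i < a 0%R i]%R `&` [set x | x 0%R i <= b 0%R i]%R).
  apply/seteqP; split=> [x xab|x].
    elim/big_rec: _ => // i Y _ YP; split=> //; have /andP[h1 h2] := xab i.
    by split=> //=; apply/negP; rewrite -leNgt.
  move=> h i; move: h; rewrite (bigD1 i) //= => -[[/negP + ->] _].
  by rewrite -leNgt => ->.
elim/big_rec: _ => [|i Y _ mY].
  by rewrite -setC0; apply: caratheodory_measurable_setC; exact: caratheodory_measurable_set0.
apply: caratheodory_measurable_setI => //; apply: caratheodory_measurable_setI.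
  apply: caratheodory_measurable_setC; apply: (@half_space_caratheodory i (a 0%R i)) => x /=.
    exact: ltW.
  by move/negP; rewrite -leNgt.
apply: (@half_space_caratheodory i (b 0%R i)) => x //= /negP; rewrite -ltNge; exact: ltW.
Qed.

(** Open sets are countable unions of boxes with rational center. *)
Lemma open_caratheodory A : open A -> box_outer.-caratheodory A.
Proof.
move=> oA; pose bx (q : 'rV[rat]_n * nat) : set V :=
  box (\row_i (ratr (q.1 0%R i) - q.2.+1%:R^-1))%R (\row_i (ratr (q.1 0%R i) + q.2.+1%:R^-1))%R.
pose F (k : nat) : set V := if unpickle k is Some q then
  (if `[< bx q `<=` A >] then bx q else set0) else set0.
suff -> : A = \bigcup_k F k.
  apply: caratheodory_measurable_bigcup => k; rewrite /F.
  case: (unpickle k) => [q|]; last exact: caratheodory_measurable_set0.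
  by case: ifP => _; [exact: box_caratheodory|exact: caratheodory_measurable_set0].
apply/seteqP; split=> [x Ax|x [k _]]; last first.
  by rewrite /F; case: (unpickle k) => // q; case: ifP => // /asboolP h /h.
have /nbhs_ballP[d /= d0 dA] := open_nbhs_nbhs (conj oA Ax).
pose m := Num.bound (2 / d)%R.
have md : (2 * m.+1%:R^-1 < d)%R.
  rewrite ltr_pdivrMr // mulrC -ltr_pdivrMr //.
  apply: lt_trans (archi_boundP _) _; first by rewrite divr_ge0 // ltW.
  by rewrite ltr_nat.
have qP i : exists q : rat, (`|x 0 i - ratr q| <= m.+1%:R^-1)%R.
  have /rat_in_itvoo[q] : (x 0 i - m.+1%:R^-1 < x 0 i + m.+1%:R^-1)%R.
    by rewrite ltrD2l gtrN ?invr_gt0.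
  rewrite in_itv /= => /andP[q1 q2]; exists q; rewrite ler_distlC.
  by rewrite (ltW q1) (ltW q2).
have [q qx] := choice qP.
exists (pickle (\row_i q i : 'rV[rat]_n, m)) => //; rewrite /F pickleK.
rewrite asboolT.
  move=> i; rewrite !mxE; have := qx i; rewrite ler_distl => /andP[h1 h2].
  by rewrite h1 h2.
move=> y ym; apply: dA; rewrite -ball_normE /=.
apply: le_lt_trans md; apply: row_norm_le => [|i]; first by rewrite mulr_ge0.
have := ym i; rewrite !mxE /= => /andP[h1 h2].
have := qx i; rewrite ler_distl => /andP[h3 h4].
move: h1 h2 h3 h4; set w := (m.+1%:R^-1)%R => h1 h2 h3 h4.
by rewrite ler_norml; apply/andP; split; lra.
Qed.

Lemma lebesgue_null_outer N : lebesgue_null N -> box_outer N = 0.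
Proof.
move=> N0; apply/eqP; rewrite eq_le outer_measure_ge0 andbT.
apply/lee_addgt0Pr => e e0; rewrite add0e.
have [a [b [ab Nab le]]] := N0 e e0.
apply: le_trans (box_outer_le_cover Nab) (le_trans _ le).
apply: lee_nneseries => [k _ _|k _]; first exact: hull_volume_ge0.
exact: hull_volume_le.
Qed.

Lemma null_caratheodory N : box_outer N = 0 -> box_outer.-caratheodory N.
Proof.
move=> N0; apply: le_caratheodory_measurable => X.
rewrite [X in X + _ <= _](_ : _ = 0); last first.
  by apply/eqP; rewrite eq_le outer_measure_ge0 andbT -N0; apply: le_outer_measure; exact: subIsetr.
by rewrite add0e; apply: le_outer_measure; exact: subIsetl.
Qed.

Lemma lebesgue_measurable_caratheodory A : lebesgue_measurable A -> box_outer.-caratheodory A.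
Proof.
move=> [B [sB /lebesgue_null_outer N0]].
have mB : box_outer.-caratheodory B.
  apply: sB; split; last exact: open_caratheodory.
  split; first exact: caratheodory_measurable_set0.
  - by move=> C mC; rewrite setTD; exact: caratheodory_measurable_setC.
  - by move=> F mF; exact: caratheodory_measurable_bigcup.
have null C : C `<=` (A `\` B) `|` (B `\` A) -> box_outer.-caratheodory C.
  move=> CN; apply: null_caratheodory; apply/eqP; rewrite eq_le outer_measure_ge0 andbT -N0.
  exact: le_outer_measure.
have -> : A = (B `|` (A `\` B)) `\` (B `\` A).
  apply/seteqP; split=> [x Ax|x [[Bx|[]//] nBA]].
    split; last by case.
    by have [Bx|Bx] := pselect (B x); [left|right].
  by apply: contrapT => Ax; exact: nBA.
apply: caratheodory_measurable_setD; last by apply: null; exact: subsetUr.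
by apply: caratheodory_measurable_setU => //; apply: null; exact: subsetUl.
Qed.

(** On Caratheodory measurable sets an outer measure is a measure, hence continuous from
    above. *)
Lemma caratheodory_cvg0 (T : pointedType) (mu : {outer_measure set T -> \bar R})
    (F : (set T)^nat) :
  mu (F 0%N) < +oo -> (forall k, mu.-caratheodory (F k)) -> \bigcap_k F k = set0 ->
  nonincreasing_seq F -> mu \o F @ \oo --> 0.
Proof.
move=> F0 mF Foo niF.
pose nu : {measure set (caratheodory_type mu) -> \bar R} := mu.
have nu0 : nu set0 = 0 by exact: outer_measure0.
rewrite -nu0 -Foo; apply: (nonincreasing_cvg_mu (mu := nu)) => //.
by rewrite Foo; exact: caratheodory_measurable_set0.
Qed.

Lemma measurable_exhaustion a b (A : nat -> set V) (e : R) :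
  (forall i, (a 0%R i <= b 0%R i)%R) -> (forall k, lebesgue_measurable (A k)) ->
  (forall k l, (k <= l)%N -> A k `<=` A l) ->
  box a b `<=` \bigcup_k A k -> (0 < e)%R ->
  exists k, box_outer (box a b `\` A k) <= e%:E.
Proof.
move=> ab mA incA cov e0; pose F k := box a b `\` A k.
have F0 : \bigcap_k F k = set0.
  rewrite -subset0 => x h; have [xb _] := h 0%N I.
  by have [k _ Ak] := cov _ xb; have [_] := h k I.
have mF k : box_outer.-caratheodory (F k).
  apply: caratheodory_measurable_setD; first exact: box_caratheodory.
  exact: lebesgue_measurable_caratheodory.
have : box_outer \o F @ \oo --> 0.
  apply: (@caratheodory_cvg0 _ box_outer) => //.
    apply: le_lt_trans (ltry (box_volume a b)); apply: le_trans (box_outer_box ab).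
    by apply: le_outer_measure; exact: subDsetl.
  apply/nonincreasing_seqP => k; apply/subsetPset => x [xb nA].
  by split=> // Ak; apply: nA; apply: incA Ak.
move=> /fine_cvgP[ff /cvgrPdist_le/(_ _ e0)] cc.
near \oo => k; exists k.
have fk : box_outer (F k) \is a fin_num by near: k.
rewrite -(fineK fk) lee_fin; apply: le_trans (ler_norm _) _.
by rewrite -normrN -[(- _)%R]sub0r; near: k.
Unshelve. all: by end_near. Qed.

End BoxOuterMeasure.

(** * Volumes of boxes and of preimages *)

Section BoxVolume.
Variables (R : realType) (n : nat).
Local Notation V := ('rV[R]_n).
Local Open Scope ereal_scope.

(** Integrate the inequality [1 <= sum of the indicators of the covering boxes] one
    coordinate at a time over the covered box: the [j]-th inequality below has its first [j]
    coordinates integrated. *)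
Lemma box_volume_cover (c d : V) (a b : nat -> V) :
  (forall i, (c 0%R i <= d 0%R i)%R) -> (forall k i, (a k 0%R i <= b k 0%R i)%R) ->
  box c d `<=` \bigcup_k box (a k) (b k) ->
  (box_volume c d)%:E <= \sum_(k <oo) (box_volume (a k) (b k))%:E.
Proof.
move=> cd ab cov.
pose w (j k : nat) (x : 'I_n -> R) := (\prod_(i < n) if (i < j)%N then b k 0 i - a k 0 i
   else \1_(`[a k 0 i, b k 0 i]%classic) (x i))%R.
pose u (j : nat) := (\prod_(i < n) if (i < j)%N then d 0 i - c 0 i else 1)%R.
have w0 j k x : (0 <= w j k x)%R.
  by apply: prodr_ge0 => i _; case: ifP => _; rewrite ?subr_ge0 // indicE ler0n.
have claim j : (j <= n)%N -> forall x, (forall i, c 0%R i <= x i <= d 0%R i)%R ->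
    (u j)%:E <= \sum_(k <oo) (w j k x)%:E.
  elim: j => [_ x xcd|j IH jn x xcd].
    have [k _ kx] : (\bigcup_k box (a k) (b k)) (\row_i x i)%R.
      by apply: cov => i; rewrite mxE.
    apply: le_trans (nneseries_lim_ge k.+1 _); last by move=> *; rewrite lee_fin.
    rewrite big_nat_recr //= -[leLHS]add0e; apply: leeD.
      by apply: sume_ge0 => *; rewrite lee_fin.
    rewrite lee_fin /u /w big1 // big1 // => i _; rewrite indicE mem_set //=.
    by have := kx i; rewrite mxE in_itv.
  pose i0 := Ordinal jn; pose xt (t : R) i := if i == i0 then t else x i.
  pose r (k : nat) := (\prod_(i < n | i != i0) if (i < j)%N then b k 0 i - a k 0 i
    else \1_(`[a k 0 i, b k 0 i]%classic) (x i))%R.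
  have r0 k : (0 <= r k)%R.
    by apply: prodr_ge0 => i _; case: ifP => _; rewrite ?subr_ge0 // indicE ler0n.
  have lt_neq (i : 'I_n) : i != i0 -> (i < j.+1)%N = (i < j)%N.
    by move=> ne; rewrite ltnS leq_eqVlt -[(i == j :> nat)]/(i == i0) (negbTE ne).
  have wE k t : w j k (xt t) = (r k * \1_(`[a k 0 i0, b k 0 i0]%classic) t)%R.
    rewrite /w (bigD1 i0) //= ltnn /xt eqxx mulrC; congr (_ * _)%R.
    by apply: eq_bigr => i /negbTE ->.
  have wSE k : w j.+1 k x = (r k * (b k 0 i0 - a k 0 i0))%R.
    rewrite /w (bigD1 i0) //= ltnSn mulrC; congr (_ * _)%R.
    by apply: eq_bigr => i ne; rewrite lt_neq.
  have uE : u j.+1 = (u j * (d 0 i0 - c 0 i0))%R.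
    rewrite /u (bigD1 i0) //= [in RHS](bigD1 i0) //= ltnSn ltnn mul1r mulrC.
    by congr (_ * _)%R; apply: eq_bigr => i ne; rewrite lt_neq.
  pose D := `[c 0%R i0, d 0%R i0]%classic : set R.
  have mD : measurable D by exact: measurable_itv.
  have mI k : measurable_fun D (EFin \o (fun t : R => w j k (xt t))).
    apply/measurable_EFinP; rewrite (_ : (fun t => _) =
        (fun t => r k * \1_(`[a k 0 i0, b k 0 i0]%classic) t)%R); last by apply/funext => t.
    by apply: measurable_funM; [exact: measurable_cst|exact: measurable_indic].
  have itvE (p q : R) : (p <= q)%R -> lebesgue_measure (`[p, q]%classic : set R) = (q - p)%:E.
    move=> pq; rewrite lebesgue_measure_itv /= lte_fin; case: ltP => // qp.
    by have -> : p = q by [apply/eqP; rewrite eq_le pq qp]; rewrite subrr.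
  have lower : (u j.+1)%:E <= \int[lebesgue_measure]_(t in D) \sum_(k <oo) (w j k (xt t))%:E.
    rewrite uE EFinM -(itvE _ _ (cd i0)) -integral_cst //.
    apply: ge0_le_integral => //.
    - by move=> t _; rewrite lee_fin; apply: prodr_ge0 => i _; case: ifP; rewrite ?subr_ge0.
    - have := @ge0_emeasurable_sum _ _ R D (fun k t => (w j k (xt t))%:E) xpredT.
      by apply=> [k t _ _|k _]; [rewrite lee_fin|exact: mI].
    - move=> t tD; apply: IH; first exact: ltnW.
      by move=> i; rewrite /xt; case: eqP => [->|_] //; move: tD; rewrite /D /= in_itv.
  apply: le_trans lower _; rewrite integral_nneseries //; last by move=> k t _; rewrite lee_fin.
  apply: lee_nneseries => [k _ _|k _].
    by apply: integral_ge0 => t _; rewrite lee_fin.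
  under eq_integral => t _ do rewrite wE EFinM.
  rewrite ge0_integralZl_EFin //; last exact/measurable_EFinP/measurable_indic.
  rewrite integral_indic // wSE EFinM -(itvE _ _ (ab k i0)).
  by apply: lee_wpmul2l; rewrite ?lee_fin //; apply: le_measure; rewrite ?inE //; exact: measurableI.
have := claim n (leqnn n) (fun i => c 0 i)%R; rewrite (_ : u n = box_volume c d); last first.
  by apply: eq_bigr => i _; rewrite ltn_ord.
have wn k x : w n k x = box_volume (a k) (b k) by apply: eq_bigr => i _; rewrite ltn_ord.
move=> h; apply: le_trans (h _) _ => [i|]; first by rewrite lexx cd.
by apply: lee_nneseries => [k _ _|k _]; rewrite ?lee_fin // wn.
Qed.

(** Replace the sets of a cover by boxes of almost the same volume. In positive dimension there
    are boxes of volume zero, which take care of the empty sets. *)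
Lemma box_outer_box_ge (c d : V) : (0 < n)%N -> (forall i, (c 0%R i <= d 0%R i)%R) ->
  (box_volume c d)%:E <= box_outer (box c d).
Proof.
move=> n0 cd; apply: box_outer_glb => F cov.
have [[k koo]|noo] := pselect (exists k, hull_volume (F k) = +oo).
  rewrite (eseries_pinfty _ _ koo) ?leey // => k' _.
  by rewrite -ltNye (lt_le_trans _ (hull_volume_ge0 _)).
apply/lee_addgt0Pr => e e0.
have P k : exists p : V * V, boxes_around (F k) p /\
    (box_volume p.1 p.2)%:E <= hull_volume (F k) + (e / (2 ^ k.+1)%:R)%:E.
  have ek : (0 < e / (2 ^ k.+1)%:R)%R by rewrite divr_gt0 // ltr0n expn_gt0.
  have [F0|F0] := pselect (F k = set0).
    exists (0%R, 0%R); split; first by split => //; rewrite F0.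
    rewrite F0 hull_volume0 add0e lee_fin /box_volume /=.
    by rewrite (bigD1 (Ordinal n0)) //= !mxE subrr mul0r ltW.
  have hE : hull_volume (F k) = ereal_inf [set (box_volume p.1 p.2)%:E | p in boxes_around (F k)].
    by rewrite /hull_volume asboolF.
  have fin : hull_volume (F k) \is a fin_num.
    rewrite ge0_fin_numE ?hull_volume_ge0 // ltey; apply/eqP => koo.
    by case: noo; exists k.
  have := fin; rewrite {1}hE => /(lb_ereal_inf_adherent ek)[_ [p pF <-] lt].
  by exists p; split=> //; rewrite hE ltW.
have [p pP] := choice P.
apply: le_trans (box_volume_cover (a := fun k => (p k).1) (b := fun k => (p k).2) cd _ _) _.
- by move=> k; have [[]] := pP k.
- by move=> x /cov[k _ Fk]; exists k => //; have [[_ FB] _] := pP k; exact: FB.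
apply: le_trans (epsilon_trick _ _ (ltW e0)); last by move=> k; exact: hull_volume_ge0.
apply: lee_nneseries => [k _ _|k _]; last by have [] := pP k.
by rewrite lee_fin box_volume_ge0 //; have [[]] := pP k.
Qed.

Lemma box_outer_subadditive (I : eqType) (s : seq I) (A : I -> set V) (X : set V) :
  (forall x, X x -> exists2 i, i \in s & A i x) ->
  box_outer X <= \sum_(i <- s) box_outer (A i).
Proof.
elim: s X => [|i s IH] X cov.
  rewrite big_nil (_ : X = set0) ?outer_measure0 // -subset0 => x Xx.
  by have [?] := cov x Xx.
rewrite big_cons; apply: le_trans (_ : box_outer (A i) + box_outer (X `\` A i) <= _).
  apply: le_trans (outer_measureU2 _ _ _); apply: le_outer_measure => x Xx.
  by have [Ax|nA] := pselect (A i x); [left|right].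
apply: leeD => //; apply: IH => x [/cov[j + Ajx] nA].
by rewrite inE => /orP[/eqP ji|js]; [rewrite ji in Ajx|exists j].
Qed.

(** Subdivide the box into cubes of side [l], the number of which is at most
    [\prod_i ((b_i - a_i) / l + 1)]. The preimage of each of them has diameter at most [C l], hence
    lies in a cube of side [2 C l]. Let [l] tend to zero. *)
Lemma lipschitz_preimage_box (Q : set V) (Phi : V -> V) (C : R) (a b : V) : (0 < C)%R ->
  (forall v v', Q v -> Q v' -> (`|v - v'| <= C * `|Phi v - Phi v'|)%R) ->
  (forall i, (a 0%R i <= b 0%R i)%R) ->
  box_outer (Q `&` Phi @^-1` box a b) <= ((2 * C) ^+ n * box_volume a b)%:E.
Proof.
move=> C0 PhiC ab.
have grid (l : R) : (0 < l)%R -> box_outer (Q `&` Phi @^-1` box a b) <=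
    ((2 * C) ^+ n * \prod_i (b 0%R i - a 0%R i + l))%:E.
  move=> l0; pose m i := (Num.truncn ((b 0 i - a 0 i) / l)%R).+1; pose M := \max_i m i.
  have mM i : (m i <= M)%N by exact: leq_bigmax.
  pose F (i : 'I_n) := [pred k : 'I_M.+1 | (k < m i)%N].
  pose cell (f : {ffun 'I_n -> 'I_M.+1}) : set V :=
    box (\row_i (a 0 i + (f i)%:R * l))%R (\row_i (a 0 i + (f i).+1%:R * l))%R.
  have cell_small f : box_outer (Q `&` Phi @^-1` cell f) <= ((2 * (C * l)) ^+ n)%:E.
    have [[v0 [Qv0 cv0]]|none] := pselect (exists v, Q v /\ cell f (Phi v)); last first.
      rewrite (_ : _ `&` _ = set0) ?outer_measure0 ?lee_fin ?exprn_ge0 ?mulr_ge0 ?ltW //.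
      by rewrite -subset0 => v [Qv cv]; apply: none; exists v.
    have Cl0 : (0 <= C * l)%R by rewrite mulr_ge0 ?ltW.
    pose lo : V := (\row_i (v0 0 i - C * l))%R; pose hi : V := (\row_i (v0 0 i + C * l))%R.
    have lohi i : (lo 0%R i <= hi 0%R i)%R by rewrite !mxE; lra.
    apply: le_trans (_ : box_outer (box lo hi) <= _).
      apply: le_outer_measure => v [Qv cv] i.
      have h : (`|v - v0| <= C * l)%R.
        apply: le_trans (PhiC _ _ Qv Qv0) _; rewrite ler_pM2l //.
        apply: row_norm_le => [|i']; first exact: ltW.
        have := cv i'; have := cv0 i'; rewrite !mxE -[(f i').+1]addn1 natrD => /andP[h1 h2] /andP[h3 h4].
        by rewrite ler_norml; apply/andP; split; lra.
      have := le_trans (coord_norm_le _ i) h; rewrite !mxE ler_norml => /andP[h1 h2].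
      by apply/andP; split; lra.
    apply: le_trans (box_outer_box lohi) _; rewrite lee_fin /box_volume.
    rewrite (eq_bigr (fun=> 2 * (C * l))%R) => [|i _]; last by rewrite !mxE; ring.
    by rewrite prodr_const card_ord.
  apply: le_trans (box_outer_subadditive (s := enum (family F))
      (A := fun f => Q `&` Phi @^-1` cell f) _) _.
    move=> v [Qv Pv].
    have tm i : (Num.truncn ((Phi v 0 i - a 0 i) / l)%R < m i)%N.
      rewrite ltnS; apply: le_truncn; rewrite ler_pM2r ?invr_gt0 // lerD2r.
      by have /andP[] := Pv i.
    pose f : {ffun 'I_n -> 'I_M.+1} := [ffun i => inord (Num.truncn ((Phi v 0 i - a 0 i) / l)%R)].
    have fE i : f i = Num.truncn ((Phi v 0 i - a 0 i) / l)%R :> nat.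
      by rewrite ffunE inordK // ltnS; exact: leq_trans (ltnW (tm i)) (mM i).
    exists f; first by rewrite mem_enum; apply/familyP => i; rewrite inE fE.
    split=> // i; rewrite !mxE fE; have /andP[h1 h2] := Pv i.
    have /truncn_itv : (0 <= (Phi v 0 i - a 0 i) / l)%R by rewrite divr_ge0 ?subr_ge0 // ltW.
    set t := Num.truncn _; rewrite ler_pdivlMr // ltr_pdivrMr // => /andP[h3 h4].
    by apply/andP; split; lra.
  apply: le_trans (_ : \sum_(f <- enum (family F)) ((2 * (C * l)) ^+ n)%:E <= _).
    by apply: lee_sum => f _; exact: cell_small.
  rewrite sumEFin lee_fin big_enum /=.
  have -> : (\sum_(f in family F) (2 * (C * l)) ^+ n = \prod_i \sum_(k | F i k) (2 * (C * l)))%R.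
    rewrite bigA_distr_big_dep; apply: eq_bigr => f _.
    by rewrite prodr_const card_ord.
  apply: le_trans (_ : \prod_i (2 * C * (b 0 i - a 0 i + l)) <= _)%R; last first.
    by rewrite big_split /= prodr_const card_ord.
  apply: ler_prod => i _; apply/andP; split.
    by apply: sumr_ge0 => k _; rewrite !mulr_ge0 ?ltW.
  rewrite -(big_ord_widen M.+1 (fun=> 2 * (C * l))%R) ?(leq_trans (mM i)) // sumr_const card_ord.
  have /truncn_itv/andP[h1 _] : (0 <= (b 0 i - a 0 i) / l)%R by rewrite divr_ge0 ?subr_ge0 // ltW.
  rewrite -[leLHS]mulr_natr /m; move: h1; set t := Num.truncn _; rewrite ler_pdivlMr // => h1.
  rewrite (_ : 2 * (C * l) * t.+1%:R = 2 * C * (t%:R * l + l))%R; last first.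
    by have -> : t.+1%:R = (t%:R + 1)%R :> R; [rewrite natr1|ring].
  by rewrite ler_pM2l ?mulr_gt0 // lerD2r.
apply/lee_addgt0Pr => e e0.
pose p : {poly R} := (((2 * C) ^+ n)%:P * \prod_i ((b 0 i - a 0 i)%:P + 'X))%R.
have pE l : p.[l]%R = ((2 * C) ^+ n * \prod_i (b 0%R i - a 0%R i + l))%R.
  rewrite hornerM hornerC horner_prod; congr (_ * _)%R.
  by apply: eq_bigr => i _; rewrite hornerD hornerC hornerX.
have p0 : p.[0]%R = ((2 * C) ^+ n * box_volume a b)%R.
  by rewrite pE; congr (_ * _)%R; apply: eq_bigr => i _; rewrite addr0.
have : p.[t]%R @[t --> (0 : R)%R] --> p.[0]%R by exact: continuous_horner.
move=> /cvgrPdist_le /(_ _ e0) [l /= l0 lP].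
apply: le_trans (grid (l / 2)%R _) _; first by rewrite divr_gt0.
rewrite -pE -EFinD lee_fin -p0 -lerBlDl.
apply: le_trans (ler_norm _) _; rewrite distrC; apply: lP => /=.
by rewrite sub0r normrN gtr0_norm ?divr_gt0 // ltr_pdivrMr // ltr_pMr // ltr1n.
Qed.

Lemma lipschitz_preimage (Q E : set V) (Phi : V -> V) (C : R) : (0 < C)%R ->
  (forall v v', Q v -> Q v' -> (`|v - v'| <= C * `|Phi v - Phi v'|)%R) ->
  box_outer (Q `&` Phi @^-1` E) <= ((2 * C) ^+ n)%:E * box_outer E.
Proof.
move=> C0 PhiC; pose K : R := ((2 * C) ^+ n)%R.
have K0 : (0 < K)%R by rewrite exprn_gt0 // mulr_gt0.
have pull (x y : \bar R) : x <= K%:E * y <-> (K^-1)%:E * x <= y.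
  by rewrite lee_pdivrMl.
rewrite -/K; apply/pull; apply: box_outer_glb => F EF; apply/pull.
rewrite -nneseriesZl; last by move=> *; exact: hull_volume_ge0.
apply: le_trans (_ : \sum_(k <oo) box_outer (Q `&` Phi @^-1` F k) <= _).
  apply: le_trans (outer_measure_sigma_subadditive _ _); apply: le_outer_measure => v [Qv /EF[k _ Fk]].
  by exists k.
apply: lee_nneseries => [k _ _|k _]; first exact: outer_measure_ge0.
rewrite /hull_volume; case: ifP => [/asboolP ->|_].
  by rewrite preimage_set0 setI0 outer_measure0 mule0.
apply/pull; apply: le_ereal_inf_tmp => _ [[a b] /= [ab Fab] <-]; apply/pull.
apply: le_trans (lipschitz_preimage_box C0 PhiC ab); apply: le_outer_measure => v [Qv Fv].
by split=> //; exact: Fab.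
Qed.

End BoxVolume.

(** * Continuity of h-convex functions *)

Section HConvexRegularity.
Variables (R : realType) (n : nat) (G : stratifiedGroup R n).
Variables (Omega : set 'rV[R]_n) (U : 'rV[R]_n -> R).
Hypotheses (Omega_open : open Omega) (U_hconvex : hconvex G Omega U).
Implicit Types (x y z k : 'rV[R]_n) (hs : seq 'rV[R]_n) (bs : seq bool).

Local Notation "x '**' y" := (gmul G x y) (at level 40, left associativity).

Lemma convex_on_line z k (t1 t2 s : R) : H1 G k -> t1 <= t2 ->
  (forall t, t1 <= t <= t2 -> Omega (z ** (t *: k))) -> 0 <= s <= 1 ->
  U (z ** (((1 - s) * t1 + s * t2) *: k)) <= s * U (z ** (t2 *: k)) + (1 - s) * U (z ** (t1 *: k)).
Proof.
move=> hk t12 O s01; pose h := (t2 - t1) *: k.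
have hh : H1 G h by exact: H1Z.
have E (a : R) : z ** (t1 *: k) ** (a *: h) = z ** ((t1 + a * (t2 - t1)) *: k).
  by rewrite -gmulA /h scalerA gmul_collinear.
have E1 : z ** (t1 *: k) ** h = z ** (t2 *: k).
  by rewrite -[h]scale1r E mul1r addrC subrK.
have hE : - (z ** (t1 *: k)) ** (z ** (t2 *: k)) = h by rewrite -E1 gmulNK.
have := @U_hconvex (z ** (t1 *: k)) (z ** (t2 *: k)).
cbv zeta; rewrite hE => h1; have /h1 : Omega (z ** (t1 *: k)) by apply: O; rewrite lexx.
move=> /(_ _ hh _ s s01); rewrite dil_H1 // E => h2; rewrite (_ : (1 - s) * t1 + s * t2 = t1 + s * (t2 - t1)); last by ring.
apply: h2; first by apply: O; rewrite lexx andbT.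
move=> _ [_ [a /= + <-] <-]; rewrite in_itv /= => /andP[a0 a1]; rewrite E; apply: O.
apply/andP; split; first by rewrite lerDl mulr_ge0 ?subr_ge0.
by rewrite -lerBrDl ler_piMl ?subr_ge0.
Qed.

(** The notion of neighbourhood adapted to h-convexity: at most [N] horizontal steps of size at
    most [e]. *)
Definition reachable (N : nat) (e : R) z y := exists hs, [/\ (size hs <= N)%N, horizontal G hs,
  forall X, X \in hs -> `|X| <= e & y = z ** gprod G hs].

Lemma reachable_step N e z k y : H1 G k -> `|k| <= e ->
  reachable N e (z ** k) y -> reachable N.+1 e z y.
Proof.
move=> hk ke [hs [sz hh he ->]]; exists (k :: hs); split => //.
- exact: horizontal_cons.
- by move=> X; rewrite inE => /orP[/eqP->|/he].
- by rewrite /= gmulA.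
Qed.

Lemma reachable_line N e z k (t : R) : H1 G k -> `|k| <= e -> `|t| <= 1 ->
  reachable N.+1 e z (z ** (t *: k)).
Proof.
move=> hk ke t1; exists [:: t *: k]; split => //; last by rewrite /= gmulx0.
  by move=> X; rewrite inE => /eqP->; exact: H1Z.
move=> X; rewrite inE => /eqP->; rewrite normrZ; apply: le_trans ke.
by rewrite ler_piMl.
Qed.

Lemma reachable_near N x0 (r : R) : 0 < r -> exists2 e, 0 < e &
  forall z y, `|z - x0| <= e -> reachable N e z y -> `|y - x0| <= r.
Proof.
elim: N r => [|N IH] r r0.
  by exists r => // z y zr [[|k hs] [// _ _ _ ->]]; rewrite /= gmulx0.
have [e e0 eP] := IH r r0.
have [C C0 CP] := gmul_lipschitz G (`|x0| + 1).
pose d := Num.min 1 (Num.min e (e / (C + 1))).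
have d0 : 0 < d by rewrite !lt_min ltr01 e0 divr_gt0 // ltr_wpDl.
have [d1 [de dC]] : d <= 1 /\ (d <= e /\ d <= e / (C + 1)) by rewrite /d !ge_min !lexx !orbT.
exists d => // z y zd [hs [sz hh he ->]].
have zb : `|z| <= `|x0| + 1.
  by rewrite -[z](subrK x0) addrC; apply: le_trans (ler_normD _ _) _; rewrite lerD2l (le_trans zd).
case: hs sz hh he => [_ _ _|k hs /= sz hh he].
  rewrite /= gmulx0; have := eP z z (le_trans zd de); apply.
  by exists [::]; split; rewrite //= gmulx0.
have hk : H1 G k by apply: hh; rewrite mem_head.
have kd : `|k| <= d by apply: he; rewrite mem_head.
apply: (eP (z ** k)); last first.
  exists hs; split; rewrite ?gmulA //; first by move=> X Xh; apply: hh; rewrite inE Xh orbT.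
  by move=> X Xh; apply: le_trans de; apply: he; rewrite inE Xh orbT.
have kb : `|k| <= `|x0| + 1 by apply: le_trans kd (le_trans d1 _); rewrite lerDr.
have x0b : `|x0| <= `|x0| + 1 by rewrite lerDl.
have b0 : `|0 : 'rV[R]_n| <= `|x0| + 1 by rewrite normr0 addr_ge0.
have := CP d z k x0 0 zb kb x0b b0 zd; rewrite subr0 gmulx0 => /(_ kd) h.
apply: le_trans h (le_trans (ler_wpM2l C0 dC) _).
by rewrite mulrCA ler_piMr ?(ltW e0) // ler_pdivrMr ?ltr_wpDl // mul1r lerDl.
Qed.

(** The midpoint inequality bounds the value at [z] by one of the values at [z ** k] and
    [z ** - k]; repeat this for the next letter. *)
Lemma le_flips e (M : R) ks z : horizontal G ks -> (forall X, X \in ks -> `|X| <= e) ->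
  (forall y, reachable (size ks) e z y -> Omega y) ->
  (forall bs, size bs = size ks -> U (z ** gprod G (flip bs ks)) <= M) -> U z <= M.
Proof.
elim: ks z => [|k ks IH] z hk he O Ub.
  by have := Ub [::] erefl; rewrite /= gmulx0.
have Hk : H1 G k by apply: hk; rewrite mem_head.
have ke : `|k| <= e by apply: he; rewrite mem_head.
have hks : horizontal G ks by move=> X Xk; apply: hk; rewrite inE Xk orbT.
have heks X : X \in ks -> `|X| <= e by move=> Xk; apply: he; rewrite inE Xk orbT.
have Up : U (z ** k) <= M.
  apply: IH => // [y yz|bs sz]; first by apply: O; exact: reachable_step yz.
  by have := Ub (false :: bs); rewrite /flip /= -/(flip _ _) sz gmulA; apply.
have Um : U (z ** - k) <= M.
  apply: IH => // [y yz|bs sz].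
    by apply: O; apply: reachable_step yz; [exact: H1N|rewrite normrN].
  by have := Ub (true :: bs); rewrite /flip /= -/(flip _ _) sz gmulA; apply.
have := @convex_on_line z k (-1) 1 2^-1 Hk.
have -> : (1 - 2^-1) * -1 + 2^-1 * 1 = 0 :> R by field.
rewrite scale0r gmulx0 scale1r scaleN1r => h.
have h1 : -1 <= 1 :> R by lra.
have h2 t : -1 <= t <= 1 -> Omega (z ** (t *: k)).
  by move=> t1; apply: O; apply: reachable_line => //; rewrite ler_norml.
have h3 : 0 <= (2^-1 : R) <= 1 by apply/andP; split; lra.
by have := h h1 h2 h3; lra.
Qed.

Section LocalBound.
Hypothesis U_measurable : lebesgue_measurable_fun Omega U.

(** Up to a left and a right translation, which are Lipschitz on bounded sets uniformly in [z],
    the map [Phi] is the frame chart of the modified word. *)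
Lemma flip_chart_lipschitz s p bs (r : R) :
  (forall j, (p j < size s)%N) -> size bs = size s ->
  \det (frame_mx G (flip bs s) p) != 0 -> exists C, exists2 e, 0 < e & 0 < C /\
  forall z v v', `|z| <= r -> `|v| <= e -> `|v'| <= e ->
    let Phi u := z ** wprod G [seq 1 + a | a <- spread p (size s) u] (flip bs s) in
    `|Phi v| <= r -> `|Phi v'| <= r -> `|v - v'| <= C * `|Phi v - Phi v'|.
Proof.
move=> ps sz det0; pose s' := flip bs s; have szs : size s' = size s by exact: size_flip.
have ps' j : (p j < size s')%N by rewrite szs.
have [c0 cf] := frame_chart_flat0 G ps'.
have Bu : frame_mx G s' p \in unitmx by rewrite unitmxE unitfE.
have [C [e e0 [C0 CP]]] := inverse_lipschitz Bu cf.
pose g := gprod G s'.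
have [C1 C10 CP1] := gmul_lipschitz G r.
pose r2 := Num.max `|g| (C1 * r).
have [C2 C20 CP2] := gmul_lipschitz G r2.
exists (C * (C2 * C1) + 1), e => //; split; first by rewrite ltr_wpDl // !mulr_ge0.
move=> z v v' zr ve ve' Phi Pr Pr'.
have PhiE u : Phi u = z ** (frame_chart G s' p u ** g) by rewrite /Phi -szs wprod_frame_chart.
have LE u : frame_chart G s' p u = (- z ** Phi u) ** - g by rewrite PhiE gmulNK gmulK.
have r0 : 0 <= r := le_trans (normr_ge0 _) zr.
have b u : `|Phi u| <= r -> `|- z ** Phi u| <= r2.
  move=> Pu; have := CP1 r (- z) (Phi u) 0 0; rewrite !normrN !subr0 !normr0 normrN gmulx0 subr0.
  by move=> /(_ zr Pu r0 r0 zr Pu) h; rewrite /r2 le_max h orbT.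
have gb : `|- g| <= r2 by rewrite normrN /r2 le_max lexx.
apply: le_trans (CP _ _ ve ve') _; rewrite mulrDl mul1r ler_wpDr // -mulrA; apply: ler_wpM2l => //.
rewrite !LE -mulrA; apply: (CP2 _ _ _ _ _ (b _ Pr) gb (b _ Pr') gb).
  by apply: CP1 => //; rewrite ?normrN // subrr normr0.
by rewrite subrr normr0 !mulr_ge0.
Qed.

(** The parameters [v] of the words starting at [z] form a cube. If [U z] is large, each of
    them leads, for some choice of the signs, to a point where [U] is large; but the set of
    these points has small measure, and the words, being strictly differentiable with
    invertible derivative, pull back small sets to small sets, uniformly in [z]. *)
Lemma hconvex_locally_bounded_above x0 : Omega x0 ->
  exists M, exists2 r : R, 0 < r & forall z, `|z - x0| <= r -> Omega z /\ U z <= M.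
Proof.
move=> Ox0; have [n0|n0] := posnP n.
  exists (U x0), 1 => // z _; suff -> : z = x0 by [].
  by apply/rowP => i; have := ltn_ord i; rewrite {2}n0.
have [R0 R00 R0P] : exists2 r : R, 0 < r & forall z, `|z - x0| <= r -> Omega z.
  have /nbhs_ballP[e /= e0 eP] := open_nbhs_nbhs (conj Omega_open Ox0).
  exists (e / 2) => [|z zr]; first by rewrite divr_gt0.
  apply: eP; rewrite -ball_normE /= distrC; apply: le_lt_trans zr _.
  by rewrite ltr_pdivrMr // ltr_pMr // ltr1n.
have [s0 [p [hs0 ps0 det0]]] := flip_frame_basis_exists G.
have [e e0 eP] := reachable_near (size s0) x0 R00.
(* A rescaled word, so short that the paths considered below remain within distance R0 of x0. *)
pose rho := e / (2 * \sum_(X <- s0) `|X| + 1).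
have S0 : 0 <= \sum_(X <- s0) `|X| by apply: sumr_ge0.
have rho0 : 0 < rho by rewrite divr_gt0 // ltr_wpDl // mulr_ge0.
pose s := [seq rho *: X | X <- s0].
have ss : size s = size s0 by rewrite size_map.
have hs : horizontal G s by apply: horizontal_map hs0 => X; exact: H1Z.
have se X : X \in s -> 2 * `|X| <= e.
  move=> /mapP[Y Ys ->]; rewrite normrZ gtr0_norm // /rho mulrCA mulrC mulrA.
  rewrite ler_pdivrMr ?ltr_wpDl ?mulr_ge0 // mulrC ler_pM2l // ler_wpDr // ler_pM2l //.
  by rewrite (big_rem Y) //= lerDl sumr_ge0.
have det bs : size bs = size s -> \det (frame_mx G (flip bs s) p) != 0.
  rewrite ss => sz; rewrite /s flip_scale frame_mx_dil_det ?det0 ?gt_eqF //.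
  exact: horizontal_flip.
have ps j : (p j < size s)%N by rewrite ss.
pose r := `|x0| + e + R0.
have [C [d d0 [C0 CP]]] : exists C, exists2 d, 0 < d & 0 < C /\
    forall bs, size bs = size s -> forall z v v', `|z| <= r -> `|v| <= d -> `|v'| <= d ->
    let Phi u := z ** wprod G [seq 1 + a | a <- spread p (size s) u] (flip bs s) in
    `|Phi v| <= r -> `|Phi v'| <= r -> `|v - v'| <= C * `|Phi v - Phi v'|.
  suff gen (l : seq ((size s).-tuple bool)) : exists C, exists2 d, 0 < d & 0 < C /\
      forall t : (size s).-tuple bool, t \in l -> forall z v v', `|z| <= r -> `|v| <= d -> `|v'| <= d ->
      let Phi u := z ** wprod G [seq 1 + a | a <- spread p (size s) u] (flip t s) in
      `|Phi v| <= r -> `|Phi v'| <= r -> `|v - v'| <= C * `|Phi v - Phi v'|.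
    have [C [d d0 [C0 CP]]] := gen (enum {: (size s).-tuple bool}).
    exists C, d => //; split => // bs /eqP sz; apply: (CP (Tuple sz)).
    by rewrite mem_enum.
  elim: l => [|t l [C [d d0 [C0 CP]]]]; first by exists 1, 1.
  have [C' [d' d0' [C0' CP']]] := flip_chart_lipschitz r ps (size_tuple t) (det _ (size_tuple t)).
  exists (C + C'), (Num.min d d'); first by rewrite lt_min d0 d0'.
  split; first exact: addr_gt0.
  move=> b; rewrite inE => /orP[/eqP ->|bl] z v v' zr; rewrite !le_min => /andP[v1 v2] /andP[v1' v2'] Phi Pv Pv'.
    by apply: le_trans (CP' z v v' zr v2 v2' Pv Pv') _; rewrite ler_wpM2r // lerDr ltW.
  by apply: le_trans (CP b bl z v v' zr v1 v1' Pv Pv') _; rewrite ler_wpM2r // lerDl ltW.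
(* The half side of the cube of parameters; for |v| <= q the letters are rescaled by at most 2. *)
pose q := Num.min d (n%:R^-1).
have q0 : 0 < q by rewrite lt_min d0 invr_gt0 ltr0n.
pose lo : 'rV[R]_n := const_mx (- q); pose hi : 'rV[R]_n := const_mx q.
pose a : 'rV[R]_n := \row_i (x0 0 i - R0); pose b : 'rV[R]_n := \row_i (x0 0 i + R0).
have ab i : a 0 i <= b 0 i by rewrite !mxE; lra.
have lohi i : lo 0 i <= hi 0 i by rewrite !mxE; lra.
have boxP y : box a b y <-> `|y - x0| <= R0.
  split=> [yb|yb i].
    apply: row_norm_le => [|i]; first exact: ltW.
    have := yb i; rewrite !mxE => /andP[h1 h2]; rewrite ler_norml; apply/andP; split; lra.
  have := le_trans (coord_norm_le _ i) yb; rewrite !mxE ler_norml => /andP[h1 h2].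
  by apply/andP; split; lra.
pose N := #|{: (size s).-tuple bool}|.
pose vol := box_volume lo hi.
have vol0 : 0 < vol.
  by apply: prodr_gt0 => i _; rewrite !mxE opprK addr_gt0.
pose K := (2 * C) ^+ n.
have K0 : 0 < K by rewrite exprn_gt0 // mulr_gt0.
(* An exceptional set of measure at most eta has one preimage for each of the N choices of the
   signs; their total measure, at most K N eta, is less than that of the cube of parameters. *)
pose eta := vol / (2 * (N%:R + 1) * K).
have N0 : 0 < N%:R + 1 :> R by rewrite ltr_wpDl.
have eta0 : 0 < eta by rewrite divr_gt0 // !mulr_gt0.
pose A (m : nat) := Omega `&` [set y | U y < m%:R].
have [m mP] : exists m, (box_outer (box a b `\` A m) <= eta%:E)%E.
  apply: measurable_exhaustion => //.
  - by move=> k; exact: U_measurable.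
  - by move=> k l kl y [Oy Uy]; split=> //=; apply: lt_le_trans Uy _; rewrite ler_nat.
  - move=> y /boxP yb; have Oy := R0P _ yb; exists (Num.bound (U y)) => //; split=> //=.
    apply: le_lt_trans (ler_norm _) _.
    by rewrite /Num.bound; have := archi_boundP (normr_ge0 (U y)); rewrite /Num.bound normr_id.
have [e' [e'0 [e'e e'R]]] : exists e', 0 < e' /\ (e' <= e /\ e' <= R0).
  by exists (Num.min e R0); rewrite lt_min e0 R00 !ge_min !lexx orbT.
exists m%:R, e' => // z ze; split; first by apply: R0P; exact: le_trans e'R.
rewrite leNgt; apply/negP => Uz.
have zr : `|z| <= r.
  rewrite -[z](subrK x0) addrC; apply: le_trans (ler_normD _ _) _.
  by rewrite /r -addrA lerD2l; apply: le_trans ze _; rewrite ler_wpDr // ltW.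
pose Phi bs v := z ** wprod G [seq 1 + a | a <- spread p (size s) v] (flip bs s).
have small v c X : `|v| <= q -> c \in [seq 1 + a | a <- spread p (size s) v] -> X \in s -> `|c *: X| <= e.
  move=> vq /mapP[c' /spread_bound cb ->] Xs; rewrite normrZ; apply: le_trans (se X Xs).
  apply: ler_wpM2r => //; apply: le_trans (ler_normD _ _) _; rewrite normr1.
  have : `|c'| <= 1; last by lra.
  apply: le_trans cb _; rewrite -ler_pdivlMl ?ltr0n // mulr1.
  by apply: le_trans vq _; rewrite /q ge_min lexx orbT.
have Phib bs v : size bs = size s -> `|v| <= q -> `|Phi bs v - x0| <= R0.
  move=> sz vq; apply: (eP z); first exact: le_trans e'e.
  exists [seq u.1 *: u.2 | u <- zip [seq 1 + a | a <- spread p (size s) v] (flip bs s)]; split => //.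
  - by rewrite size_map size_zip size_map size_spread size_flip // minnn ss.
  - by move=> _ /mapP[u /mem_zip_unzip/andP[_ /(horizontal_flip hs) h] ->]; exact: H1Z.
  - move=> _ /mapP[[c X] /mem_zip_unzip /= /andP[cv /mapP[[b' Y] /mem_zip_unzip /= /andP[_ Ys] ->]] ->].
    by case: b'; rewrite ?scalerN ?normrN; exact: (small v _ _ vq cv Ys).
(* If no choice of the signs led to an exceptional point, le_flips would bound U z by m. *)
have bad v : box lo hi v -> exists t : (size s).-tuple bool, (box a b `\` A m) (Phi t v).
  move=> vb; have vq : `|v| <= q.
    apply: row_norm_le => [|i]; first exact: ltW.
    by have := vb i; rewrite !mxE ler_norml.
  apply: contrapT => none; have : U z <= m%:R; last by rewrite leNgt Uz.
  pose ks := [seq u.1 *: u.2 | u <- zip [seq 1 + a | a <- spread p (size s) v] s].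
  have szk : size ks = size s by rewrite size_map size_zip size_map size_spread minnn.
  apply: (@le_flips e _ ks).
  - by move=> _ /mapP[u /mem_zip_unzip/andP[_ /hs h] ->]; exact: H1Z.
  - by move=> _ /mapP[[c X] /mem_zip_unzip /= /andP[cv Xs] ->]; exact: (small v _ _ vq cv Xs).
  - rewrite szk ss => y yz; apply: R0P; apply: eP yz; exact: le_trans e'e.
  move=> bs sz.
  have fE : flip bs ks = [seq u.1 *: u.2 | u <- zip [seq 1 + a | a <- spread p (size s) v] (flip bs s)].
    rewrite /ks /flip; move: [seq 1 + a | a <- spread p (size s) v] => cs0.
    elim: bs cs0 (s) {sz szk ks} => [|b0 bs IHb] [|c cs] [|X s1] //=.
    by rewrite IHb; case: b0; rewrite ?scalerN.
  have {}sz : size bs = size s by rewrite sz.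
  have Pb := Phib bs v sz vq.
  rewrite fE leNgt; apply/negP => big; apply: none.
  move/eqP: (sz) => szb; exists (Tuple szb); split; first exact/boxP.
  by move=> [_ /=]; rewrite ltNge => /negP; apply; exact: ltW.
have : (vol%:E <= (N%:R * (K * eta))%:E)%E.
  apply: le_trans (box_outer_box_ge n0 lohi) _.
  apply: le_trans (box_outer_subadditive (s := enum {: (size s).-tuple bool})
    (A := fun t : (size s).-tuple bool => box lo hi `&` Phi t @^-1` (box a b `\` A m)) _) _.
    by move=> v vb; have [bs bsP] := bad v vb; exists bs; rewrite ?mem_enum.
  have -> : ((N%:R * (K * eta))%:E = \sum_(t <- enum {: (size s).-tuple bool}) (K * eta)%:E)%E.
    by rewrite sumEFin big_enum sumr_const mulr_natl.
  apply: lee_sum => t _; apply: le_trans (lipschitz_preimage (C := C) _ C0 _) _.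
    move=> v v' vb vb'.
    have bq w : box lo hi w -> `|w| <= d /\ `|w| <= q.
      move=> wb; have wq : `|w| <= q.
        apply: row_norm_le => [|i]; first exact: ltW.
        by have := wb i; rewrite !mxE ler_norml.
      by split=> //; apply: le_trans wq _; rewrite /q ge_min lexx.
    have [[vd vq] [vd' vq']] := (bq _ vb, bq _ vb').
    have Pr w : `|w| <= q -> `|Phi t w| <= r.
      move=> wq; rewrite -[Phi t w](subrK x0) addrC; apply: le_trans (ler_normD _ _) _.
      rewrite /r -addrA lerD2l; apply: le_trans (Phib _ _ (size_tuple t) wq) _.
      by rewrite ler_wpDl // ltW.
    exact: (CP t (size_tuple t) z v v' zr vd vd' (Pr _ vq) (Pr _ vq')).
  by rewrite EFinM; apply: lee_wpmul2l => //; rewrite lee_fin ltW.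
rewrite lee_fin /eta; apply/negP; rewrite -ltNge.
have -> : N%:R * (K * (vol / (2 * (N%:R + 1) * K))) = N%:R / (N%:R + 1) * (vol / 2).
  by field; rewrite !gt_eqF.
apply: le_lt_trans (_ : 1 * (vol / 2) < _); last by lra.
apply: ler_wpM2r; first by rewrite divr_ge0 // ltW.
by rewrite ler_pdivrMr // mul1r lerDl.
Qed.

(** Along a horizontal line a convex function with an upper bound varies little; points near
    [x0] are reached by boundedly many short horizontal steps. *)
Lemma hconvex_continuous x0 : Omega x0 -> U y @[y --> x0] --> U x0.
Proof.
move=> Ox0; have [M [r r0 rP]] := hconvex_locally_bounded_above Ox0.
have [N NP] := horizontal_products_near0 G.
have [e e0 eP] := reachable_near N.+1 x0 r0.
(* The upper bound for U (y ** tau k) uses the segment from y to y ** k, the lower bound that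
   from y ** - k to y ** tau k. *)
have step (tau : R) y k : 0 < tau <= 1 -> H1 G k -> `|k| <= e ->
    (forall y', reachable 1 e y y' -> `|y' - x0| <= r) ->
    `|U (y ** (tau *: k)) - U y| <= tau * (M - U y).
  move=> /andP[tau0 tau1] hk ke near_x0.
  have line t : `|t| <= 1 -> Omega (y ** (t *: k)) /\ U (y ** (t *: k)) <= M.
    by move=> t1; apply: rP; apply: near_x0; exact: reachable_line.
  have [_ Up] : Omega (y ** (1 *: k)) /\ U (y ** (1 *: k)) <= M by apply: line; rewrite normr1.
  have [_ Um] : Omega (y ** ((-1) *: k)) /\ U (y ** ((-1) *: k)) <= M.
    by apply: line; rewrite normrN1.
  have h1 : U (y ** (tau *: k)) <= tau * M + (1 - tau) * U y.
    have := @convex_on_line y k 0 1 tau hk ler01; rewrite mulr0 add0r mulr1 scale0r gmulx0 => h.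
    apply: le_trans (h _ _) _.
    - by move=> t /andP[t0 t1]; have [] := line t; rewrite ?ger0_norm.
    - by rewrite ltW.
    - by rewrite lerD2r ler_wpM2l // ltW.
  have t10 : 0 < 1 + tau by rewrite ltr_wpDl.
  pose s := (1 + tau)^-1.
  have h2 : U y <= s * U (y ** (tau *: k)) + (1 - s) * M.
    have := @convex_on_line y k (-1) tau s hk.
    have -> : (1 - s) * -1 + s * tau = 0 by rewrite /s; field; rewrite gt_eqF.
    have s1 : 0 <= 1 - s by rewrite subr_ge0 /s invf_le1 // lerDl ltW.
    rewrite scale0r gmulx0 => h; apply: le_trans (h _ _ _) _.
    - by lra.
    - by move=> t /andP[t0 t1]; have [] := line t; rewrite ?ler_norml ?t0 ?(le_trans t1).
    - by apply/andP; split; [rewrite invr_ge0 ltW|rewrite -subr_ge0].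
    - by rewrite lerD2l ler_wpM2l.
  have h3 : (1 + tau) * U y <= U (y ** (tau *: k)) + tau * M.
    have := ler_wpM2l (ltW t10) h2.
    rewrite mulrDr [X in _ <= X + _]mulrA mulfV ?gt_eqF // mul1r [X in _ <= _ + X]mulrA.
    by have -> : (1 + tau) * (1 - s) = tau by rewrite /s; field; rewrite gt_eqF.
  by rewrite ler_norml; apply/andP; split; lra.
(* Each step multiplies the distance of U to the bound M by at most 1 + tau. *)
have chain (tau : R) : 0 < tau <= 1 -> forall j hs y, (size hs <= j)%N -> horizontal G hs ->
    (forall X, X \in hs -> `|X| <= tau * e) ->
    (forall y', reachable j.+1 e y y' -> `|y' - x0| <= r) ->
    `|U (y ** gprod G hs) - U y| <= ((1 + tau) ^+ j - 1) * (M - U y).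
  move=> tau01; have /andP[tau0 tau1] := tau01; elim=> [|j IH] hs y sz hh he near_x0.
    by case: hs sz {hh he} => // _; rewrite /= gmulx0 subrr normr0 subrr mul0r.
  have MU0 : 0 <= M - U y.
    have /near_x0 : reachable j.+2 e y y by exists [::]; split; rewrite //= gmulx0.
    by move=> /rP[_]; rewrite subr_ge0.
  have pow0 i : 0 <= (1 + tau) ^+ i - 1.
    by rewrite subr_ge0 exprn_ege1 // lerDl ltW.
  case: hs sz hh he => [_ _ _|h hs sz hh he].
    by rewrite /= gmulx0 subrr normr0 mulr_ge0.
  have hH : H1 G h by apply: hh; rewrite mem_head.
  have ht : `|tau^-1 *: h| <= e.
    rewrite normrZ normfV gtr0_norm // ler_pdivrMl //; apply: he; exact: mem_head.
  have hE : tau *: (tau^-1 *: h) = h by rewrite scalerA mulfV ?gt_eqF // scale1r.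
  have he' : `|h| <= e.
    by apply: le_trans (he h (mem_head _ _)) _; rewrite ler_piMl // ltW.
  have s1 : `|U (y ** h) - U y| <= tau * (M - U y).
    rewrite -hE; apply: step => //; first exact: H1Z.
    move=> y' [ks [sk hk ek ->]]; apply: near_x0; exists ks; split => //.
    exact: leq_trans sk _.
  have s2 : `|U (y ** h ** gprod G hs) - U (y ** h)| <= ((1 + tau) ^+ j - 1) * (M - U (y ** h)).
    apply: IH => // [X Xh|X Xh|y' yy'].
    - by apply: hh; rewrite inE Xh orbT.
    - by apply: he; rewrite inE Xh orbT.
    - by apply: near_x0; exact: reachable_step yy'.
  have s3 : M - U (y ** h) <= (1 + tau) * (M - U y).
    by move: s1; rewrite ler_norml => /andP[h1 h2]; lra.
  rewrite /= gmulA -[X in X - _](subrK (U (y ** h))) -addrA; apply: le_trans (ler_normD _ _) _.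
  apply: le_trans (lerD (le_trans s2 (ler_wpM2l (pow0 j) s3)) s1) _.
  by rewrite exprS le_eqVlt; apply/orP; left; apply/eqP; ring.
apply/(cvgrPdist_le (FF := nbhs_filter x0)) => eta eta0.
have [tau [tau01 tauP]] : exists tau : R, 0 < tau <= 1 /\ ((1 + tau) ^+ N - 1) * (M - U x0) <= eta.
  pose p : {poly R} := ((1 + 'X) ^+ N - 1) * (M - U x0)%:P.
  have pE t : p.[t] = ((1 + t) ^+ N - 1) * (M - U x0).
    by rewrite hornerM hornerC hornerD hornerN horner_exp hornerD hornerX hornerC.
  have : p.[t] @[t --> (0 : R)] --> p.[0] by exact: continuous_horner.
  move=> /cvgrPdist_le/(_ _ eta0)[d /= d0 dP].
  exists (Num.min 1 (d / 2)); split; first by rewrite lt_min ltr01 divr_gt0 //= ge_min lexx.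
  have m0 : 0 < Num.min 1 (d / 2) by rewrite lt_min ltr01 divr_gt0.
  rewrite -pE; have := dP (Num.min 1 (d / 2)); rewrite /= sub0r normrN gtr0_norm // => h.
  have : Num.min 1 (d / 2) < d.
    by rewrite gt_min; apply/orP; right; rewrite ltr_pdivrMr // ltr_pMr // ltr1n.
  move=> /h; rewrite pE addr0 expr1n subrr mul0r sub0r normrN; exact: le_trans (ler_norm _).
have te0 : 0 < tau * e by have /andP[? _] := tau01; rewrite mulr_gt0.
have [d d0 dP] := NP _ te0.
have cv : (- x0 ** y) @[y --> x0] --> (0 : 'rV[R]_n).
  by rewrite -[X in _ --> X](gmulNx G x0); apply: (@gmul_cvg _ _ G _ _ (nbhs_filter x0) (fun=> - x0) id); [exact: cvg_cst|exact: cvg_id].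
near=> y.
have yd : `|- x0 ** y| <= d.
  by near: y; move/(cvgr0Pnorm_le (FF := nbhs_filter x0)) : cv; apply.
have [hs [sz hh he E]] := dP _ yd.
have yE : y = x0 ** gprod G hs by rewrite E gmulKN.
rewrite distrC yE; apply: le_trans tauP; apply: (chain _ tau01) => //; first by rewrite sz.
by move=> y'; apply: eP; rewrite subrr normr0 ltW.
Unshelve. all: by end_near. Qed.

End LocalBound.
End HConvexRegularity.

(** * Directional slopes *)

Section DirectionalSlope.
Variables (R : realType) (n : nat) (G : stratifiedGroup R n).
Variables (Omega : set 'rV[R]_n) (U : 'rV[R]_n -> R).
Hypotheses (Omega_open : open Omega) (U_hconvex : hconvex G Omega U).
Hypothesis (U_continuous : forall x, Omega x -> U y @[y --> x] --> U x).
Variables (x : 'rV[R]_n) (Omega_x : Omega x).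
Implicit Types (y z k : 'rV[R]_n).

Local Notation "x '**' y" := (gmul G x y) (at level 40, left associativity).

Definition admissible k : set R :=
  [set t | 0 < t /\ forall a, 0 <= a <= t -> Omega (x ** (a *: k))].

Definition quotient k t : R := (U (x ** (t *: k)) - U x) / t.

(** The one-sided derivative of [U] at [x] in the direction [k], the difference quotients of
    a convex function being monotone. *)
Definition slope k : R := inf [set quotient k t | t in admissible k].

Lemma Omega_near : exists2 r : R, 0 < r & forall z, `|z - x| <= r -> Omega z.
Proof.
have /nbhs_ballP[e /= e0 eP] := open_nbhs_nbhs (conj Omega_open Omega_x).
exists (e / 2) => [|z zr]; first by rewrite divr_gt0.
apply: eP; rewrite -ball_normE /= distrC; apply: le_lt_trans zr _.
by rewrite ltr_pdivrMr // ltr_pMr // ltr1n.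
Qed.

Lemma admissible_small k : H1 G k -> exists2 tau, 0 < tau &
  forall t, 0 < t <= tau -> admissible k t.
Proof.
move=> hk; have [r r0 rP] := Omega_near; have [e e0 eP] := reachable_near G 1 x r0.
exists (e / (`|k| + 1)) => [|t /andP[t0 te]]; first by rewrite divr_gt0 // ltr_wpDl.
split=> // a /andP[a0 at_]; apply: rP; apply: (eP x); first by rewrite subrr normr0 ltW.
exists [:: a *: k]; split => //; last by rewrite /= gmulx0.
  by move=> X; rewrite inE => /eqP ->; exact: H1Z.
move=> X; rewrite inE => /eqP ->; rewrite normrZ ger0_norm //.
apply: le_trans (_ : e / (`|k| + 1) * (`|k| + 1) <= _).
  by apply: ler_pM; rewrite ?lerDl // (le_trans at_).
by rewrite divfK // gt_eqF // ltr_wpDl.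
Qed.

Lemma quotient_monotone k s t : H1 G k -> 0 < s <= t -> admissible k t ->
  quotient k s <= quotient k t.
Proof.
move=> hk /andP[s0 st] [t0 at_].
have := convex_on_line U_hconvex (s := s / t) hk (ltW t0) at_.
rewrite mulr0 add0r divfK ?gt_eqF // scale0r gmulx0 => h.
have st1 : 0 <= s / t <= 1.
  by apply/andP; split; [rewrite divr_ge0 ?ltW|rewrite ler_pdivrMr // mul1r].
rewrite /quotient ler_pdivrMr // mulrAC ler_pdivlMr //.
have := ler_wpM2l (ltW t0) (h st1).
have -> : t * (s / t * U (x ** (t *: k)) + (1 - s / t) * U x) =
  s * U (x ** (t *: k)) + (t - s) * U x by field; rewrite gt_eqF.
move=> h2; lra.
Qed.

(** The point [x] lies between the two points at which [U] is evaluated. *)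
Lemma quotient_lower k tau t : H1 G k -> admissible (- k) tau -> admissible k t ->
  - quotient (- k) tau <= quotient k t.
Proof.
move=> hk [tau0 atau] [t0 at_].
have line a : - tau <= a <= t -> Omega (x ** (a *: k)).
  move=> /andP[a1 a2]; have [a0|a0] := leP 0 a; first by apply: at_; rewrite a0.
  by have := atau (- a); rewrite scalerN scaleNr opprK; apply; apply/andP; split; lra.
have tt : - tau <= t by lra.
have D0 : 0 < t + tau by exact: addr_gt0.
have s01 : 0 <= tau / (t + tau) <= 1.
  by apply/andP; split; [rewrite divr_ge0 ?ltW|rewrite ler_pdivrMr // mul1r lerDr ltW].
have := convex_on_line U_hconvex hk tt line s01.
have -> : (1 - tau / (t + tau)) * - tau + tau / (t + tau) * t = 0.
  by field; rewrite gt_eqF.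
rewrite scale0r gmulx0 => h.
have := ler_wpM2l (ltW D0) h.
have -> : (t + tau) * (tau / (t + tau) * U (x ** (t *: k)) + (1 - tau / (t + tau)) * U (x ** (- tau *: k))) =
  tau * U (x ** (t *: k)) + t * U (x ** (- tau *: k)) by field; rewrite gt_eqF.
rewrite /quotient scalerN -scaleNr => h2.
rewrite -mulNr ler_pdivrMr // mulrAC ler_pdivlMr //; lra.
Qed.

Lemma slope_le k t : H1 G k -> admissible k t -> slope k <= quotient k t.
Proof.
move=> hk adm; apply: ge_inf; last by exists t.
have [tau tau0 /(_ tau)] := admissible_small (H1N hk); rewrite tau0 lexx => /(_ isT) admN.
by exists (- quotient (- k) tau) => _ [s adms <-]; exact: quotient_lower.
Qed.

Lemma slope_ge k (c : R) : H1 G k -> (forall t, admissible k t -> c <= quotient k t) ->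
  c <= slope k.
Proof.
move=> hk h; apply: lb_le_inf => [|_ [t /h ct <-] //].
have [tau tau0 /(_ tau)] := admissible_small hk; rewrite tau0 lexx => /(_ isT) adm.
by exists (quotient k tau), tau.
Qed.

Lemma slope_lt k (c : R) : H1 G k -> slope k < c -> exists2 t, admissible k t & quotient k t < c.
Proof.
move=> hk sc; apply: contrapT => h; have : c <= slope k; last by rewrite leNgt sc.
by apply: slope_ge => // t adm; rewrite leNgt; apply/negP => qc; apply: h; exists t.
Qed.

Lemma slope0 : slope 0 = 0.
Proof.
have q0 t : quotient 0 t = 0 by rewrite /quotient scaler0 gmulx0 subrr mul0r.
apply/eqP; rewrite eq_le; apply/andP; split.
  have [tau tau0 /(_ tau)] := admissible_small (@H10 R n G); rewrite tau0 lexx => /(_ isT) adm.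
  by rewrite -(q0 tau); apply: slope_le => //; exact: H10.
by apply: slope_ge => [|t _]; rewrite ?q0 //; exact: H10.
Qed.

Lemma slopeZ k (c : R) : H1 G k -> 0 < c -> slope (c *: k) <= c * slope k.
Proof.
move=> hk c0; rewrite -ler_pdivrMl //; apply: slope_ge => // t [t0 adm].
rewrite ler_pdivrMl //.
have -> : c * quotient k t = quotient (c *: k) (t / c).
  by rewrite /quotient scalerA divfK ?gt_eqF //; field; rewrite !gt_eqF.
apply: slope_le; first exact: H1Z.
split=> [|a /andP[a0 ac]]; first exact: divr_gt0.
rewrite scalerA; apply: adm; apply/andP; split; first by rewrite mulr_ge0 // ltW.
by rewrite -ler_pdivlMr.
Qed.

(** Difference quotients depend continuously on the base point; hence the slope is upper
    semicontinuous in it, with a uniform step. *)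
Lemma slope_upper_bound_near k (c : R) : H1 G k -> slope k < c ->
  exists tau, exists2 r, 0 < r & 0 < tau /\ forall y s, `|y - x| <= r -> 0 <= s <= tau ->
    U (y ** (s *: k)) <= U y + s * c.
Proof.
move=> hk /(slope_lt hk)[t0 adm0 qc0].
have [R1 R10 R1P] := Omega_near; have [e e0 eP] := reachable_near G 1 x R10.
have k1 : 0 < `|k| + 1 by rewrite ltr_wpDl.
pose tau := Num.min t0 (e / (`|k| + 1)).
have tau0 : 0 < tau by rewrite lt_min; have [-> _] := adm0; rewrite divr_gt0.
have qc : quotient k tau < c.
  apply: le_lt_trans qc0; apply: quotient_monotone => //.
  by rewrite tau0 /tau ge_min lexx.
have line y a : `|y - x| <= e -> 0 <= a <= tau -> Omega (y ** (a *: k)).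
  move=> ye /andP[a0 atau]; apply: R1P; apply: (eP y) => //.
  exists [:: a *: k]; split => //; last by rewrite /= gmulx0.
    by move=> X; rewrite inE => /eqP ->; exact: H1Z.
  move=> X; rewrite inE => /eqP ->; rewrite normrZ ger0_norm //.
  apply: le_trans (_ : e / (`|k| + 1) * (`|k| + 1) <= _).
    by apply: ler_pM; rewrite ?lerDl // (le_trans atau) // /tau ge_min lexx orbT.
  by rewrite divfK // gt_eqF.
have cv : (U (y ** (tau *: k)) - U y) @[y --> x] --> U (x ** (tau *: k)) - U x.
  apply: (cvgB (FF := nbhs_filter x)); last exact: U_continuous.
  have O : Omega (x ** (tau *: k)).
    by apply: line; rewrite ?subrr ?normr0 ?(ltW e0) // lexx ltW.
  have cvy : (y ** (tau *: k)) @[y --> x] --> x ** (tau *: k).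
    by apply: (@gmul_cvg _ _ G _ _ (nbhs_filter x) id (fun=> tau *: k)); [exact: cvg_id|exact: cvg_cst].
  exact: (cvg_comp _ _ cvy (U_continuous O)).
have d0 : 0 < c * tau - (U (x ** (tau *: k)) - U x).
  by rewrite subr_gt0 -ltr_pdivrMr.
move/(cvgrPdist_le (FF := nbhs_filter x)) : cv => /(_ _ d0) /nbhs_ballP[r1 /= r10 r1P].
exists tau, (Num.min e (r1 / 2)); first by rewrite lt_min e0 divr_gt0.
split=> // y s; rewrite le_min => /andP[ye yr] /andP[s0 stau].
have yb : ball x r1 y.
  rewrite -ball_normE /= distrC; apply: le_lt_trans yr _.
  by rewrite ltr_pdivrMr // ltr_pMr // ltr1n.
have := r1P y yb; rewrite ler_norml => /andP[h _].
have := convex_on_line U_hconvex (s := s / tau) hk (ltW tau0) (fun a => line y a ye).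
rewrite mulr0 add0r divfK ?gt_eqF // scale0r gmulx0 => h2.
have st1 : 0 <= s / tau <= 1 by apply/andP; split; [rewrite divr_ge0 // ltW|rewrite ler_pdivrMr // mul1r].
apply: le_trans (h2 st1) _.
have h3 : U (y ** (tau *: k)) - U y <= c * tau by lra.
have : s / tau * (U (y ** (tau *: k)) - U y) <= s / tau * (c * tau).
  by apply: ler_wpM2l => //; have /andP[] := st1.
have -> : s / tau * (c * tau) = s * c by field; rewrite gt_eqF.
by move=> h4; lra.
Qed.

(** Move from [x] to a point near [x ** t (k + k')] along a staircase of [2 N] steps in the
    directions [k] and [k']. By upper semicontinuity each step increases [U] at most at a rate
    close to the slope at [x]. The continuity of [U] permits to let [N] tend to infinity. *)
Lemma slope_subadditive k k' : H1 G k -> H1 G k' -> slope (k + k') <= slope k + slope k'.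
Proof.
move=> hk hk'; apply/ler_addgt0Pr => eps eps0.
pose c := slope k + eps / 2; pose c' := slope k' + eps / 2.
have -> : slope k + slope k' + eps = c + c' by rewrite /c /c' addrACA -splitr.
have hkk : H1 G (k + k') by rewrite -[k]scale1r; exact: H1D.
have [tau [r r0 [tau0 tauP]]] : exists tau, exists2 r, 0 < r & 0 < tau /\
    forall y s, `|y - x| <= r -> 0 <= s <= tau -> U (y ** (s *: k)) <= U y + s * c.
  by apply: slope_upper_bound_near => //; rewrite ltrDl divr_gt0.
have [tau' [r' r0' [tau0' tauP']]] : exists tau, exists2 r, 0 < r & 0 < tau /\
    forall y s, `|y - x| <= r -> 0 <= s <= tau -> U (y ** (s *: k')) <= U y + s * c'.
  by apply: slope_upper_bound_near => //; rewrite ltrDl divr_gt0.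
clearbody c c'; have [R1 R10 R1P] := Omega_near.
pose rr := Num.min R1 (Num.min r r').
have rr0 : 0 < rr by rewrite !lt_min R10 r0 r0'.
have [d d0 dP] : exists2 d : R, 0 < d & forall v w, `|v| <= d -> `|w| <= d -> `|x ** v ** w - x| <= rr.
  have cv : (x ** p.1 ** p.2) @[p --> ((0, 0) : 'rV[R]_n * 'rV[R]_n)] --> x.
    rewrite -[X in _ --> X](gmulx0 G) -[X in _ --> X ** _](gmulx0 G).
    apply: (@gmul_cvg _ _ G _ _ (nbhs_filter _) (fun p => x ** p.1) snd); last exact: cvg_snd.
    by apply: (@gmul_cvg _ _ G _ _ (nbhs_filter _) (fun=> x) fst); [exact: cvg_cst|exact: cvg_fst].
  move/(cvgrPdist_le (FF := nbhs_filter _)) : cv => /(_ _ rr0) /nbhs_ballP[e /= e0 eP].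
  exists (e / 2) => [|v w ve we]; first by rewrite divr_gt0.
  have e2 : e / 2 < e by rewrite ltr_pdivrMr // ltr_pMr // ltr1n.
  rewrite distrC; apply: (eP (v, w)); split; rewrite /= -ball_normE /= sub0r normrN;
    exact: le_lt_trans e2.
pose D := `|k + k'| + `|k| + 1.
have D0 : 0 < D by rewrite ltr_wpDl // addr_ge0.
pose t := Num.min (Num.min 1 (d / D)) (Num.min tau tau').
have t0 : 0 < t by rewrite !lt_min ltr01 divr_gt0 //= tau0 tau0'.
have [t1 [tD [tt tt']]] : t <= 1 /\ (t <= d / D /\ (t <= tau /\ t <= tau')).
  by rewrite /t !ge_min !lexx !orbT.
have tDd : t * D <= d by rewrite -ler_pdivlMr.
have near v : `|v| <= d -> `|x ** v - x| <= rr.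
  by move=> vd; have := dP v 0 vd; rewrite gmulx0; apply; rewrite normr0 ltW.
have tkd : t * `|k| <= d by apply: le_trans tDd; rewrite ler_pM2l // /D addrAC lerDr addr_ge0.
have adm : admissible (k + k') t.
  split=> // a /andP[a0 at_]; apply: R1P.
  have : rr <= R1 by rewrite /rr ge_min lexx.
  apply: le_trans; apply: near; rewrite normrZ ger0_norm //; apply: le_trans tDd.
  by apply: ler_pM => //; rewrite /D -addrA lerDl addr_ge0.
apply: le_trans (slope_le hkk adm) _; rewrite /quotient ler_pdivrMr // lerBlDl.
(* One stair; by trotter, N of them lead almost to t (k + k'). *)
pose w (i : nat) := (i.+1%:R^-1 *: (t *: k)) ** (i.+1%:R^-1 *: (t *: k')).
have wcv : (i.+1%:R *: w i) @[i --> \oo] --> t *: (k + k').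
  by rewrite scalerDr; exact: trotter.
have Ucv : U (x ** (i.+1%:R *: w i)) @[i --> \oo] --> U (x ** (t *: (k + k'))).
  have O : Omega (x ** (t *: (k + k'))) by have [_] := adm; apply; rewrite lexx ltW.
  have cvi : (x ** (i.+1%:R *: w i)) @[i --> \oo] --> x ** (t *: (k + k')).
    by apply: gmul_cvg; [exact: cvg_cst|].
  exact: (cvg_comp _ _ cvi (U_continuous O)).
have bound i : `|i.+1%:R *: w i| <= t * (`|k + k'| + 1) -> U (x ** (i.+1%:R *: w i)) <= U x + (c + c') * t.
  move=> wb; pose N : R := i.+1%:R; have N0 : 0 < N by rewrite ltr0n.
  have tN : 0 <= t / N by rewrite divr_ge0 ?ltW.
  have tNt : t / N <= t by rewrite ler_pdivrMr // ler_peMr //; [exact: ltW|rewrite /N ler1n].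
  suff stair (j : nat) : (j <= i.+1)%N -> U (x ** (j%:R *: w i)) <= U x + j%:R * (t / N * (c + c')).
    apply: le_trans (stair i.+1 (leqnn _)) _; rewrite lerD2l -/N.
    by rewrite le_eqVlt; apply/orP; left; apply/eqP; field; rewrite gt_eqF.
  elim: j => [_|j IH ji]; first by rewrite scale0r gmulx0 mul0r addr0.
  have jw : `|j%:R *: w i| <= d.
    apply: le_trans (_ : `|N *: w i| <= _).
      by rewrite !normrZ; apply: ler_wpM2r => //; rewrite /N !normr_nat ler_nat ltnW.
    apply: le_trans wb (le_trans _ tDd); by rewrite ler_pM2l // /D [leRHS]addrAC lerDl.
  have step1 : `|x ** (j%:R *: w i) - x| <= r.
    by apply: le_trans (near _ jw) _; rewrite /rr !ge_min lexx !orbT.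
  have tkN : `|(t / N) *: k| <= d.
    by rewrite normrZ ger0_norm //; apply: le_trans tkd; rewrite ler_wpM2r.
  have step2 : `|x ** (j%:R *: w i) ** ((t / N) *: k) - x| <= r'.
    by apply: le_trans (dP _ _ jw tkN) _; rewrite /rr !ge_min lexx !orbT.
  have tN1 : 0 <= t / N <= tau by rewrite tN (le_trans tNt).
  have tN2 : 0 <= t / N <= tau' by rewrite tN (le_trans tNt).
  have s1 := tauP _ _ step1 tN1; have s2 := tauP' _ _ step2 tN2.
  have wE : x ** (j%:R *: w i) ** ((t / N) *: k) ** ((t / N) *: k') = x ** (j.+1%:R *: w i).
    rewrite -!gmulA; congr (_ ** _).
    have -> : (t / N) *: k ** ((t / N) *: k') = 1 *: w i.
      by rewrite scale1r /w !scalerA mulrC.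
    by rewrite gmul_collinear natr1.
  rewrite -wE; have -> : j.+1%:R * (t / N * (c + c')) =
      j%:R * (t / N * (c + c')) + t / N * c + t / N * c'.
    by have -> : j.+1%:R = j%:R + 1 :> R; [rewrite natr1|ring].
  apply: le_trans s2 _; rewrite !addrA lerD2r; apply: le_trans s1 _; rewrite lerD2r.
  exact: IH (ltnW ji).
rewrite leNgt; apply/negP => lt; set v := U (x ** (t *: (k + k'))) in lt Ucv.
have e0 : 0 < v - (U x + (c + c') * t) by rewrite subr_gt0.
have tt0 : 0 < t by [].
near \oo => i.
have hb : `|i.+1%:R *: w i| <= t * (`|k + k'| + 1).
  rewrite -[_ *: w i](subKr (t *: (k + k'))); apply: le_trans (ler_normB _ _) _.
  rewrite mulrDr mulr1 normrZ gtr0_norm // lerD2l.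
  by near: i; move/cvgrPdist_le : wcv; apply.
have := bound i hb; apply/negP; rewrite -ltNge.
have : `|v - U (x ** (i.+1%:R *: w i))| < v - (U x + (c + c') * t).
  by near: i; move/cvgrPdist_lt : Ucv; apply.
by rewrite ltr_norml => /andP[_ h]; lra.
Unshelve. all: by end_near. Qed.

End DirectionalSlope.

(** * Supporting linear forms and homogeneous norms *)

Section HahnBanach.
Variables (R : realType) (n : nat).
Implicit Types (f g : 'rV[R]_n -> R) (u v h : 'rV[R]_n).

Definition sublinear f := [/\ f 0 = 0, forall u v, f (u + v) <= f u + f v &
  forall (c : R) u, 0 < c -> f (c *: u) <= c * f u].

(** The infimum of [f (u + t h) - t s] over [t]. It is the largest sublinear function below [f]
    that is at most [s] at [h] and at most [- s] at [- h], hence linear along [h]. *)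
Lemma sublinear_reduction f h (s : R) : sublinear f -> - f (- h) <= s <= f h ->
  exists g, [/\ sublinear g, forall u, g u <= f u, g h <= s & g (- h) <= - s].
Proof.
move=> [f0 fD fZ] /andP[s1 s2].
have line t : t * s <= f (t *: h).
  have [t0|t0|->] := ltrgt0P t; last by rewrite mul0r scale0r f0.
    have ti : 0 < t^-1 by rewrite invr_gt0.
    have := fZ _ (t *: h) ti; rewrite scalerA mulVf ?gt_eqF // scale1r => h1.
    by rewrite mulrC -ler_pdivlMr // mulrC; apply: le_trans h1.
  have ti : 0 < (- t)^-1 by rewrite invr_gt0 oppr_gt0.
  have := fZ _ (t *: h) ti; rewrite scalerA invrN mulNr mulVf ?lt_eqF // scaleN1r => h1.
  have h2 : - s <= - t^-1 * f (t *: h) by lra.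
  have nt : 0 < - t by rewrite oppr_gt0.
  have := ler_wpM2l (ltW nt) h2.
  rewrite mulrNN (_ : - t * (- t^-1 * f (t *: h)) = f (t *: h)) //.
  by field; rewrite lt_eqF.
pose S u := [set f (u + t *: h) - t * s | t in setT].
have S0 u t : S u (f (u + t *: h) - t * s) by exists t.
have Slb u : has_lbound (S u).
  exists (- f (- u)) => _ [t _ <-]; have := line t; have := fD (u + t *: h) (- u).
  by rewrite addrAC subrr add0r; lra.
pose g u := inf (S u).
have gle u t : g u <= f (u + t *: h) - t * s by apply: ge_inf.
have leg u a : (forall t, a <= f (u + t *: h) - t * s) -> a <= g u.
  move=> au; apply: lb_le_inf; first by exists (f (u + 0 *: h) - 0 * s).
  by move=> _ [t _ <-].
exists g; split.
- split.
  + apply/eqP; rewrite eq_le; apply/andP; split.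
      by have := gle 0 0; rewrite scale0r addr0 f0 mul0r subrr.
    by apply: (leg) => t; rewrite add0r subr_ge0.
  + move=> u v; rewrite -lerBlDr; apply: (leg) => t; rewrite lerBlDl -lerBlDr.
    apply: (leg) => t'; rewrite lerBlDr.
    apply: le_trans (gle _ (t + t')) _; have := fD (u + t *: h) (v + t' *: h).
    have -> : u + v + (t + t') *: h = u + t *: h + (v + t' *: h).
      by rewrite scalerDl addrACA.
    by lra.
  + move=> c u c0; rewrite -ler_pdivrMl //; apply: (leg) => t; rewrite ler_pdivrMl //.
    apply: le_trans (gle _ (c * t)) _; rewrite -scalerA -scalerDr mulrBr -mulrA lerD2r.
    exact: fZ.
- by move=> u; have := gle u 0; rewrite scale0r addr0 mul0r subr0.
- by have := gle h (-1); rewrite scaleN1r subrr f0 mulN1r opprK add0r.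
- by have := gle (- h) 1; rewrite scale1r addNr f0 mul1r add0r.
Qed.

(** After a reduction along [h], reduce along the vectors of the standard basis in turn. A
    sublinear function that is linear along each of them is linear. *)
Lemma hahn_banach_row f h (s : R) : sublinear f -> - f (- h) <= s <= f h ->
  exists w : 'rV[R]_n, (forall v, \sum_i v 0 i * w 0 i <= f v) /\ \sum_i h 0 i * w 0 i = s.
Proof.
move=> fsub fs; have [g [gsub gf gh gNh]] := sublinear_reduction fsub fs.
have gen m : (m <= n)%N -> exists g', [/\ sublinear g', forall u, g' u <= g u &
    forall i : 'I_n, (i < m)%N -> g' (delta_mx 0 i) + g' (- delta_mx 0 i) <= 0].
  elim: m => [_|m IH mn]; first by exists g; split.
  have [g1 [g1sub g1g g1i]] := IH (ltnW mn); pose im := Ordinal mn.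
  have [g10 g1D _] := g1sub.
  have [|g2 [g2sub g21 g2e g2Ne]] := @sublinear_reduction g1 (delta_mx 0 im) (g1 (delta_mx 0 im)) g1sub.
    by rewrite lexx andbT; have := g1D (delta_mx 0 im) (- delta_mx 0 im); rewrite subrr g10; lra.
  exists g2; split => // [u|i]; first exact: le_trans (g21 u) (g1g u).
  rewrite ltnS leq_eqVlt => /orP[/eqP im'|/g1i h1].
    by have -> : i = im by [apply/val_inj]; lra.
  by apply: le_trans h1; apply: lerD.
have [q [[q0 qD qZ] qg qi]] := gen n (leqnn n).
pose w : 'rV[R]_n := \row_i q (delta_mx 0 i).
have le1 v : q v <= \sum_i v 0 i * w 0 i.
  rewrite {1}(row_sum_delta v).
  apply: (big_ind2 (fun u a => q u <= a)); first by rewrite q0.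
    by move=> u1 a1 u2 a2 h1 h2; apply: le_trans (qD _ _) (lerD h1 h2).
  move=> i _; rewrite mxE; have := qi i (ltn_ord i); set e := delta_mx 0 i => ei.
  have [t0|t0|->] := ltrgt0P (v 0 i); last by rewrite scale0r mul0r q0.
    exact: qZ.
  have nt : 0 < - v 0 i by rewrite oppr_gt0.
  have := qZ _ (- e) nt; rewrite scalerN scaleNr opprK => h1; apply: le_trans h1 _.
  have : q (- e) <= - q e by lra.
  by move=> /(ler_wpM2l (ltW nt)); rewrite mulrNN.
have eq1 v : \sum_i v 0 i * w 0 i = q v.
  apply/eqP; rewrite eq_le le1 andbT.
  have := le1 (- v); have := qD v (- v); rewrite subrr q0.
  have -> : \sum_i (- v) 0 i * w 0 i = - \sum_i v 0 i * w 0 i.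
    by rewrite -sumrN; apply: eq_bigr => i _; rewrite mxE mulNr.
  by lra.
exists w; split=> [v|]; first by rewrite eq1; exact: le_trans (qg v) (gf v).
rewrite eq1; have := qg h; have := qg (- h); have := qD h (- h); rewrite subrr q0.
by move=> h1 h2 h3; apply/eqP; rewrite eq_le; apply/andP; split; lra.
Qed.

End HahnBanach.

Section Riesz.
Variables (R : realType) (n : nat) (G : stratifiedGroup R n).
Variable ip : 'rV[R]_n -> 'rV[R]_n -> R.
Hypothesis ip_scalar : scalar_product G ip.
Implicit Types (x y z : 'rV[R]_n).

Definition horizontal_part x : 'rV[R]_n := \row_i (if deg G i == 1%N then x 0 i else 0).

Lemma horizontal_part_H1 x : H1 G (horizontal_part x).
Proof. by move=> i /eqP/negbTE di; rewrite mxE di. Qed.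

Lemma horizontal_part_id x : H1 G x -> horizontal_part x = x.
Proof. by move=> hx; apply/rowP => i; rewrite mxE; case: eqP => // /hx ->. Qed.

Lemma horizontal_partD x y : horizontal_part (x + y) = horizontal_part x + horizontal_part y.
Proof. by apply/rowP => i; rewrite !mxE; case: ifP => // _; rewrite addr0. Qed.

Lemma horizontal_partZ (c : R) x : horizontal_part (c *: x) = c *: horizontal_part x.
Proof. by apply/rowP => i; rewrite !mxE; case: ifP => // _; rewrite mulr0. Qed.

Lemma ip_sumr x (w : 'I_n -> R) (v : 'I_n -> 'rV[R]_n) :
  ip x (\sum_i w i *: v i) = \sum_i w i * ip x (v i).
Proof.
have [ipl ips _ _] := ip_scalar.
have ip0 y : ip 0 y = 0.
  by apply: (addrI (1 * ip 0 y)); rewrite -ipl scaler0 addr0 mul1r addr0.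
rewrite ips; apply: (big_rec2 (fun a b => ip a x = b)) => [|i b a _ <-]; first exact: ip0.
by rewrite ipl (ips (v i)).
Qed.

(** The layers being orthogonal, the vector that represents a linear form vanishing on the
    higher layers is horizontal. *)
Lemma riesz_H1 (w : 'rV[R]_n) : exists p, H1 G p /\
  forall k, H1 G k -> ip p k = \sum_i k 0 i * w 0 i.
Proof.
have [ipl ips ippos iporth] := ip_scalar.
pose A : 'M[R]_n := \matrix_(i, j) ip (delta_mx 0 i) (delta_mx 0 j).
have ipA x j : (x *m A) 0 j = ip x (delta_mx 0 j).
  rewrite mxE ips {2}(row_sum_delta x) ip_sumr; apply: eq_bigr => i _.
  by rewrite mxE (ips (delta_mx 0 j)).
have ipE x y : ip x y = \sum_j y 0 j * (x *m A) 0 j.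
  by rewrite {1}(row_sum_delta y) ip_sumr; apply: eq_bigr => j _; rewrite ipA.
have Au : A \in unitmx.
  rewrite -row_free_unit; apply: inj_row_free => x x0; apply/eqP; apply: contraT => /ippos.
  by rewrite ipE x0 big1 ?ltxx // => j _; rewrite mxE mulr0.
pose w1 := horizontal_part w; pose g0 := w1 *m invmx A; pose g := horizontal_part g0.
have g0E y : ip g0 y = \sum_j y 0 j * w1 0 j by rewrite ipE mulmxKV.
(* v has no component in the first layer, so that it is orthogonal both to g and to g0. *)
pose v := g0 - g.
have v1 j : deg G j = 1%N -> v 0 j = 0 by move=> dj; rewrite !mxE dj eqxx subrr.
have gv : ip g v = 0.
  rewrite (row_sum_delta v) ip_sumr big1 // => j _.
  have [/v1 ->|dj] := eqVneq (deg G j) 1%N; first by rewrite mul0r.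
  rewrite (iporth 1%N (deg G j)) ?mulr0 //; first by move=> e; rewrite -e eqxx in dj.
    exact: horizontal_part_H1.
  exact: delta_layer.
have g0v : ip g0 v = 0.
  rewrite g0E big1 // => j _; rewrite [w1 0 j]mxE.
  by case: eqP => [/v1 ->|_]; rewrite ?mul0r ?mulr0.
have v0 : v = 0.
  apply/eqP; apply: contraT => /ippos.
  have -> : ip v v = ip g0 v - ip g v.
    by have := ipl (-1) g g0 v; rewrite scaleN1r addrC -/v mulN1r => ->; rewrite addrC.
  by rewrite gv g0v subrr ltxx.
have gE : g0 = g by apply/eqP; rewrite -subr_eq0 -/v v0.
exists g0; split; first by rewrite gE; exact: horizontal_part_H1.
move=> k hk; rewrite g0E; apply: eq_bigr => j _; rewrite [w1 0 j]mxE.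
by case: eqP => // /hk ->; rewrite !mul0r.
Qed.

End Riesz.

Section HomogeneousNorm.
Variables (R : realType) (n : nat) (G : stratifiedGroup R n).
Variable d : 'rV[R]_n -> 'rV[R]_n -> R.
Hypothesis d_homog : homogeneous_distance G d.
Implicit Types (x y w : 'rV[R]_n).

Lemma hnorm_dil (r : R) w : 0 < r -> hnorm d (dil (deg G) r w) = r * hnorm d w.
Proof.
have [_ _ _ dd] := d_homog => r0.
by rewrite /hnorm -{1}(dil0 G r) dd.
Qed.

Lemma hnorm_gt0 w : w != 0 -> 0 < hnorm d w.
Proof.
have [[dge0 d0 _ _] _ _ _] := d_homog => w0; rewrite lt_neqAle dge0 andbT eq_sym.
by apply: contraNneq w0 => /d0 ->.
Qed.

Lemma hnorm_continuous : continuous (hnorm d).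
Proof.
have [_ dc _ _] := d_homog => w.
have c2 : ((0, z) : 'rV[R]_n * 'rV[R]_n) @[z --> w] --> ((0, w) : 'rV[R]_n * 'rV[R]_n).
  by apply: (cvg_pair (FF := nbhs_filter w) (FG := nbhs_filter _) (FH := nbhs_filter _));
    [exact: cvg_cst|exact: cvg_id].
exact: (cvg_comp _ _ c2 (dc (0, w))).
Qed.

Lemma hnorm_lower_bound : exists2 c, 0 < c & forall w, `|w| = 1 -> c <= hnorm d w.
Proof.
pose S := [set w : 'rV[R]_n | `|w| = 1].
have [S0|S0] := eqVneq S set0.
  exists 1 => // w w1; have : S w by []. by rewrite S0.
have Sc : compact S.
  apply: bounded_closed_compact.
    by exists 1; split=> [|M M1 w /= ->]; rewrite ?num_real // ltW.
  rewrite (_ : S = (fun w : 'rV[R]_n => `|w|) @^-1` [set 1]) //.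
  apply: preimage_closed; last exact: closed_eq.
  by move=> w _; exact: norm_continuous.
have hc : {within S, continuous (hnorm d)} by apply: continuous_subspaceT; exact: hnorm_continuous.
move/set0P : S0 => S0; have [w1 Sw1 w1P] := EVT_min_rV S0 Sc hc.
exists (hnorm d w1) => [|w Sw]; last by apply: w1P; rewrite inE.
apply: hnorm_gt0; apply/eqP => w_0.
by move: Sw1; rewrite inE /S /= w_0 normr0 => /esym/eqP; rewrite oner_eq0.
Qed.

(** A vector of norm larger than one is dilated to norm one by some factor [r < 1]; the
    homogeneous norm of the result is [r] on the unit sphere, and it has a positive lower
    bound. *)
Lemma unit_sphere_bounded : exists B : R, forall w, hnorm d w = 1 -> `|w| <= B.
Proof.
have [c c0 cP] := hnorm_lower_bound.
exists (Num.max 1 (c^-1 ^+ step G)) => w w1; rewrite le_max.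
have [//|wgt1 /=] := leP `|w| 1.
pose f (r : R) := `|dil (deg G) r w|.
have fc : {within `[0, 1], continuous f}.
  apply: continuous_subspaceT => r.
  apply: (@cvg_comp _ _ _ (fun r : R => dil (deg G) r w) (fun v : 'rV[R]_n => `|v|)); last exact: norm_continuous.
  have E r' : dil (deg G) r' w = \sum_i (r' ^+ deg G i * w 0 i) *: delta_mx 0 i.
    by rewrite {1}(row_sum_delta (dil (deg G) r' w)); apply: eq_bigr => i _; rewrite mxE.
  rewrite E (funext E); elim: (index_enum _) => [|i s IH].
    by rewrite big_nil (funext (fun t => big_nil _ _ _ _)); exact: cvg_cst.
  rewrite big_cons (funext (fun t => big_cons _ _ _ _ _ _)) /=.
  apply: cvgD => //; apply: cvgZr_tmp; apply: cvgMr_tmp; exact: exprn_continuous.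
have f0 : f 0 = 0.
  rewrite /f (_ : dil _ _ _ = 0) ?normr0 //; apply/rowP => i; rewrite !mxE.
  by have /andP[di _] := deg_bounds G i; rewrite expr0n eqn0Ngt di mul0r.
have f1 : f 1 = `|w|.
  by rewrite /f (_ : dil _ _ _ = w) //; apply/rowP => i; rewrite mxE expr1n mul1r.
have [r r01 fr] : exists2 r, r \in `[0, 1] & f r = 1.
  by apply: IVT => //; rewrite f0 f1 ge_min le_max ler01 (ltW wgt1) orbT.
move: r01; rewrite in_itv /= => /andP[r0 r1].
have r_gt0 : 0 < r.
  rewrite lt_neqAle r0 andbT eq_sym; apply/eqP => r_0.
  by move: fr; rewrite r_0 f0 => /esym/eqP; rewrite oner_eq0.
have cr : c <= r by have := cP _ fr; rewrite hnorm_dil // w1 mulr1.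
apply: le_trans (_ : r^-1 ^+ step G <= _); last first.
  by apply: lerXn2r; rewrite ?nnegrE ?invr_ge0 ?(ltW c0) ?(ltW r_gt0) // lef_pV2 ?posrE.
apply: row_norm_le => [|i]; first by rewrite exprn_ge0 // invr_ge0.
rewrite exprVn -[leRHS]mul1r ler_pdivlMr ?exprn_gt0 // mulrC.
apply: le_trans (_ : r ^+ deg G i * `|w 0 i| <= _).
  apply: ler_wpM2r => //; apply: ler_wiXn2l => //.
  by have /andP[_] := deg_bounds G i.
rewrite -{1}(ger0_norm (exprn_ge0 (deg G i) r0)) -normrM -fr /f.
by have := coord_norm_le (dil (deg G) r w) i; rewrite mxE.
Qed.

End HomogeneousNorm.

(** * Polynomials of homogeneous degree two *)

Section PolynomialExpansion.
Variables (R : realType) (n : nat) (G : stratifiedGroup R n).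
Implicit Types (x y h k : 'rV[R]_n).

Local Notation "x '**' y" := (gmul G x y) (at level 40, left associativity).

Lemma deg_gt0 i : (0 < deg G i)%N.
Proof. by have /andP[] := deg_bounds G i. Qed.

(** Exponents are given by a function, in order that a factor can be split off. *)
Lemma monomial_peel (e : 'I_n -> nat) i : (0 < e i)%N -> exists e' : 'I_n -> nat,
  (\sum_j deg G j * e j = deg G i + \sum_j deg G j * e' j)%N /\
  forall y, \prod_j y 0 j ^+ e j = y 0 i * \prod_j y 0 j ^+ e' j :> R.
Proof.
move=> ei; exists (fun j => e j - (j == i))%N; split=> [|y].
  rewrite (bigD1 i) //= [in RHS](bigD1 i) //= eqxx addnA -[in RHS]mulnS subn1 prednK //.
  by congr (_ + _)%N; apply: eq_bigr => j /negbTE ->; rewrite subn0.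
rewrite (bigD1 i) //= [in RHS](bigD1 i) //= eqxx mulrA -exprS subn1 prednK //.
by congr (_ * _); apply: eq_bigr => j /negbTE ->; rewrite subn0.
Qed.

Lemma monomial_trivial (e : 'I_n -> nat) : (\sum_j deg G j * e j = 0)%N ->
  forall y, \prod_j y 0 j ^+ e j = 1 :> R.
Proof.
move=> /eqP; rewrite sum_nat_eq0 => /forallP e0 y; rewrite big1 // => j _.
by have := e0 j; rewrite muln_eq0 eqn0Ngt deg_gt0 /= => /eqP ->.
Qed.

Lemma monomial_nontrivial (e : 'I_n -> nat) : (\sum_j deg G j * e j != 0)%N ->
  exists i, (0 < e i)%N.
Proof.
rewrite sum_nat_eq0 negb_forall => /existsP[i]; rewrite /= muln_eq0 negb_or => /andP[_ ei].
by exists i; rewrite lt0n.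
Qed.

Lemma monomial_cases (e : 'I_n -> nat) : (\sum_j deg G j * e j <= 2)%N ->
  [\/ (\sum_j deg G j * e j = 0)%N /\ (forall y, \prod_j y 0 j ^+ e j = 1 :> R),
      exists i, (\sum_j deg G j * e j = deg G i)%N /\
        (forall y, \prod_j y 0 j ^+ e j = y 0 i :> R) |
      exists i j, [/\ deg G i = 1%N, deg G j = 1%N, (\sum_j deg G j * e j = 2)%N &
        forall y, \prod_j y 0 j ^+ e j = y 0 i * y 0 j :> R]].
Proof.
move=> le2; have [e0|/monomial_nontrivial[i /monomial_peel[e1 [E1 P1]]]] :=
    eqVneq (\sum_j deg G j * e j)%N 0%N.
  by apply: Or31; split => //; exact: monomial_trivial.
have [e10|/monomial_nontrivial[j /monomial_peel[e2 [E2 P2]]]] :=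
    eqVneq (\sum_j deg G j * e1 j)%N 0%N.
  apply: Or32; exists i; split; first by rewrite E1 e10 addn0.
  by move=> y; rewrite P1 monomial_trivial // mulr1.
apply: Or33; exists i, j; move: le2; rewrite E1 E2; have := deg_gt0 i; have := deg_gt0 j.
case: (deg G i) => [//|[|a]]; case: (deg G j) => [//|[|b]] // _ _ le2;
  try by exfalso; move: le2; rewrite ?addSn ?addnS ?ltnS.
have e20 : (\sum_l deg G l * e2 l = 0)%N.
  by move: le2; rewrite !add1n !ltnS leqn0 => /eqP.
split; rewrite ?e20 //.
by move=> y; rewrite P1 P2 (monomial_trivial e20) mulr1.
Qed.

Definition linear_form (L : 'rV[R]_n -> R) := forall a u v, L (a *: u + v) = a * L u + L v.

(** Along a horizontal line a coordinate of degree one or two is affine, its slope being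
    linear in the direction. *)
Lemma monomial_expansion x (e : 'I_n -> nat) : (\sum_j deg G j * e j <= 2)%N ->
  exists2 L, linear_form L & forall h t, H1 G h ->
    \prod_j (x ** (t *: h)) 0 j ^+ e j = \prod_j x 0 j ^+ e j + t * L h
      + t ^+ 2 * (if (\sum_j deg G j * e j == 2)%N then \prod_j h 0 j ^+ e j else 0).
Proof.
move=> le2; case: (monomial_cases le2) => [[E P]|[i [E P]]|[i [j [di dj E P]]]].
- exists (fun=> 0) => [a u v|h t _]; first by rewrite mulr0 addr0.
  by rewrite E !P !mulr0 !addr0.
- have : (deg G i == 1%N) || (deg G i == 2%N).
    by move: le2 (deg_gt0 i); rewrite E; case: (deg G i) => [|[|[|]]].
  move=> /orP[|] /eqP di.
    exists (fun h => h 0 i) => [a u v|h t _]; first by rewrite !mxE.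
    by rewrite !P E di gmul_coord1 // mxE mulr0 addr0.
  exists (fun h => 2^-1 * lie G x h 0 i) => [a u v|h t hh].
    by rewrite lieDr !mxE; ring.
  rewrite !P E di eqxx gmul_coord2 // lieZr !mxE hh ?di // !mulr0 !addr0.
  by rewrite mulrCA.
- exists (fun h => x 0 i * h 0 j + h 0 i * x 0 j) => [a u v|h t _]; first by rewrite !mxE; ring.
  by rewrite !P E eqxx !gmul_coord1 // !mxE; ring.
Qed.

Lemma poly_expansion (P : mpoly.mpoly n R) x : hdeg_le (deg G) P 2 ->
  exists2 L, linear_form L & forall h t, H1 G h ->
    poly_fun P (x ** (t *: h)) = poly_fun P x + t * L h + t ^+ 2 * homog_part (deg G) 2 P h.
Proof.
move=> P2; rewrite /poly_fun /homog_part.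
have gen (s : seq (mpoly.multinom n)) :
    (forall m, m \in s -> (hdeg_monomial (deg G) m <= 2)%N) ->
    exists2 L, linear_form L & forall h t, H1 G h ->
    \sum_(m <- s) mpoly.mcoeff m P * \prod_i (x ** (t *: h)) 0 i ^+ mpoly.fun_of_multinom m i =
    \sum_(m <- s) mpoly.mcoeff m P * \prod_i x 0 i ^+ mpoly.fun_of_multinom m i + t * L h
    + t ^+ 2 * \sum_(m <- s | hdeg_monomial (deg G) m == 2%N)
        mpoly.mcoeff m P * \prod_i h 0 i ^+ mpoly.fun_of_multinom m i.
  elim: s => [_|m s IH s2].
    exists (fun=> 0) => [a u v|h t _]; first by rewrite mulr0 addr0.
    by rewrite !big_nil !mulr0 !addr0.
  have [|L Ll LE] := IH; first by move=> m' ms; apply: s2; rewrite inE ms orbT.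
  have [L' Ll' LE'] := @monomial_expansion x (mpoly.fun_of_multinom m) (s2 m (mem_head _ _)).
  exists (fun h => mpoly.mcoeff m P * L' h + L h) => [a u v|h t hh].
    by rewrite Ll Ll'; ring.
  rewrite !big_cons LE // LE' // -/(hdeg_monomial (deg G) m).
  by case: ifP => _; ring.
have [|L Ll LE] := gen (mpoly.msupp P).
  by move=> m; rewrite mpoly.mcoeff_msupp => /P2.
by exists L => // h t hh; rewrite !mpoly.mevalE LE.
Qed.

Lemma homog_part_dil (P : mpoly.mpoly n R) j (r : R) h :
  homog_part (deg G) j P (dil (deg G) r h) = r ^+ j * homog_part (deg G) j P h.
Proof.
rewrite /homog_part mulr_sumr; apply: eq_bigr => m /eqP mj.
rewrite mulrCA; congr (_ * _); rewrite -mj /hdeg_monomial -prodrXr -big_split /=.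
by apply: eq_bigr => i _; rewrite mxE exprMn exprM.
Qed.

Section LambdaBound.
Variable d : 'rV[R]_n -> 'rV[R]_n -> R.
Hypothesis d_homog : homogeneous_distance G d.

(** By homogeneity it is enough to consider the unit sphere, on which the polynomial is bounded,
    so that the supremum defining [lambda_max] is one of a bounded set. *)
Lemma homog_part_ge (P : mpoly.mpoly n R) h : H1 G h ->
  - (lambda_max G d P * hnorm d h ^+ 2) <= homog_part (deg G) 2 P h.
Proof.
move=> hh; have [->|h0] := eqVneq h 0.
  have := homog_part_dil P 2 0 0; rewrite dil0 expr0n mul0r => ->.
  have [[_ d0 _ _] _ _ _] := d_homog.
  by rewrite /hnorm (_ : d 0 0 = 0) ?expr0n ?mulr0 ?oppr0 //; apply/d0.
have r0 : 0 < hnorm d h by exact: (hnorm_gt0 d_homog h0).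
set r := hnorm d h in r0 *; pose w := dil (deg G) r^-1 h.
have w1 : hnorm d w = 1 by rewrite (hnorm_dil d_homog) ?invr_gt0 // mulVf // gt_eqF.
have hw : h = dil (deg G) r w.
  have rV : r^-1 != 0 by rewrite invr_neq0 // gt_eqF.
  by have := dilK G h rV; rewrite invrK => ->.
rewrite hw homog_part_dil mulrC -mulrN ler_pM2l ?exprn_gt0 //.
have : `|homog_part (deg G) 2 P w| <= lambda_max G d P; last by rewrite ler_norml => /andP[].
apply: ub_le_sup; last by exists w.
have [B BP] := unit_sphere_bounded d_homog.
exists (\sum_(m <- mpoly.msupp P | hdeg_monomial (deg G) m == 2%N)
   `|mpoly.mcoeff m P| * \prod_i `|B| ^+ mpoly.fun_of_multinom m i).
move=> _ [v v1 <-]; apply: le_trans (ler_norm_sum _ _ _) _; apply: ler_sum => m _.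
rewrite normrM; apply: ler_wpM2l => //; rewrite normr_prod; apply: ler_prod => i _.
rewrite normr_ge0 normrX lerXn2r ?nnegrE //.
by apply: le_trans (coord_norm_le _ _) (le_trans (BP _ v1) (ler_norm _)).
Qed.

End LambdaBound.
End PolynomialExpansion.

Section Rolle.
Variable R : realType.

(** If both extrema are attained at end points only, the function is constant. *)
Lemma interior_extremum (g : R -> R) : {within `[0, 1], continuous g} -> g 0 = g 1 ->
  exists2 t0, 0 < t0 < 1 & (forall t, 0 <= t <= 1 -> g t0 <= g t) \/
                           (forall t, 0 <= t <= 1 -> g t <= g t0).
Proof.
move=> gc g01; have [m mI mP] := EVT_min ler01 gc; have [M MI MP] := EVT_max ler01 gc.
have inI t : 0 <= t <= 1 -> t \in `[0, 1]%R by rewrite in_itv.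
have [m01|m01] := boolP (0 < m < 1); first by exists m => //; left => t /inI/mP.
have [M01|M01] := boolP (0 < M < 1); first by exists M => //; right => t /inI/MP.
have edge t : t \in `[0, 1]%R -> ~~ (0 < t < 1) -> g t = g 0.
  rewrite in_itv /= => /andP[t0 t1]; rewrite negb_and -!leNgt => /orP[h|h].
    by congr g; apply/eqP; rewrite eq_le t0 h.
  by rewrite g01; congr g; apply/eqP; rewrite eq_le t1 h.
exists 2^-1; first by apply/andP; split; lra.
left=> t /inI tI; apply: le_trans (MP _ _) _; first by apply: inI; apply/andP; split; lra.
by rewrite (edge _ MI M01) -(edge _ mI m01); exact: mP.
Qed.

End Rolle.

(** * Subgradients and the mean value *)

Section Subgradients.
Variables (R : realType) (n : nat) (G : stratifiedGroup R n).
Variables (Omega : set 'rV[R]_n) (U : 'rV[R]_n -> R).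
Hypotheses (Omega_open : open Omega) (U_hconvex : hconvex G Omega U).
Hypothesis (U_continuous : forall x, Omega x -> U y @[y --> x] --> U x).
Variables (x : 'rV[R]_n) (Omega_x : Omega x).
Implicit Types (y z k h : 'rV[R]_n).

Local Notation "x '**' y" := (gmul G x y) (at level 40, left associativity).
Local Notation slope := (slope G Omega U x).
Local Notation quotient := (quotient G U x).

(** The slope is the limit of the difference quotients at zero; hence an error of first order in
    [v], which the quadratic part of the polynomial causes, does not matter. *)
Lemma slope_ge_germ k (a b delta : R) : H1 G k -> 0 < delta ->
  (forall v, 0 < v <= delta -> a - v * b <= quotient k v) -> a <= slope k.
Proof.
move=> hk delta0 h; apply: (slope_ge Omega_open Omega_x hk) => t adm.
have t0 : 0 < t by case: adm.
apply/ler_addgt0Pr => e e0; pose v := Num.min (Num.min t delta) (e / (`|b| + 1)).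
have b1 : 0 < `|b| + 1 by rewrite ltr_wpDl.
have v0 : 0 < v by rewrite !lt_min t0 delta0 divr_gt0.
have [vt [vd ve]] : v <= t /\ (v <= delta /\ v <= e / (`|b| + 1)).
  by rewrite /v !ge_min !lexx !orbT.
have hv : a - v * b <= quotient k v by apply: h; rewrite v0.
have mono : quotient k v <= quotient k t.
  by apply: (quotient_monotone U_hconvex hk _ adm); rewrite v0.
have vb : v * b <= e.
  apply: le_trans (_ : v * (`|b| + 1) <= _); last by rewrite -ler_pdivlMr.
  by rewrite ler_pM2l // ler_wpDr // ler_norm.
by lra.
Qed.

Lemma slope_le_germ k (a b delta : R) : H1 G k -> 0 < delta ->
  (forall v, 0 < v <= delta -> quotient k v <= a - v * b) -> slope k <= a.
Proof.
move=> hk delta0 h; have [tau tau0 adm] := admissible_small Omega_open Omega_x hk.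
apply/ler_addgt0Pr => e e0; pose v := Num.min (Num.min tau delta) (e / (`|b| + 1)).
have b1 : 0 < `|b| + 1 by rewrite ltr_wpDl.
have v0 : 0 < v by rewrite !lt_min tau0 delta0 divr_gt0.
have [vt [vd ve]] : v <= tau /\ (v <= delta /\ v <= e / (`|b| + 1)).
  by rewrite /v !ge_min !lexx !orbT.
have hv : quotient k v <= a - v * b by apply: h; rewrite v0.
have admv : admissible G Omega x k v by apply: adm; rewrite v0.
have := slope_le Omega_open U_hconvex Omega_x hk admv.
have vb : - (v * b) <= e.
  apply: le_trans (_ : v * (`|b| + 1) <= _); last by rewrite -ler_pdivlMr.
  by rewrite -mulrN ler_pM2l // ler_wpDr // -normrN ler_norm.
by lra.
Qed.

Lemma slope_sublinear : sublinear (fun v => slope (horizontal_part G v)).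
Proof.
have hp := @horizontal_part_H1 _ _ G; split=> [|u v|c u c0].
- rewrite (horizontal_part_id (@H10 _ _ G)).
  exact: (slope0 Omega_open U_hconvex Omega_x).
- rewrite horizontal_partD; exact: (slope_subadditive Omega_open U_hconvex U_continuous Omega_x).
- rewrite horizontal_partZ; exact: (slopeZ Omega_open U_hconvex Omega_x).
Qed.

(** Subgradients with a prescribed value in one direction: extend this value to a linear form
    below the slope. *)
Lemma subgradient_exists h (s : R) : H1 G h -> - slope (- h) <= s <= slope h ->
  exists w : 'rV[R]_n, \sum_i h 0 i * w 0 i = s /\
    forall k, H1 G k -> (forall a, 0 <= a <= 1 -> Omega (x ** (a *: k))) ->
      \sum_i k 0 i * w 0 i <= U (x ** k) - U x.
Proof.
move=> hh hs; have [|w [wle wh]] := @hahn_banach_row _ _ _ h s slope_sublinear.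
  by rewrite !horizontal_part_id //; exact: H1N.
exists w; split=> // k hk Ok; have := wle k; rewrite horizontal_part_id //.
move=> /le_trans; apply.
have adm : admissible G Omega x k 1 by split.
have := slope_le Omega_open U_hconvex Omega_x hk adm.
by rewrite /quotient scale1r divr1.
Qed.

End Subgradients.

Theorem theorem3p2 (R : realType) (n : nat) (G : stratifiedGroup R n)
    (ip : 'rV[R]_n -> 'rV[R]_n -> R) (ip_scalar : scalar_product G ip)
    (d : 'rV[R]_n -> 'rV[R]_n -> R) (d_homog : homogeneous_distance G d)
    (Omega : set 'rV[R]_n) (Omega_open : open Omega)
    (U : 'rV[R]_n -> R) (U_hconvex : hconvex G Omega U)
    (U_measurable : lebesgue_measurable_fun Omega U)
    (P : mpoly.mpoly n R) (P_deg : hdeg_le (deg G) P 2)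
    (u : 'rV[R]_n -> R)
    (uE : forall x, Omega x -> u x = U x + poly_fun P x) :
  forall x h : 'rV[R]_n, Omega x ->
    segment0 h `<=` H1 G `&` ltrans G (- x) Omega ->
    exists (t : R) (p : 'rV[R]_n),
      [/\ 0 <= t <= 1,
          subdifferential G ip d (lambda_max G d P) Omega u
            (gmul G x (dil (deg G) t h)) p &
          u (gmul G x h) - u x = ip p h].
Proof.
have U_continuous x : Omega x -> U y @[y --> x] --> U x.
  by move=> Ox; exact: (hconvex_continuous Omega_open U_hconvex U_measurable Ox).
have segP x k : segment0 k `<=` H1 G `&` ltrans G (- x) Omega ->
    H1 G k /\ forall a, 0 <= a <= 1 -> Omega (gmul G x (a *: k)).
  move=> sub; have inS a : 0 <= a <= 1 -> segment0 k (a *: k).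
    by move=> a01; exists a => //; rewrite /= in_itv.
  split.
    have /inS/sub[] : 0 <= (1 : R) <= 1 by rewrite ler01 lexx.
    by rewrite scale1r.
  by move=> a /inS/sub[_ [z Oz <-]]; rewrite gmulKN.
move=> x h Ox /segP[hh Oh].
(* Subtract the linear interpolation from the restriction of u to the segment. *)
pose c := u (gmul G x h) - u x.
pose g t := U (gmul G x (t *: h)) + poly_fun P (gmul G x (t *: h)) - t * c.
have gE t : 0 <= t <= 1 -> g t = u (gmul G x (t *: h)) - t * c.
  by move=> t01; rewrite uE //; exact: Oh.
have g01 : g 0 = g 1.
  rewrite !gE ?lexx ?ler01 // scale0r gmulx0 scale1r /c mul0r mul1r.
  ring.
have gc : {within `[0, 1], continuous g}.
  apply: continuous_in_subspaceT => t; rewrite inE /= in_itv /= => t01.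
  have [L _ LE] := poly_expansion x P_deg.
  rewrite (_ : g = fun t => U (gmul G x (t *: h)) + (poly_fun P x + t * L h
      + t ^+ 2 * homog_part (deg G) 2 P h) - t * c); last first.
    by apply/funext => s; rewrite /g LE.
  apply: cvgB; last by apply: cvgMr_tmp; exact: cvg_id.
  apply: cvgD.
    have cvt : (gmul G x (s *: h)) @[s --> t] --> gmul G x (t *: h).
      by apply: gmul_cvg; [exact: cvg_cst|apply: cvgZr_tmp; exact: cvg_id].
    exact: (cvg_comp _ _ cvt (U_continuous _ (Oh _ t01))).
  apply: cvgD; last by apply: cvgMr_tmp; exact: exprn_continuous.
  by apply: cvgD; [exact: cvg_cst|apply: cvgMr_tmp; exact: cvg_id].
have [t0 t01 ext] := interior_extremum gc g01.
have t01' : 0 <= t0 <= 1 by move: t01 => /andP[h1 h2]; rewrite !ltW.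
pose y := gmul G x (t0 *: h).
have Oy : Omega y by exact: Oh.
have [L Ll LE] := poly_expansion y P_deg.
pose b := homog_part (deg G) 2 P h.
have hN : H1 G (- h) by exact: H1N.
have incr v : g (t0 + v) - g t0 = U (gmul G y (v *: h)) - U y + v * (L h - c) + v ^+ 2 * b.
  have yE : gmul G x ((t0 + v) *: h) = gmul G y (v *: h) by rewrite /y -gmulA gmul_collinear.
  rewrite /g yE LE // -/y -/b; ring.
have quoE v : 0 < v -> quotient G U y h v = (g (t0 + v) - g t0) / v + (c - L h) - v * b.
  move=> v0; rewrite incr /quotient; field; by rewrite gt_eqF.
have quoNE v : 0 < v ->
    quotient G U y (- h) v = (g (t0 - v) - g t0) / v - (c - L h) - v * b.
  move=> v0; rewrite incr /quotient scalerN scaleNr; field; by rewrite gt_eqF.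
pose delta := Num.min t0 (1 - t0).
have delta0 : 0 < delta by move: t01 => /andP[h1 h2]; rewrite lt_min h1 subr_gt0.
have inI v : 0 < v <= delta -> 0 <= t0 + v <= 1 /\ 0 <= t0 - v <= 1.
  rewrite le_min => /and3P[v0 v1 v2]; move: t01 => /andP[h1 h2].
  by split; apply/andP; split; lra.
(* At a minimum the two one-sided slopes of g are nonnegative. At a maximum they are
   nonpositive, hence zero, as the sum of two opposite slopes of U is nonnegative. *)
have slopes : - slope G Omega U y (- h) <= c - L h <= slope G Omega U y h.
  case: ext => ext.
    apply/andP; split; last first.
      apply: (slope_ge_germ Omega_open U_hconvex Oy (b := b) hh delta0) => v vd.
      have /andP[v0 _] := vd; have [h1 _] := inI v vd.
      have q0 : 0 <= (g (t0 + v) - g t0) / v by rewrite divr_ge0 ?subr_ge0 ?(ltW v0) //; exact: ext.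
      by rewrite quoE //; lra.
    rewrite lerNl.
    apply: (slope_ge_germ Omega_open U_hconvex Oy (b := b) hN delta0) => v vd.
    have /andP[v0 _] := vd; have [_ h1] := inI v vd.
    have q0 : 0 <= (g (t0 - v) - g t0) / v by rewrite divr_ge0 ?subr_ge0 ?(ltW v0) //; exact: ext.
    by rewrite quoNE //; lra.
  have s1 : slope G Omega U y h <= c - L h.
    apply: (slope_le_germ Omega_open U_hconvex Oy (b := b) hh delta0) => v vd.
    have /andP[v0 _] := vd; have [h1 _] := inI v vd.
    have q0 : (g (t0 + v) - g t0) / v <= 0
      by rewrite pmulr_lle0 ?invr_gt0 // subr_le0; exact: ext.
    by rewrite quoE //; lra.
  have s2 : slope G Omega U y (- h) <= - (c - L h).
    apply: (slope_le_germ Omega_open U_hconvex Oy (b := b) hN delta0) => v vd.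
    have /andP[v0 _] := vd; have [_ h1] := inI v vd.
    have q0 : (g (t0 - v) - g t0) / v <= 0
      by rewrite pmulr_lle0 ?invr_gt0 // subr_le0; exact: ext.
    by rewrite quoNE //; lra.
  have := slope_subadditive Omega_open U_hconvex U_continuous Oy hh hN.
  rewrite subrr (slope0 Omega_open U_hconvex Oy) => s3.
  by apply/andP; split; lra.
have [w [wh wP]] := subgradient_exists Omega_open U_hconvex U_continuous Oy hh slopes.
have LZ a v : L (a *: v) = a * L v.
  have L0 : L 0 = 0 by have := Ll 1 0 0; rewrite scaler0 addr0 mul1r; lra.
  by rewrite -[a *: v]addr0 Ll L0 addr0.
have Lsum v : L v = \sum_i v 0 i * L (delta_mx 0 i).
  rewrite {1}(row_sum_delta v); apply: (big_ind2 (fun z a => L z = a)) => //.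
  - by have := LZ 0 0; rewrite scale0r mul0r.
  - by move=> z1 a1 z2 a2 <- <-; rewrite -[z1]scale1r Ll mul1r scale1r.
(* The linear term of P at y has to be added to the subgradient of U. *)
have [p [hp pE]] := riesz_H1 ip_scalar (\row_i (w 0 i + L (delta_mx 0 i))).
have {}pE k : H1 G k -> ip p k = \sum_i k 0 i * w 0 i + L k.
  move=> hk; rewrite pE // Lsum -big_split /=; apply: eq_bigr => i _.
  by rewrite mxE mulrDr.
exists t0, p; rewrite dil_H1 // -/y; split=> //; last first.
  by rewrite pE // wh subrK.
split=> // k /segP[hk Ok]; have := wP k hk Ok.
have Oyk : Omega (gmul G y k) by have := Ok 1; rewrite scale1r; apply; rewrite ler01 lexx.
rewrite !uE // pE //.
have := LE k 1 hk; rewrite scale1r mul1r expr1n mul1r => ->.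
have := homog_part_ge d_homog P hk; lra.
Qed.
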